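(* Let $N\in\mathbb{N}$, $m_i\in(0,\infty)$ and $a_i,b_i\in[0,\infty)$ for all $i\in[N]$. Let $\eta=(\eta(t))_{t\ge0}$ be the Markov chain of inter-particle distances of the elastic particle system with these parameters. Then the Markov chain $\eta$ on $\mathbb{Z}_+^{N-1}$ is positive recurrent if and only if $$\frac{U_k}{M_k}<\frac{U_N}{M_N},\quad\text{for all } k\in[N-1].$$ If positive recurrent, then $\eta$ is geometrically ergodic, meaning that the stationary distribution has a finite exponential moment.
   Context: Notation: $[n]=\{1,2,\dots,n\}$, $\mathbb{N}=\{1,2,\dots\}$, $\mathbb{Z}_+=\{0,1,2,\dots\}$, and $\mathbb{X}_N=\{(x_i)_{i\in[N]}\in\mathbb{Z}^N: x_1\le\cdots\le x_N\}$. Elastic particle system: the continuous-time Markov chain $X(t)=(X_i(t))_{i\in[N]}$ on $\mathbb{X}_N$ in which, for each $i\in[N]$, coordinate $X_i(t)$ jumps to $X_i(t)-1$ at rate $A_i(X(t))$ and to $X_i(t)+1$ at rate $B_i(X(t))$, where for $x\in\mathbb{X}_N$ $$A_i(x)=\mathbf{1}\{x_{i-1}<x_i\}\sum_{j=i}^N\frac{m_ja_j}{m_i}\mathbf{1}\{x_j=x_i\},\qquad B_i(x)=\mathbf{1}\{x_{i+1}>x_i\}\sum_{j=1}^i\frac{m_jb_j}{m_i}\mathbf{1}\{x_j=x_i\},$$ with conventions $x_0=-\infty$, $x_{N+1}=+\infty$. Set $u_i=b_i-a_i$, and $U_k=-\sum_{i=1}^k m_iu_i$, $M_k=\sum_{i=1}^k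 m_i$ for $k\in[N]$. The inter-particle distance process is $\eta(t)=(\eta_i(t))_{i\in[N-1]}\in\mathbb{Z}_+^{N-1}$ with $\eta_i(t)=X_{i+1}(t)-X_i(t)$; it is itself a continuous-time Markov chain. *)

(* Defs.v *)
From mathcomp Require Import all_boot all_order all_algebra.
From mathcomp Require Import all_classical all_reals all_analysis.
From mathcomp Require Import measurable_realfun.

Set Implicit Arguments.
Unset Strict Implicit.
Unset Printing Implicit Defensive.

Import Order.TTheory GRing.Theory Num.Theory.

Local Open Scope classical_set_scope.
Local Open Scope ring_scope.

(* Continuous-time Markov chains on a countable state space, as families of
   laws (P x) on a common sample space, P x being the law of the chain started
   at x.  Only the off-diagonal values of the rates q are used. *)
Section jump_process.
Context {R : realType} {S : countType}.
Variable q : S -> S -> R.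

Definition exit_rate (x : S) : R :=
  fine (\esum_(y in [set y | y != x]) (q x y)%:E)%E.

(* An absorbing state is given the jump law concentrated on itself and, in
   [is_jump_process], an infinite holding time. *)
Definition jump_prob (x y : S) : R :=
  if exit_rate x == 0 then (x == y)%:R else (x != y)%:R * q x y / exit_rate x.

Context {d : measure_display} {Omega : measurableType d}.

(* X follows the embedded chain Y, staying in Y n for the time W n.  Under P x,
   Y is the discrete-time chain with transition matrix jump_prob and Y 0 = x,
   and given Y the W n are independent exponentials of rates exit_rate (Y n).
   Every path is non-explosive. *)
Definition is_jump_process (P : S -> probability Omega R)
    (X : R -> Omega -> S) : Prop :=
  exists (Y : nat -> Omega -> S) (W : nat -> Omega -> \bar R),
    let J n w : \bar R := (\sum_(k < n) W k w)%E in
    [/\ (forall n y, measurable [set w | Y n w = y])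
          /\ (forall n, measurable_fun [set: Omega] (W n)),
        forall n w, (0 < W n w)%E,
        forall w (t : R), exists n, (t%:E < J n w)%E,
        forall w n (t : R), (J n w <= t%:E)%E -> (t%:E < J n.+1 w)%E ->
          X t w = Y n w
      & forall (x : S) (n : nat) (y : nat -> S) (s : nat -> R),
          (forall k, 0 <= s k) ->
          P x [set w | forall k, (k <= n)%N ->
                         Y k w = y k /\ ((s k)%:E < W k w)%E] =
          ((x == y 0)%:R
           * \prod_(k < n) jump_prob (y k) (y k.+1)
           * \prod_(k < n.+1) expR (- (exit_rate (y k) * s k)))%:E].

End jump_process.

Section recurrence.
Context {R : realType} {S : countType} {d : measure_display}
  {Omega : measurableType d}.
Variables (P : S -> probability Omega R) (Z : R -> Omega -> S).

Definition hits (z : S) (w : Omega) : Prop := exists2 t : R, 0 <= t & Z t w = z.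

(* First time at z after having been away from z; +oo if there is none. *)
Definition return_time (z : S) (w : Omega) : \bar R :=
  ereal_inf [set t%:E | t in [set t : R |
    (exists s : R, [/\ 0 <= s, s < t & Z s w <> z]) /\ Z t w = z]].

Definition absorbing (z : S) : Prop :=
  {ae P z, forall w, forall t : R, 0 <= t -> Z t w = z}.

Definition positive_recurrent_state (z : S) : Prop :=
  absorbing z \/ (\int[P z]_w return_time z w < +oo)%E.

(* The chain need not be irreducible, as some of its rates may vanish; this is
   positive (Harris) recurrence: there is one positive recurrent class, and it
   is reached almost surely from every state.  For an irreducible chain it says
   that every state is positive recurrent. *)
Definition positive_recurrent : Prop :=
  exists z, positive_recurrent_state z
    /\ forall x, {ae P x, forall w, hits z w}.

Definition stationary (pi : S -> R) : Prop :=
  [/\ forall z, 0 <= pi z,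
      (\esum_(z in [set: S]) (pi z)%:E = 1)%E
    & forall (t : R) (y : S), 0 <= t ->
        (\esum_(z in [set: S]) ((pi z)%:E * P z [set w | Z t w = y])
         = (pi y)%:E)%E].

End recurrence.

(* There are N = n.+1 particles, indexed from 0, hence n gaps. *)

Definition ordered n (x : {ffun 'I_n.+1 -> int}) : bool :=
  [forall i : 'I_n.+1, forall j : 'I_n.+1, (i <= j)%N ==> (x i <= x j)].

Definition config n := {x : {ffun 'I_n.+1 -> int} | ordered x}.

Section elastic.
Context {R : realType} {n : nat}.
Variables m a b : 'I_n.+1 -> R.
Implicit Types (x y : config n) (i j : 'I_n.+1).

(* The leading indicators hold for the first, respectively last, particle,
   which has no neighbour on that side. *)
Definition rateA x i : R :=
  [forall j : 'I_n.+1, (j.+1 == i :> nat) ==> (val x j < val x i)]%:R *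
  \sum_(j < n.+1 | (i <= j)%N) m j * a j / m i * (val x j == val x i)%:R.

Definition rateB x i : R :=
  [forall j : 'I_n.+1, (j == i.+1 :> nat) ==> (val x i < val x j)]%:R *
  \sum_(j < n.+1 | (j <= i)%N) m j * b j / m i * (val x j == val x i)%:R.

Definition elastic_rate x y : R :=
  \sum_i (rateA x i * (val y == [ffun j => val x j - (j == i)%:R])%:R
        + rateB x i * (val y == [ffun j => val x j + (j == i)%:R])%:R).

Definition Umass (k : nat) : R := - \sum_(i < n.+1 | (i < k)%N) m i * (b i - a i).

Definition Mmass (k : nat) : R := \sum_(i < n.+1 | (i < k)%N) m i.

End elastic.

Section gaps.
Context {n : nat}.

(* [lift ord0 i] has value i.+1 and [lift ord_max i] has value i. *)
Definition gap (x : config n) : {ffun 'I_n -> nat} :=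
  [ffun i => absz (val x (lift ord0 i) - val x (lift ord_max i))].

Definition anchored_fun (z : {ffun 'I_n -> nat}) : {ffun 'I_n.+1 -> int} :=
  [ffun i : 'I_n.+1 => (\sum_(j < n | (j < i)%N) z j)%N%:Z].

Lemma anchored_ordered z : ordered (anchored_fun z).
Proof.
apply/forallP => i; apply/forallP => j; apply/implyP => ij.
rewrite !ffunE lez_nat [leqRHS](bigID (fun k : 'I_n => (k < i)%N)) /=.
apply: leq_trans (leq_addr _ _).
rewrite [leqRHS](eq_bigl (fun k : 'I_n => (k < i)%N)) // => k.
by apply: andb_idl => /leq_trans; apply.
Qed.

(* The configuration with gaps z and first particle at 0.  The rates being
   translation invariant, the position of the first particle is immaterial to
   the law of the gaps. *)
Definition anchored (z : {ffun 'I_n -> nat}) : config n :=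
  exist _ (anchored_fun z) (anchored_ordered z).

Lemma anchoredK : cancel anchored gap.
Proof.
move=> z; apply/ffunP => i; rewrite /gap /anchored /= !ffunE.
rewrite (bigD1 i) ?lift0 //= PoszD.
rewrite [in X in _ + X - _](eq_bigl (fun j : 'I_n => (j < lift ord_max i)%N)).
  by rewrite addrK.
by move=> j; rewrite lift_max ltnS andbC ltn_neqAle.
Qed.

Definition finite_exp_moment {R : realType} (pi : {ffun 'I_n -> nat} -> R) :=
  exists2 theta : R, 0 < theta &
    (\esum_(z in [set: {ffun 'I_n -> nat}])
       (pi z * expR (theta * (\sum_i z i)%:R))%:E < +oo)%E.

(* Geometric ergodicity in the sense that the unique stationary distribution
   has a finite exponential moment. *)
Definition geometrically_ergodic {R : realType} {d : measure_display}
    {Omega : measurableType d}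
    (P : {ffun 'I_n -> nat} -> probability Omega R)
    (Z : R -> Omega -> {ffun 'I_n -> nat}) : Prop :=
  exists pi, [/\ stationary P Z pi,
                 forall pi', stationary P Z pi' -> pi' =1 pi
               & finite_exp_moment pi].

End gaps.

(* Main.v *)
(* A jump transferred within a cluster takes place at the site of its original
   owner, so sum_i m_i (B_i - A_i) g(x_i) = sum_j m_j (b_j - a_j) g(x_j) for
   every g: whatever the clusters, functionals of the positions drift as if the
   particles were free.

   Let c_k = (M_k / M_N) U_N - U_k, so that the condition reads c_k > 0.  If
   c_k > 0 for all k, then for small theta the function
   V = (sum_j m_j e^(theta x_j)) (sum_j m_j e^(- theta x_j)) of the gaps
   satisfies a geometric drift inequality off a finite set, because by Abel
   summation the first-order part of its drift is governed by the c_k.  The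
   collapsed configuration is reachable from everywhere, as b_1 > 0 or a_N > 0,
   and V can be corrected so as to drift off that single state.  This bounds the
   return time, and also the V-moment of the occupation measure of an excursion,
   which is proportional to the stationary distribution.

   Conversely, if c_k <= 0, then D_k = (M_k / M_N) sum_j m_j x_j - sum_(j <= k)
   m_j x_j is a submartingale that every jump changes.  If z is positive
   recurrent, optional stopping at the return to z shows that no jump out of z
   can increase D_k; so all of them decrease it, against the submartingale
   property at z. *)
Require Import Defs.
From mathcomp Require Import all_boot all_order all_algebra.
From mathcomp Require Import all_classical all_reals all_analysis.
From mathcomp Require Import measurable_realfun ring lra zify.

Set Implicit Arguments.
Unset Strict Implicit.
Unset Printing Implicit Defensive.

Import Order.TTheory GRing.Theory Num.Theory.
Import numFieldNormedType.Exports.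

Local Open Scope classical_set_scope.
Local Open Scope ring_scope.

(** A chain is known only through the probabilities of events that fix finitely many states and
    bound the holding times from below; a Markov property of [X] is not given. Recurrence is
    therefore settled on the embedded chain killed at a state and carried over to continuous time by
    counting sojourns, with exit rates bounded above and, under a drift condition, below.

    Stationarity does involve [X t]. Exact transition probabilities are avoided: keeping only the
    paths with at most one jump bounds the law at time t + h from below by an explicit kernel, up to
    O(h^2). This yields pi <= pi P_t, and equality because both sides have mass one. The same
    comparison of masses, applied to the minimum of two stationary laws, gives uniqueness.

    Some a_i and b_i may vanish, so the gaps need not be irreducible: sufficiency and uniqueness
    rest on the reachability of the collapsed state alone. Two cases are treated apart: a single
    particle, and all rates zero, where every state is absorbing. With at least two particles every
    jump changes the gaps, so these form a jump process with the same holding times as the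
    particles. *)

Section esum_extra.
Context {R : realType} {T : choiceType}.
Implicit Types (a : T -> \bar R) (D : set T).

Lemma ge0_esumZl (k : R) D a : 0 <= k -> (forall x, D x -> (0 <= a x)%E) ->
  (\esum_(x in D) (k%:E * a x) = k%:E * \esum_(x in D) a x)%E.
Proof.
have half (l : R) (b : T -> \bar R) : 0 < l -> (forall x, D x -> (0 <= b x)%E) ->
    (\esum_(x in D) (l%:E * b x) <= l%:E * \esum_(x in D) b x)%E.
  move=> l0 b0; apply: ge_ereal_sup => _ [A [fA AD] <-].
  rewrite fsbig_finite//= big_seq -ge0_sume_distrr; last first.
    by move=> i; rewrite in_fset_set// inE => /AD/b0.
  rewrite lee_pmul2l// -big_seq -fsbig_finite//.
  by apply: ereal_sup_ubound; exists A.
move=> k0 a0; have [->|k_neq0] := eqVneq k 0.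
  by rewrite mul0e esum1// => i _; rewrite mul0e.
have kp : 0 < k by rewrite lt_neqAle eq_sym k_neq0.
apply/eqP; rewrite eq_le half//=.
have := @half k^-1 (fun x => k%:E * a x)%E.
rewrite invr_gt0 => /(_ kp).
have ka0 x : D x -> (0 <= k%:E * a x)%E by move=> /a0 ?; rewrite mule_ge0.
move=> /(_ ka0); rewrite (_ : \esum_(_ in _) _ = \esum_(x in D) a x)%E; last first.
  by apply: eq_esum => x _; rewrite muleA -EFinM mulVf// mul1e.
move=> /(lee_wpmul2l (_ : (0 <= k%:E)%E)); rewrite lee_fin => /(_ k0).
by rewrite muleA -EFinM divff// mul1e.
Qed.

Lemma esum_delta (k : \bar R) (x : T) : (0 <= k)%E ->
  (\esum_(y in [set: T]) (if y == x then k else 0) = k)%E.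
Proof.
move=> k0; rewrite -[RHS](@esum_set1 _ _ x (fun=> k))//.
rewrite [RHS]esum_mkcond; apply: eq_esum => y _.
by rewrite in_set1.
Qed.

Lemma esum_exchange (U : choiceType) (a : T -> U -> \bar R) :
  (forall x y, (0 <= a x y)%E) ->
  (\esum_(x in [set: T]) \esum_(y in [set: U]) a x y =
   \esum_(y in [set: U]) \esum_(x in [set: T]) a x y)%E.
Proof.
move=> a0; rewrite !esum_esum//.
rewrite (reindex_esum (setT `*`` (fun=> setT)) _ (fun x : U * T => (x.2, x.1)))//.
split => //= [[x y] [x' y'] _ _ [-> ->]//|[x y] _].
by exists (y, x).
Qed.

Lemma esum_ge1 a x : (forall x, (0 <= a x)%E) ->
  (a x <= \esum_(y in [set: T]) a y)%E.
Proof.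
move=> a0; apply: esum_ge; exists [set x]; first by split.
by rewrite fsbig_set1.
Qed.

End esum_extra.

Section measure_extra.
Context {R : realType} {d : measure_display} {Omega : measurableType d}.
Implicit Types (mu : {measure set Omega -> \bar R}).

Lemma measure_partition (S : countType) mu (Y : Omega -> S) (E : set Omega) :
  (forall y, measurable [set w | Y w = y]) -> measurable E ->
  mu E = (\esum_(y in [set: S]) mu (E `&` [set w | Y w = y]))%E.
Proof.
move=> mY mE.
have mF k : measurable (E `&` [set w | pickle (Y w) = k]).
  apply: measurableI => //.
  case: (pselect (exists y : S, pickle y = k)) => [[y <-]|nk].
    rewrite (_ : mkset _ = [set w | Y w = y])//.
    by apply/seteqP; split => w /=; [apply: pcan_inj pickleK _ _|move=> ->].
  rewrite (_ : mkset _ = set0)//; apply/seteqP; split => w //= kY.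
  by apply: nk; exists (Y w).
have -> : E = \bigcup_k (E `&` [set w | pickle (Y w) = k]).
  apply/seteqP; split => [w Ew|w [k _ []]//].
  by exists (pickle (Y w)).
rewrite measure_semi_bigcup//; last 2 first.
- by move=> i j _ _ [w [[_ /= <-] [_ /= <-]]].
- exact: bigcupT_measurable.
rewrite nneseries_esumT//.
rewrite -setI_bigcupr [X in _ `&` X](_ : _ = setT) ?setIT; last first.
  by apply/seteqP; split => // w _; exists (pickle (Y w)).
rewrite [LHS](_ : _ = \esum_(k in pickle @` [set: S])
    mu (E `&` [set w | pickle (Y w) = k]))%E; last first.
  rewrite [RHS]esum_mkcond; apply: eq_esum => k _; case: ifPn => // /negP.
  rewrite inE => nk; rewrite (_ : _ `&` _ = set0) ?measure0//.
  apply/seteqP; split => w //= [_ kY].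
  by apply: nk; exists (Y w).
rewrite esum_image; last by move=> x y _ _; apply: pcan_inj pickleK _ _.
apply: eq_esum => y _; congr (mu (_ `&` _)).
by apply/seteqP; split => w /=; [apply: pcan_inj pickleK _ _|move=> ->].
Qed.

(** Meant for [return_time], an infimum over uncountably many times whose measurability is not at
    hand: the integral of a nonnegative function is a supremum over the simple functions below it,
    hence monotone. *)
Lemma ge0_le_integral_nomeas mu (f g : Omega -> \bar R) :
  (forall w, (0 <= f w)%E) -> (forall w, (f w <= g w)%E) ->
  (\int[mu]_w f w <= \int[mu]_w g w)%E.
Proof.
move=> f0 fg; have g0 w : (0 <= g w)%E by apply: le_trans (fg w).
rewrite !ge0_integralTE//; apply: le_ereal_sup => _ [h /= hf <-].
by exists h => // w; apply: le_trans (fg w).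
Qed.

End measure_extra.

(** * Chains with finitely many moves *)

Lemma measurable_countable_preimage {d : measure_display}
    {Omega : measurableType d} (S : countType) (Y : Omega -> S) (Q : set S) :
  (forall y, measurable [set w | Y w = y]) -> measurable [set w | Q (Y w)].
Proof.
move=> mY.
rewrite (_ : mkset _ = \bigcup_k [set w | Q (Y w) /\ pickle (Y w) = k]).
  apply: bigcupT_measurable => k.
  case: (pselect (exists2 y : S, Q y & pickle y = k)) => [[y Qy <-]|nk].
    rewrite (_ : mkset _ = [set w | Y w = y])//.
    apply/seteqP; split => w /=; last by move=> ->.
    by move=> [_]; apply: pcan_inj pickleK _ _.
  rewrite (_ : mkset _ = set0)//; apply/seteqP; split => w //= -[QY kY].
  by apply: nk; exists (Y w).
apply/seteqP; split => w /=; last by move=> [k _ []].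
by move=> QY; exists (pickle (Y w)).
Qed.

Section finite_moves.
Context {R : realType} {S : countType} {I : finType}.
Variables (r : S -> I -> R) (mv : S -> I -> S).

(** Distinct moves may lead to the same state, hence the sum. Indexing jumps by a finite type turns
    the expectation over the next state into the finite sum [step]. *)
Definition move_rate (x y : S) : R := \sum_i r x i * (y == mv x i)%:R.

Definition tot (x : S) : R := \sum_i r x i.

Definition step (f : S -> R) (x : S) : R := (\sum_i r x i * f (mv x i)) / tot x.

Definition jump (x y : S) : R := move_rate x y / tot x.

(** Moves of nonzero rate change the state, which makes [tot] the exit rate; no state is
    absorbing. *)
Definition regular_moves : Prop :=
  [/\ forall x i, 0 <= r x i, forall x i, r x i != 0 -> mv x i != x
    & forall x, 0 < tot x].

Hypothesis reg : regular_moves.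

Let r_ge0 x i : 0 <= r x i. Proof. by case: reg. Qed.
Let tot_gt0 x : 0 < tot x. Proof. by case: reg. Qed.

Lemma jump_ge0 x y : 0 <= jump x y.
Proof.
apply: divr_ge0 (ltW (tot_gt0 x)); apply: sumr_ge0 => i _.
by rewrite mulr_ge0.
Qed.

Lemma step_ge0 f x : (forall y, 0 <= f y) -> 0 <= step f x.
Proof.
move=> f0; apply: divr_ge0 (ltW (tot_gt0 x)); apply: sumr_ge0 => i _.
by rewrite mulr_ge0.
Qed.

Lemma le_step f g x : (forall i, r x i != 0 -> f (mv x i) <= g (mv x i)) ->
  step f x <= step g x.
Proof.
move=> fg; rewrite ler_pM2r ?invr_gt0//; apply: ler_sum => i _.
have [->|/fg] := eqVneq (r x i) 0; first by rewrite !mul0r.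
exact: ler_wpM2l.
Qed.

Lemma eq_step f g x : f =1 g -> step f x = step g x.
Proof. by move=> fg; congr (_ / _); apply: eq_bigr => i _; rewrite fg. Qed.

Lemma stepZ k f x : step (fun y => k * f y) x = k * step f x.
Proof.
rewrite /step mulrA; congr (_ / _); rewrite mulr_sumr.
by apply: eq_bigr => i _; rewrite mulrCA.
Qed.

Lemma stepD f g x : step (fun y => f y + g y) x = step f x + step g x.
Proof.
rewrite /step -mulrDl -big_split/=; congr (_ / _).
by apply: eq_bigr => i _; rewrite mulrDr.
Qed.

Lemma step_cst k x : step (fun=> k) x = k.
Proof. by rewrite /step -mulr_suml -/(tot x) mulrAC divff ?mul1r// gt_eqF. Qed.

Lemma step_sum (J : Type) (s : seq J) (F : J -> S -> R) x :
  step (fun y => \sum_(j <- s) F j y) x = \sum_(j <- s) step (F j) x.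
Proof.
rewrite /step; under eq_bigr do rewrite mulr_sumr.
by rewrite exchange_big/= mulr_suml.
Qed.

Lemma step_delta y x : step (fun z => (y == z)%:R) x = jump x y.
Proof. by []. Qed.

Lemma esum_jump (f : S -> R) x : (forall y, 0 <= f y) ->
  (\esum_(y in [set: S]) (jump x y * f y)%:E = (step f x)%:E)%E.
Proof.
move=> f0; rewrite (eq_esum (b := fun y => \sum_(i <- index_enum I)
    (r x i * (y == mv x i)%:R * ((tot x)^-1 * f y))%:E)%E); last first.
  by move=> y _; rewrite /jump /move_rate -mulrA mulr_suml -sumEFin.
rewrite esum_sum; last first.
  move=> y i _ _; rewrite lee_fin mulr_ge0 ?mulr_ge0//.
  by rewrite invr_ge0 ltW.
rewrite /step mulr_suml -sumEFin; apply: eq_bigr => i _.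
rewrite -[RHS](esum_delta (mv x i)); last first.
  by rewrite lee_fin mulr_ge0 ?mulr_ge0// invr_ge0 ltW.
apply: eq_esum => y _; case: eqP => [->|_]; last by rewrite mulr0 mul0r.
by rewrite mulr1 -mulrA [f _ * _]mulrC.
Qed.

Lemma exit_rate_tot x : exit_rate move_rate x = tot x.
Proof.
have [_ mv_neq _] := reg.
rewrite /exit_rate.
rewrite (_ : \esum_(y in _) _ = (tot x)%:E)%E//.
rewrite -[RHS](_ : \esum_(y in [set: S]) (jump x y * tot x)%:E = _)%E; last first.
  rewrite esum_jump; first by rewrite step_cst.
  by move=> _; exact: ltW.
rewrite esum_mkcond; apply: eq_esum => y _.
rewrite /jump -mulrA mulVf ?mulr1 ?gt_eqF//.
case: ifPn => //; rewrite notin_setE/= => /negP; rewrite negbK => /eqP ->.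
congr (_ %:E); rewrite /move_rate big1// => i _; case: eqP => [xi|]; last by rewrite mulr0.
by have [->|/mv_neq] := eqVneq (r x i) 0; rewrite ?mul0r// -xi eqxx.
Qed.

Lemma jump_probE x y : jump_prob move_rate x y = jump x y.
Proof.
have [_ mv_neq _] := reg.
rewrite /jump_prob exit_rate_tot gt_eqF// /jump.
have [->|_] := eqVneq x y; last by rewrite mul1r.
rewrite !mul0r /move_rate big1 ?mul0r// => i _.
case: eqP => [xi|]; last by rewrite mulr0.
by have [->|/mv_neq] := eqVneq (r y i) 0; rewrite ?mul0r// -xi eqxx.
Qed.

(* The joint law of Y and W tested on products of state predicates and tails. *)
Fixpoint cyl n (A : nat -> pred S) (s : nat -> R) (x : S) : R :=
  (A 0 x)%:R * expR (- (tot x * s 0)) *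
  (if n is n'.+1 then step (cyl n' (A \o succn) (s \o succn)) x else 1).

Lemma cyl_ge0 n A s x : 0 <= cyl n A s x.
Proof.
elim: n A s x => [|n IH] A s x /=; rewrite ?mulr1.
  by rewrite mulr_ge0// expR_ge0.
apply: mulr_ge0; first by rewrite mulr_ge0 ?expR_ge0.
by apply: step_ge0 => y; exact: IH.
Qed.

Context {d : measure_display} {Omega : measurableType d}.
Variables (P : S -> probability Omega R) (Y : nat -> Omega -> S)
  (W : nat -> Omega -> \bar R).
Hypothesis mY : forall n y, measurable [set w | Y n w = y].
Hypothesis mW : forall n, measurable_fun [set: Omega] (W n).

Lemma measurable_tail n (s : R) : measurable [set w | (s%:E < W n w)%E].
Proof. by rewrite -[mkset _]setTI; exact: emeasurable_fun_o_infty. Qed.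

Lemma measurable_state n (Q : set S) : measurable [set w | Q (Y n w)].
Proof. exact: measurable_countable_preimage. Qed.

Hypothesis law : forall (x : S) (n : nat) (y : nat -> S) (s : nat -> R),
  (forall k, 0 <= s k) ->
  P x [set w | forall k, (k <= n)%N -> Y k w = y k /\ ((s k)%:E < W k w)%E] =
  ((x == y 0)%:R * \prod_(k < n) jump_prob move_rate (y k) (y k.+1)
   * \prod_(k < n.+1) expR (- (exit_rate move_rate (y k) * s k)))%:E.

Let pre j (c : nat -> S) (s : nat -> R) x : R :=
  (x == c 0)%:R * \prod_(k < j) jump (c k) (c k.+1)
   * \prod_(k < j.+1) expR (- (tot (c k) * s k)).

Let ev j (c : nat -> S) l (A : nat -> pred S) (s : nat -> R) : set Omega :=
  [set w | forall k, (k <= j)%N -> Y k w = c k] `&`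
  ([set w | forall k, (k < l)%N -> A k (Y (j + k).+1 w)] `&`
   [set w | forall k, (k <= j + l)%N -> ((s k)%:E < W k w)%E]).

Let measurable_ev j c l A s : measurable (ev j c l A s).
Proof.
apply: measurableI.
  exact: (@bigcap_measurableType _ _ (fun k => [set w | Y k w = c k])
    [set k | (k <= j)%N]).
apply: measurableI.
  apply: (@bigcap_measurableType _ _ (fun k => [set w | A k (Y (j + k).+1 w)])
    [set k | (k < l)%N]) => k _.
  exact: (@measurable_state (j + k).+1 [set y | A k y]).
apply: (@bigcap_measurableType _ _ (fun k => [set w | ((s k)%:E < W k w)%E])
    [set k | (k <= j + l)%N]) => k _.
exact: measurable_tail.
Qed.

(** [law] evaluates only events that pin every state. Here the states up to j are pinned to c and
    the next l merely satisfy predicates; partitioning by the value of [Y j.+1] pins one more state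
    and lowers l. *)
Let law_ev x l j c A s : (forall k, 0 <= s k) ->
  P x (ev j c l A s) = (pre j c s x *
    if l is l'.+1 then step (cyl l' A (fun k => s (j + k).+1)) (c j) else 1)%:E.
Proof.
move=> s0; elim: l => [|l IH] in j c A *.
  rewrite mulr1 (_ : ev j c 0 A s = [set w | forall k, (k <= j)%N ->
      Y k w = c k /\ ((s k)%:E < W k w)%E]); last first.
    rewrite /ev addn0; apply/seteqP; split => w /=.
      by move=> [Yc [_ sW]] k kj; split; [exact: Yc|exact: sW].
    by move=> h; split => [k /h[]//|]; split => // k /h[].
  rewrite law// /pre; congr (_ * _ * _)%:E; apply: eq_bigr => k _.
    exact: jump_probE.
  by rewrite exit_rate_tot.
rewrite (measure_partition _ (mY j.+1))//.
pose c' v k := if (k <= j)%N then c k else v.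
have evE v : ev j c l.+1 A s `&` [set w | Y j.+1 w = v] =
    if A 0 v then ev j.+1 (c' v) l (A \o succn) s else set0.
  case: ifPn => [A0v|nA0v].
    rewrite /ev; apply/seteqP; split => w /=.
      move=> [[Yc [AY sW]] Yv]; split=> [k|]; last first.
        split=> k; last by rewrite addSnnS; exact: sW.
        by move=> kl; rewrite addSnnS; exact: AY.
      rewrite leq_eqVlt => /predU1P[->|]; first by rewrite /c' ltnn.
      by rewrite ltnS => kj; rewrite /c' kj; exact: Yc.
    move=> [Yc [AY sW]]; split; last first.
      by rewrite Yc// /c' ltnn.
    split=> [k kj|]; first by rewrite Yc ?leqW// /c' kj.
    split=> [[_|k]|k]; last 2 first.
    - by rewrite ltnS => /AY; rewrite addSnnS.
    - by rewrite -addSnnS; exact: sW.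
    - by rewrite addn0 Yc// /c' ltnn.
  apply/seteqP; split => w //= -[[_ [/(_ 0%N (ltn0Sn _))]]].
  by rewrite addn0 => AY _ Yv; move: nA0v; rewrite -Yv AY.
have pre' v : pre j.+1 (c' v) s x =
    pre j c s x * (jump (c j) v * expR (- (tot v * s j.+1))).
  rewrite /pre big_ord_recr/= [\prod_(k < j.+2) _]big_ord_recr/=.
  rewrite /c' /= leqnn ltnn.
  rewrite (eq_bigr (fun k : 'I_j => jump (c k) (c k.+1))); last first.
    by move=> k _; rewrite ltn_ord (ltnW (ltn_ord k)).
  rewrite (eq_bigr (fun k : 'I_j.+1 => expR (- (tot (c k) * s k)))); last first.
    by move=> k _; rewrite -ltnS ltn_ord.
  by ring.
rewrite (eq_esum (b := fun v => ((pre j c s x)%:E * (jump (c j) v *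
    cyl l A (fun k => s (j + k).+1) v)%:E)%E)); last first.
  move=> v _; rewrite evE -EFinM; case: ifPn => A0v; last first.
    by rewrite measure0; case: (l) => [|l'] /=; rewrite (negbTE A0v) !mul0r !mulr0.
  apply: etrans (IH j.+1 (c' v) (A \o succn)) _; rewrite pre'; congr _%:E; rewrite -!mulrA; congr (_ * (_ * _)).
  case: (l) => [|l'] /=; rewrite A0v mul1r addn0//.
  rewrite /c' ltnn; do 4 congr (_ * _).
  by congr (step (cyl _ _ _) _); apply/funext => k /=; rewrite addSnnS.
rewrite ge0_esumZl; last 2 first.
- rewrite /pre !mulr_ge0//; apply: prodr_ge0 => k _.
    exact: jump_ge0.
  exact: expR_ge0.
- by move=> v _; rewrite lee_fin mulr_ge0 ?jump_ge0 ?cyl_ge0.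
rewrite esum_jump; first by rewrite -EFinM.
by move=> y; exact: cyl_ge0.
Qed.

Lemma law_cyl x n (A : nat -> pred S) (s : nat -> R) : (forall k, 0 <= s k) ->
  P x [set w | forall k, (k <= n)%N -> A k (Y k w) /\ ((s k)%:E < W k w)%E] =
  (cyl n A s x)%:E.
Proof.
move=> s0; set E := mkset _.
have mE : measurable E.
  apply: (@bigcap_measurableType _ _ (fun k => [set w | A k (Y k w)] `&`
    [set w | ((s k)%:E < W k w)%E]) [set k | (k <= n)%N]) => k _.
  apply: measurableI; last exact: measurable_tail.
  exact: (@measurable_state k [set y | A k y]).
rewrite (measure_partition _ (mY 0))//.
rewrite -[RHS](esum_delta x); last by rewrite lee_fin cyl_ge0.
apply: eq_esum => v _.
rewrite (_ : _ `&` _ = if A 0 v then ev 0 (fun=> v) n (A \o succn) s else set0).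
  case: ifPn => A0v; last first.
    rewrite measure0; case: eqP => // vx; rewrite -vx.
    by case: (n) => [|n'] /=; rewrite (negbTE A0v) !mul0r.
  apply: etrans (law_ev _ _ _ _ _ s0) _; rewrite /pre big_ord0 big_ord_recl big_ord0 !mulr1.
  rewrite eq_sym; case: (eqVneq v x) => [<-|vx]; last by rewrite !mul0r.
  by congr _%:E; case: (n) => [|n'] /=; rewrite A0v.
case: ifPn => A0v.
  apply/seteqP; split => w /=.
    move=> [h Yv]; split => [k|]; first by rewrite leqn0 => /eqP ->.
    split => [k kn|k]; first by case: (h k.+1).
    by move=> /h[].
  move=> [h1 [h2 h3]]; split; last exact: h1.
  move=> [|k] kn; split; [by rewrite h1|exact: h3|exact: h2|exact: h3].
apply/seteqP; split => w //= -[/(_ 0%N (leq0n _))[A0 _] Yv].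
by move: A0v; rewrite -Yv A0.
Qed.

End finite_moves.

(** * The embedded chain killed at a state *)

Section killed_chain.
Context {R : realType} {S : countType} {I : finType}.
Variables (r : S -> I -> R) (mv : S -> I -> S).
Hypothesis reg : regular_moves r mv.
Variable z : S.

Let r_ge0 x i : 0 <= r x i. Proof. by case: reg. Qed.
Let tot_gt0 x : 0 < tot r x. Proof. by case: reg. Qed.

(** The embedded chain is killed when it arrives at z, not when it starts there, so [alive k f x] is
    E_x[f(Y_k); Y_1, ..., Y_k != z] even for x = z. *)
Definition kill (f : S -> R) (x : S) : R :=
  step r mv (fun y => (y != z)%:R * f y) x.

Definition alive k (f : S -> R) : S -> R := iter k kill f.

Lemma le_kill f g x : (forall y, f y <= g y) -> kill f x <= kill g x.
Proof. by move=> fg; apply: le_step => // i _; rewrite ler_wpM2l. Qed.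

Lemma le_alive k f g x : (forall y, f y <= g y) -> alive k f x <= alive k g x.
Proof.
move=> fg; elim: k x => [|k IH] x; first exact: fg.
exact: le_kill.
Qed.

Lemma alive_ge0 k f x : (forall y, 0 <= f y) -> 0 <= alive k f x.
Proof.
move=> f0; elim: k x => [|k IH] x; first exact: f0.
by apply: (step_ge0 reg) => y; apply: mulr_ge0 => //; exact: IH.
Qed.

Lemma killZ c f x : kill (fun y => c * f y) x = c * kill f x.
Proof.
rewrite -stepZ; apply: eq_step => y; exact: mulrCA.
Qed.

Lemma aliveZ k c f x : alive k (fun y => c * f y) x = c * alive k f x.
Proof.
elim: k x => [//|k IH] x.
by rewrite /alive !iterS -killZ; congr (kill _ x); apply/funext.
Qed.

Lemma aliveD k f g x :
  alive k (fun y => f y + g y) x = alive k f x + alive k g x.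
Proof.
elim: k x => [//|k IH] x.
rewrite /alive !iterS -stepD; apply: eq_step => y.
by rewrite -mulrDr -IH.
Qed.

(** The Foster-Lyapunov condition L V <= - delta V off z, for the generator L f = sum_i r_i (f o
    mv_i - f). *)
Definition drift_away (V : S -> R) (delta : R) : Prop :=
  [/\ 0 < delta, forall x, 1 <= V x
    & forall x, x != z -> \sum_i r x i * V (mv x i) <= (tot r x - delta) * V x].

Section drift.
Variables (V : S -> R) (delta Lam : R).
Hypotheses (dV : drift_away V delta) (tot_le : forall x, tot r x <= Lam).

(** The left-hand side of the drift inequality is nonnegative, so tot - delta must be too. This
    bounds the mean holding times off z. *)
Lemma tot_ge_drift x : x != z -> delta <= tot r x.
Proof.
have [d0 V1 dr] := dV => /dr; have Vp : 0 < V x := lt_le_trans ltr01 (V1 x).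
move=> h; rewrite -subr_ge0 -(pmulr_lge0 _ Vp); apply: le_trans h.
apply: sumr_ge0 => i _; rewrite mulr_ge0//.
exact: le_trans ler01 (V1 _).
Qed.

Lemma alive_drift : exists C rho : R, [/\ 0 <= C, 0 < rho, rho < 1,
  forall k, alive k V z <= C * rho ^+ k
  & forall k x, x != z -> alive k V x <= rho ^+ k * V x].
Proof.
have [d0 V1 dr] := dV.
have V0 x : 0 <= V x := le_trans ler01 (V1 x).
have L0 : 0 < Lam := lt_le_trans (tot_gt0 z) (tot_le z).
(* One jump multiplies the mean of V by at most 1 - delta / tot. Dividing by Lam + delta instead of
   Lam keeps rho positive in all cases. *)
pose rho := 1 - delta / (Lam + delta).
have Ld : 0 < Lam + delta by rewrite addr_gt0.
have rho0 : 0 < rho by rewrite subr_gt0 ltr_pdivrMr// mul1r ltrDr.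
have rho1 : rho < 1 by rewrite ltrBlDr ltrDl divr_gt0.
have stepV x : x != z -> step r mv V x <= rho * V x.
  move=> xz; rewrite /step ler_pdivrMr//; apply: le_trans (dr _ xz) _.
  rewrite mulrAC ler_wpM2r// /rho mulrBl mul1r lerB//.
  rewrite mulrAC ler_pdivrMr// ler_wpM2l// ?(ltW d0)//.
  by apply: le_trans (tot_le x) _; rewrite lerDl ltW.
have alV k x : x != z -> alive k V x <= rho ^+ k * V x.
  elim: k x => [|k IH] x xz; first by rewrite expr0 mul1r.
  rewrite exprSr -mulrA; apply: le_trans (ler_wpM2l _ (stepV _ xz)); last first.
    exact/exprn_ge0/ltW.
  rewrite -stepZ; apply: le_step => // i _.
  case: (eqVneq (mv x i) z) => [->|yz].
    by rewrite mul0r mulr_ge0// exprn_ge0// ltW.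
  by rewrite mul1r; exact: IH.
(* There is no drift at z: the first summand covers k = 0, the second the first jump out of z, after
   which the bound off z applies. *)
exists (V z + step r mv V z / rho), rho; split => //.
- apply: addr_ge0 => //; apply: divr_ge0; last exact: ltW.
  exact: (step_ge0 reg).
- move=> [|k].
    rewrite expr0 mulr1 lerDl; apply: divr_ge0; last exact: ltW.
    exact: (step_ge0 reg).
  rewrite mulrDl (_ : step r mv V z / rho * _ = rho ^+ k * step r mv V z); last first.
    by rewrite exprS mulrA divfK ?gt_eqF// mulrC.
  rewrite -[leLHS]add0r lerD//.
    by rewrite mulr_ge0// exprn_ge0// ltW.
  rewrite -stepZ; apply: le_step => // i _.
  case: (eqVneq (mv z i) z) => [->|yz].
    by rewrite mul0r mulr_ge0// exprn_ge0// ltW.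
  by rewrite mul1r; exact: alV.
Qed.

End drift.

Inductive reaches : S -> Prop :=
| reaches_refl : reaches z
| reaches_step x i : 0 < r x i -> reaches (mv x i) -> reaches x.

(* [unhit l x] is the probability that l jumps from x do not visit z. *)
Let unhit l : S -> R :=
  iter l (fun f x => (x != z)%:R * step r mv f x) (fun x => (x != z)%:R).

Let unhitS l x : unhit l.+1 x = (x != z)%:R * step r mv (unhit l) x.
Proof. by []. Qed.

Let unhit_ge0 l x : 0 <= unhit l x.
Proof.
elim: l x => [|l IH] x; first by rewrite /unhit/=.
by rewrite unhitS; apply: mulr_ge0 => //; exact: (step_ge0 reg).
Qed.

Let unhit_nincr l x : unhit l.+1 x <= unhit l x.
Proof.
elim: l x => [|l IH] x; last first.
  by rewrite !unhitS ler_wpM2l//; exact: le_step.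
rewrite unhitS -[leRHS]mulr1 ler_wpM2l// -[leRHS](step_cst reg 1 x).
by apply: le_step => // i _; rewrite /unhit/=; case: eqP.
Qed.

Let unhit_mono l l' x : (l <= l')%N -> unhit l' x <= unhit l x.
Proof.
move=> /subnKC <-; elim: (l' - l)%N => [|k IH]; first by rewrite addn0.
by rewrite addnS; exact: le_trans (unhit_nincr _ _) IH.
Qed.

Let unhit_le1 l x : unhit l x <= 1.
Proof.
by apply: le_trans (unhit_mono x (leq0n l)) _; rewrite /unhit/=; case: eqP.
Qed.

Let unhit_lt1 x : reaches x -> exists l, unhit l x < 1.
Proof.
elim => [|{}x i ri _ [l hl]]; first by exists 0%N; rewrite /unhit/= eqxx.
exists l.+1; rewrite unhitS; case: eqP => _; rewrite ?mul0r// mul1r.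
rewrite /step ltr_pdivrMr// mul1r /tot.
rewrite (bigD1 i)//= [ltRHS](bigD1 i)//= ltr_leD//.
  by rewrite -[ltRHS]mulr1 ltr_pM2l.
by apply: ler_sum => j _; rewrite -[leRHS]mulr1 ler_wpM2l.
Qed.

(* The set F where V0 may grow is finite: the expected number of jumps, out of
   the first L ones, before visiting z is a bounded correction that decreases
   there. *)
Lemma drift_patch (V0 : S -> R) (delta0 b : R) (F : seq S) :
  0 < delta0 -> 0 <= b -> (forall x, 1 <= V0 x) ->
  (forall x, \sum_i r x i * V0 (mv x i) <= (tot r x - delta0) * V0 x + b) ->
  (forall x, x \notin F -> b <= delta0 / 2 * V0 x) ->
  (forall x, reaches x) ->
  exists (V : S -> R) (delta : R),
    drift_away V delta /\ forall x, V0 x <= V x.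
Proof.
move=> d0 b0 V01 dr0 VF rea.
have V00 x : 0 <= V0 x := le_trans ler01 (V01 x).
(* As [unhit] is nonincreasing in the number of jumps, the maximum of finitely many lengths serves
   all of F. *)
have [L hL] : exists L, forall x, x \in F -> unhit L x < 1.
  elim: F {VF} => [|y F [L hL]]; first by exists 0%N.
  have [l hl] := unhit_lt1 (rea y).
  exists (maxn l L) => x; rewrite inE => /predU1P[->|xF].
    by apply: le_lt_trans hl; apply: unhit_mono; exact: leq_maxl.
  by apply: le_lt_trans (hL _ xF); apply: unhit_mono; exact: leq_maxr.
pose psi x := \sum_(l < L) unhit l x.
have psi0 x : 0 <= psi x by apply: sumr_ge0.
have psiL x : psi x <= L%:R.
  rewrite -[leRHS](_ : \sum_(l < L) 1 = _); first exact: ler_sum.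
  by rewrite sumr_const card_ord.
(* The sum telescopes: a jump shifts l to l.+1, so psi loses [unhit 0 x] = 1 and gains [unhit L x].
   The loss is nonnegative off z and strictly positive on F. *)
have step_psi x : x != z -> step r mv psi x = psi x - 1 + unhit L x.
  move=> xz; rewrite step_sum (eq_bigr (fun l : 'I_L => unhit l.+1 x)); last first.
    by move=> l _; rewrite unhitS xz mul1r.
  have : \sum_(l < L.+1) unhit l x = \sum_(l < L.+1) unhit l x by [].
  rewrite [in LHS]big_ord_recl [in RHS]big_ord_recr/= -/(psi x).
  rewrite [X in X + _](_ : _ = 1); last by rewrite /unhit/= xz.
  rewrite (eq_bigr (fun l : 'I_L => unhit l.+1 x))//.
  by move=> /(canRL (addKr 1)) ->; ring.
(* Each term is the multiple of psi that one point of F needs to absorb b; their sum serves all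
   points at once. *)
pose A := \sum_(x <- F) b / (tot r x * (1 - unhit L x)).
have term0 x : x \in F -> 0 <= b / (tot r x * (1 - unhit L x)).
  by move=> xF; rewrite divr_ge0// mulr_ge0 ?subr_ge0// ltW.
have A0 : 0 <= A by rewrite /A big_seq sumr_ge0.
have Ab x : x \in F -> b <= A * (tot r x * (1 - unhit L x)).
  move=> xF; rewrite -ler_pdivrMr; last by rewrite mulr_gt0 ?subr_gt0 ?hL.
  rewrite /A (big_rem x)//= lerDl big_seq sumr_ge0// => y /mem_rem.
  exact: term0.
have AL1 : 0 < 1 + A * L%:R by rewrite ltr_pwDl// mulr_ge0.
(* Since psi <= L and V0 >= 1, the new function is at most (1 + A L) V0, which accounts for the
   rate. *)
exists (fun x => V0 x + A * psi x), (delta0 / 2 / (1 + A * L%:R)).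
split; last by move=> x; rewrite lerDl mulr_ge0.
split; first by rewrite !divr_gt0.
  by move=> x; apply: le_trans (V01 x) _; rewrite lerDl mulr_ge0.
move=> x xz.
under eq_bigr do rewrite mulrDr.
rewrite big_split/=.
have -> : \sum_i r x i * (A * psi (mv x i)) = A * (tot r x * step r mv psi x).
  rewrite mulrC [tot r x * _]mulrC /step divfK ?gt_eqF// mulr_suml.
  by apply: eq_bigr => i _; rewrite mulrAC mulrA.
rewrite step_psi//.
have bd : delta0 / 2 / (1 + A * L%:R) * (V0 x + A * psi x) <= delta0 / 2 * V0 x.
  rewrite mulrAC ler_pdivrMr// -[leRHS]mulrA ler_wpM2l//.
    by rewrite divr_ge0// ltW.
  rewrite mulrDr mulr1 lerD2l mulrCA ler_wpM2l//.
  by apply: le_trans (psiL x) _; rewrite ler_peMl.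
have key : b - A * (tot r x * (1 - unhit L x)) <= delta0 / 2 * V0 x.
  have [xF|/VF bx] := boolP (x \in F).
    apply: (@le_trans _ _ 0); first by rewrite subr_le0 Ab.
    by rewrite mulr_ge0// divr_ge0// ltW.
  apply: le_trans bx; rewrite gerBl mulr_ge0// mulr_ge0 ?subr_ge0//.
  exact: ltW.
have := dr0 x; move: bd key; set e := delta0 / 2 / _.
rewrite mulrBl mulrDr => bd key dr.
lra.
Qed.

(* Before returning to z, D is a submartingale with bounded increments, and a
   summable number of jumps makes optional stopping applicable. *)
Lemma return_submartingale (D : S -> R) (B C : R) i :
  (forall x j, r x j != 0 -> `|D (mv x j) - D x| <= B) ->
  (forall x, tot r x * D x <= \sum_j r x j * D (mv x j)) ->
  (forall K, \sum_(k < K) alive k (fun=> 1) z <= C) ->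
  r z i != 0 -> D (mv z i) <= D z.
Proof.
move=> DB Ddrift alC ri.
have B0 : 0 <= B := le_trans (normr_ge0 _) (DB _ _ ri).
pose D' x := D x - D z.
rewrite -subr_le0 -/(D' _); set y := mv z i.
have yz : y != z by case: reg => _ + _; apply.
(* D' vanishes at z, so killing there costs nothing and the submartingale inequality survives. *)
have killD' x : D' x <= kill D' x.
  rewrite /kill (@eq_step _ _ _ _ _ _ (fun y => D y + - D z)); last first.
    by move=> t; rewrite /D'; case: eqP => [->|_]; rewrite ?mul1r// subrr mul0r.
  rewrite stepD step_cst// lerD2r /step ler_pdivlMr// mulrC.
  exact: Ddrift.
have aliveD' k x : D' x <= alive k D' x.
  elim: k x => [//|k IH] x; rewrite /alive iterSr.
  apply: le_trans (IH x) _; exact: le_alive.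
have ub k x : alive k D' x <= (`|D' x| + B * k%:R) * alive k (fun=> 1) x.
  elim: k x => [|k IH] x; first by rewrite mulr0 addr0 mulr1 ler_norm.
  rewrite /alive !iterS -/(alive k _) -stepZ.
  apply: le_step => // j rj; rewrite [leRHS]mulrCA ler_wpM2l//.
  apply: le_trans (IH _) _; rewrite ler_wpM2r ?alive_ge0//.
  rewrite mulrSr mulrDr mulr1 [B * _ + B]addrC addrA lerD2r.
  rewrite -lerBlDl; apply: le_trans (lerB_dist _ _) _.
  rewrite [X in `|X|](_ : _ = D (mv x j) - D x) ?DB//.
  by rewrite /D'; ring.
(* The chain started at z jumps to y with probability at least r z i / tot z, so survival from y is
   summable as well. *)
have aly k : alive k (fun=> 1) y <= tot r z / r z i * alive k.+1 (fun=> 1) z.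
  have rip : 0 < r z i by rewrite lt_neqAle eq_sym ri r_ge0.
  rewrite /alive iterS -/(alive k _) /kill /step mulrC mulrA divfK ?gt_eqF//.
  rewrite ler_pdivlMr// (bigD1 i)//= -/y yz mul1r mulrC lerDl.
  by apply: sumr_ge0 => j _; rewrite mulr_ge0 ?mulr_ge0 ?alive_ge0.
pose C' := tot r z / r z i * C.
have alC' K : \sum_(k < K) alive k (fun=> 1) y <= C'.
  apply: (@le_trans _ _ (\sum_(k < K) tot r z / r z i * alive k.+1 (fun=> 1) z)).
    by apply: ler_sum => k _; exact: aly.
  rewrite -mulr_sumr ler_wpM2l//; first by rewrite divr_ge0// ltW.
  by apply: le_trans (alC K.+1); rewrite big_ord_recl lerDr alive_ge0.
rewrite leNgt; apply/negP => D'y.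
(* If D' y > 0, then D' y <= (D' y + B k) [alive k 1 y] makes the survival probability at least a
   constant over k + 1, and the harmonic series contradicts summability. *)
have low k : D' y / (D' y + B) * k.+1%:R^-1 <= alive k (fun=> 1) y.
  have DyB : 0 < D' y + B by rewrite ltr_pwDl.
  rewrite ler_pdivrMr ?ltr0n// ler_pdivrMr//.
  apply: le_trans (aliveD' k y) _; apply: le_trans (ub k y) _.
  rewrite mulrC -mulrA ler_wpM2l ?alive_ge0// gtr0_norm//.
  rewrite -natr1.
  have : 0 <= k%:R * D' y by rewrite mulr_ge0// ltW.
  lra.
apply: (@dvg_harmonic R); apply: nondecreasing_is_cvgn.
  apply/nondecreasing_seqP => K; rewrite !seriesEord/= big_ord_recr/= lerDl.
  by rewrite invr_ge0.
exists (C' / (D' y / (D' y + B))) => _ [K _ <-].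
rewrite ler_pdivlMr; last by rewrite divr_gt0// ltr_pwDl.
apply: le_trans (alC' K); rewrite seriesEord/= mulr_suml.
by apply: ler_sum => k _; rewrite mulrC; exact: low.
Qed.

End killed_chain.

Section series_extra.
Context {R : realType}.
Implicit Types u : nat -> \bar R.

Lemma nneseries_le_bound u (B : \bar R) : (forall n, (0 <= u n)%E) ->
  (forall n, (\sum_(0 <= k < n) u k <= B)%E) -> (\sum_(k <oo) u k <= B)%E.
Proof.
move=> u0 uB; apply: lime_le; last exact: nearW.
by apply: is_cvg_nneseries => n _ _; exact: u0.
Qed.

Lemma nneseries_geometric_le (C rho : R) : 0 <= C -> 0 < rho -> rho < 1 ->
  (\sum_(k <oo) (C * rho ^+ k)%:E <= (C / (1 - rho))%:E)%E.
Proof.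
move=> C0 rho0 rho1; apply: nneseries_le_bound => n.
  by rewrite lee_fin mulr_ge0// exprn_ge0// ltW.
rewrite sumEFin lee_fin; apply: (@geometric_le_lim _ n C rho) => //.
by rewrite gtr0_norm.
Qed.

(** For x >= 0 the series is the ceiling of x. It replaces a holding time by indicators of its
    tails, whose probabilities are known. *)
Lemma le_count_below (x : \bar R) :
  (x <= \sum_(j <oo) if j%:R%:E < x then 1 else 0)%E.
Proof.
pose c j : \bar R := (if j%:R%:E < x then 1 else 0)%E.
rewrite -/(\sum_(j <oo) c j)%E.
have c0 j : (0 <= c j)%E by rewrite /c; case: ifP.
have part n : (mine x n%:R%:E <= \sum_(0 <= j < n) c j)%E.
  elim: n => [|n IH]; first by rewrite big_nil ge_min lexx orbT.
  rewrite big_nat_recr//= /c; have [nx|xn] := ltP n%:R%:E x.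
    apply: (@le_trans _ _ (mine x n%:R%:E + 1%:E)%E); last exact: leeD2r.
    rewrite (min_idPr (ltW nx)) -EFinD natr1 ge_min lexx orbT//.
  rewrite adde0; apply: le_trans IH.
  by rewrite (min_idPl xn) ge_min lexx.
have lim n : (mine x n%:R%:E <= \sum_(j <oo) c j)%E.
  by apply: le_trans (part n) _; apply: nneseries_lim_ge => j _ _; exact: c0.
case: x @c c0 part lim => [x| |] c c0 part lim; last exact: leNye.
- have [n xn] : exists n : nat, x <= n%:R.
    exists (Num.trunc `|x|).+1; apply: le_trans (ler_norm x) _.
    by apply/ltW; rewrite truncnS_gt.
  by have := lim n; rewrite (min_idPl _)// lee_fin.
- rewrite leye_eq; apply/eqP/eq_infty => y.
  have [n yn] : exists n : nat, y <= n%:R.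
    exists (Num.trunc `|y|).+1; apply: le_trans (ler_norm y) _.
    by apply/ltW; rewrite truncnS_gt.
  apply: le_trans (lim n); rewrite (min_idPr _) ?leey//.
Qed.

End series_extra.

(** * Return times *)

Section jump_path.
Context {R : realType} {S : countType} {d : measure_display}
  {Omega : measurableType d}.

Definition jump_time (W : nat -> Omega -> \bar R) n (w : Omega) : \bar R :=
  (\sum_(k < n) W k w)%E.

(* [is_jump_process] with its embedded chain Y and holding times W exposed. *)
Definition jump_path (q : S -> S -> R) (P : S -> probability Omega R)
    (X : R -> Omega -> S) (Y : nat -> Omega -> S) (W : nat -> Omega -> \bar R) :=
  [/\ (forall n y, measurable [set w | Y n w = y])
        /\ (forall n, measurable_fun [set: Omega] (W n)),
      forall n w, (0 < W n w)%E,
      forall w (t : R), exists n, (t%:E < jump_time W n w)%E,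
      forall w n (t : R), (jump_time W n w <= t%:E)%E ->
        (t%:E < jump_time W n.+1 w)%E -> X t w = Y n w
    & forall (x : S) (n : nat) (y : nat -> S) (s : nat -> R),
        (forall k, 0 <= s k) ->
        P x [set w | forall k, (k <= n)%N ->
                       Y k w = y k /\ ((s k)%:E < W k w)%E] =
        ((x == y 0)%:R
         * \prod_(k < n) jump_prob q (y k) (y k.+1)
         * \prod_(k < n.+1) expR (- (exit_rate q (y k) * s k)))%:E].

End jump_path.

Section jump_chain.
Context {R : realType} {S : countType} {I : finType}.
Variables (r : S -> I -> R) (mv : S -> I -> S).
Hypothesis reg : regular_moves r mv.
Context {d : measure_display} {Omega : measurableType d}.
Variables (P : S -> probability Omega R) (X : R -> Omega -> S).
Variables (Y : nat -> Omega -> S) (W : nat -> Omega -> \bar R).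
Hypothesis path : jump_path (move_rate r mv) P X Y W.

Let r_ge0 x i : 0 <= r x i. Proof. by case: reg. Qed.
Let tot_gt0 x : 0 < tot r x. Proof. by case: reg. Qed.
Let mY n y : measurable [set w | Y n w = y]. Proof. by case: path => -[]. Qed.
Let mW n : measurable_fun [set: Omega] (W n). Proof. by case: path => -[]. Qed.
Let W_gt0 n w : (0 < W n w)%E. Proof. by case: path. Qed.
Let non_explosive w (t : R) : exists n, (t%:E < jump_time W n w)%E.
Proof. by case: path. Qed.
Let X_Y w n (t : R) : (jump_time W n w <= t%:E)%E ->
  (t%:E < jump_time W n.+1 w)%E -> X t w = Y n w.
Proof. by case: path => _ _ _ + _; apply. Qed.
Let law : forall (x : S) (n : nat) (y : nat -> S) (s : nat -> R),
  (forall k, 0 <= s k) ->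
  P x [set w | forall k, (k <= n)%N -> Y k w = y k /\ ((s k)%:E < W k w)%E] =
  ((x == y 0)%:R * \prod_(k < n) jump_prob (move_rate r mv) (y k) (y k.+1)
   * \prod_(k < n.+1) expR (- (exit_rate (move_rate r mv) (y k) * s k)))%:E.
Proof. by case: path. Qed.
Local Notation jump_time := (jump_time W).

Lemma jump_timeS n w : jump_time n.+1 w = (jump_time n w + W n w)%E.
Proof. exact: big_ord_recr. Qed.

Lemma jump_time0 w : jump_time 0 w = 0%E.
Proof. exact: big_ord0. Qed.

Lemma jump_time_ge0 n w : (0 <= jump_time n w)%E.
Proof. by apply: sume_ge0 => k _; exact: ltW. Qed.

Lemma le_jump_time w : {homo jump_time^~ w : m n / (m <= n)%N >-> (m <= n)%E}.
Proof.
move=> m n /subnKC <-; elim: (n - m)%N => [|k IH]; first by rewrite addn0.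
by rewrite addnS jump_timeS; apply: le_trans IH _; rewrite leeDl// ltW.
Qed.

Lemma jump_index w (t : R) : 0 <= t ->
  exists n, (jump_time n w <= t%:E)%E /\ (t%:E < jump_time n.+1 w)%E.
Proof.
move=> t0; have := non_explosive w t => /ex_minnP[[|n] tn nmin].
  by move: tn; rewrite jump_time0 lte_fin ltNge t0.
exists n; split=> //; rewrite leNgt; apply/negP => /nmin.
by rewrite ltnn.
Qed.

Lemma jump_time_uniq w (t : R) m n :
  (jump_time m w <= t%:E)%E -> (t%:E < jump_time m.+1 w)%E ->
  (jump_time n w <= t%:E)%E -> (t%:E < jump_time n.+1 w)%E -> m = n.
Proof.
wlog mn : m n / (m <= n)%N.
  move=> h; case/orP: (leq_total m n) => mn h1 h2 h3 h4; first exact: h.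
  by apply/esym; exact: h.
move=> _ tm nt _; apply/eqP; rewrite eqn_leq mn leqNgt; apply/negP => /le_jump_time.
by move=> /(_ w) /le_trans /(_ nt) /(lt_le_trans tm); rewrite ltxx.
Qed.

Variable z : S.

Definition away k (w : Omega) : Prop := forall j, (0 < j <= k)%N -> Y j w <> z.

Lemma measurable_away_tail (A : pred S) k (s : R) :
  measurable [set w | [/\ A (Y 0 w), away k w & (s%:E < W k w)%E]].
Proof.
rewrite (_ : mkset _ = [set w | A (Y 0 w)] `&` ([set w | away k w] `&`
    [set w | (s%:E < W k w)%E])); last first.
  by apply/seteqP; split => w [] // h1 [].
apply: measurableI; first exact: (measurable_state mY 0 [set y | A y]).
apply: measurableI; last exact: measurable_tail.
apply: (@bigcap_measurableType _ _ (fun j => [set w | Y j w <> z])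
  [set j | (0 < j <= k)%N]) => j _.
exact: (measurable_state mY j [set y | y <> z]).
Qed.

Lemma law_away_tail x (A : pred S) k (s : R) : 0 <= s ->
  P x [set w | [/\ A (Y 0 w), away k w & (s%:E < W k w)%E]] =
  ((A x)%:R * alive r mv z k (fun y => expR (- (tot r y * s))) x)%:E.
Proof.
move=> s0.
pose B (j : nat) (y : S) := if j is 0%N then A y else y != z.
(* Holding times are positive, so the threshold 0 imposes nothing: only W k is tested. *)
pose sk (k j : nat) : R := if j == k then s else 0.
rewrite (_ : mkset _ = [set w | forall j, (j <= k)%N ->
    B j (Y j w) /\ ((sk k j)%:E < W j w)%E]); last first.
  apply/seteqP; split => w /=.
    move=> [A0 aw sW] j jk; split.
      by case: j jk => [//|j] jk; apply/eqP/aw.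
    by rewrite /sk; case: eqP => [->|].
  move=> h; split.
  - by have [] := h 0%N isT.
  - move=> j /andP[j0 jk]; have [+ _] := h _ jk.
    by case: j j0 {jk} => // j _ /eqP.
  - by have [_] := h _ (leqnn k); rewrite /sk eqxx.
rewrite (law_cyl reg mY mW law)//; last by move=> j; rewrite /sk; case: ifP.
congr _%:E.
have cylz l y : cyl r mv l (fun _ y => y != z) (sk l) y =
    (y != z)%:R * alive r mv z l (fun y => expR (- (tot r y * s))) y.
  elim: l y => [|l IH] y; first by rewrite /= /sk eqxx mulr1.
  rewrite /= /sk /= mulr0 oppr0 expR0 mulr1; congr (_ * _).
  by rewrite /kill; apply: eq_step => y'; rewrite -IH.
case: k => [|k] /=; first by rewrite /sk eqxx mulr1.
rewrite /sk/= mulr0 oppr0 expR0 mulr1; congr (_ * _).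
by rewrite /kill; apply: eq_step => y'; rewrite -cylz.
Qed.

Lemma law_jump_self : P z [set w | Y 1 w = z] = 0%E.
Proof.
pose A (j : nat) (y : S) := if j is 1%N then y == z else true.
rewrite (_ : mkset _ = [set w | forall j, (j <= 1)%N ->
    A j (Y j w) /\ (0%:E < W j w)%E]); last first.
  apply/seteqP; split => w /=; last by move=> /(_ 1%N isT)[/eqP].
  by move=> Y1 [|[|]]//= _; split => //; rewrite Y1 eqxx.
rewrite (law_cyl reg mY mW law)//= !mulr0 oppr0 expR0 !mulr1 mul1r.
transitivity (step r mv (fun=> 0) z)%:E; last by rewrite step_cst.
congr (_ / _)%:E; apply: eq_bigr => i _.
rewrite /= !mulr0 oppr0 expR0 !mulr1.
have [->|ri] := eqVneq (r z i) 0; first by rewrite mul0r.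
by case: reg => _ /(_ _ _ ri) /negbTE -> _; rewrite mulr0.
Qed.

(** If W 0 <= 1 and Y 1 != z, the path has left z at a finite time. Absorption would thus give
    probability one to W 0 > 1, up to null events, although that event has probability exp(- tot z)
    < 1. *)
Lemma not_absorbing : ~ absorbing P X z.
Proof.
move=> [N [mN PN0 absN]].
have P1 := law_jump_self.
have P2 : P z [set w | [/\ predT (Y 0 w), away 0 w & (1%:E < W 0 w)%E]] =
    (expR (- tot r z))%:E.
  by rewrite law_away_tail//= mul1r mulr1.
have mW1 := measurable_away_tail predT 0 1.
have : (P z setT <= P z N + (P z [set w | Y 1 w = z] +
   P z [set w | [/\ predT (Y 0 w), away 0 w & (1%:E < W 0 w)%E]]))%E.
  apply: (@le_trans _ _ (P z (N `|` ([set w | Y 1 w = z] `|`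
     [set w | [/\ predT (Y 0 w), away 0 w & (1%:E < W 0 w)%E]])))).
    apply: le_measure; rewrite ?inE//.
      by do 2 (apply: measurableU => //).
    move=> w _; case: (pselect (Y 1 w = z)) => Y1; first by right; left.
    case: (ltP 1%:E (W 0 w)) => W1.
      right; right; split => //= j.
      by rewrite andbC leqn0; case: eqP => // ->.
    left; apply: absN => /= abs; apply: Y1.
    have Jfin : jump_time 1 w \is a fin_num.
      rewrite ge0_fin_numE ?jump_time_ge0// jump_timeS jump_time0 add0e.
      by apply: le_lt_trans W1 _; rewrite ltry.
    rewrite -(abs (fine (jump_time 1 w))); last by rewrite fine_ge0// jump_time_ge0.
    apply/esym/X_Y; rewrite fineK//.
    by rewrite (jump_timeS 1) lteDl.
  apply: le_trans (measureU2 _ mN (measurableU _ _ (mY 1 z) mW1)) _.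
  by apply: leeD => //; exact: measureU2.
rewrite [X in (X <= _)%E]probability_setT [X in (_ <= X + _)%E]PN0 add0e.
rewrite [X in (_ <= X + _)%E]P1 add0e [X in (_ <= X)%E]P2 lee_fin leNgt.
by rewrite expR_lt1 oppr_lt0 tot_gt0.
Qed.

(* The k-th term counts a sojourn of length at least 1 before the return. *)
Let early k : set Omega :=
  [set w | [/\ (pred1 z) (Y 0 w), away k w & (1%:E < W k w)%E]].

(** Let t be a return time and m the index of the sojourn containing t. Then Y m = z, and m > 0 as
    the path was away from z before; so [away k] fails for k >= m, while each k < m contributes at
    most W k to the m-th jump time. *)
Let early_le_return_time K w :
  (\sum_(0 <= k < K) (if k == 0%N then 0 else \1_(early k) w)%:E
   <= return_time X z w)%E.
Proof.
apply: le_ereal_inf_tmp => _ [t [[s [s0 st Xs]] Xt] <-].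
have [m [Jm Jm1]] := jump_index w (ltW (le_lt_trans s0 st)).
have [Y0|Y0] := eqVneq (Y 0 w) z; last first.
  rewrite big1.
    by rewrite lee_fin (le_trans s0)// ltW.
  move=> k _; case: ifP => // _; rewrite indicE memNset// => -[/= /eqP].
  by move/eqP: Y0.
have Ym : Y m w = z by rewrite -Xt; apply/esym/X_Y.
have m0 : (0 < m)%N.
  rewrite lt0n; apply/eqP => m0; apply: Xs; rewrite -Y0; apply: X_Y.
    by rewrite jump_time0 lee_fin.
  by move: Jm1; rewrite m0; apply: lt_trans; rewrite lte_fin.
apply: le_trans Jm; apply: le_trans (le_jump_time w (geq_minr K m)).
elim: K => [|K IH]; first by rewrite big_nil jump_time_ge0.
rewrite big_nat_recr//=; have [Km|mK] := ltnP K m.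
  rewrite (minn_idPl Km) jump_timeS; apply: leeD.
    by move: IH; rewrite (minn_idPl (ltnW Km)).
  case: ifP => _; first exact: ltW.
  rewrite indicE; case: (boolP (w \in _)); last by move=> _; exact: ltW.
  by rewrite inE => -[_ _] /ltW.
rewrite (minn_idPr (leqW mK)); move: IH; rewrite (minn_idPr mK) => IH.
rewrite [X in (_ + X)%E](_ : _ = 0%E) ?adde0//.
case: eqP => // _; rewrite indicE memNset// => -[_ /(_ m)].
by rewrite m0 mK => /(_ isT).
Qed.

(** A sojourn exceeds length 1 with probability at least exp(- Lam), so a finite mean return time
    bounds the mean number of jumps before the return. The summand 1 of the constant is the term k =
    0. *)
Lemma positive_recurrent_summable (Lam : R) : (forall x, tot r x <= Lam) ->
  positive_recurrent_state P X z ->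
  exists C : R, forall K, \sum_(k < K) alive r mv z k (fun=> 1) z <= C.
Proof.
move=> tot_le [/not_absorbing//|rt_fin].
pose rt := (\int[P z]_w return_time X z w)%E.
have rt0 w : (0 <= return_time X z w)%E.
  apply: le_ereal_inf_tmp => _ [t [[s [s0 st _]] _] <-].
  by rewrite lee_fin (le_trans s0)// ltW.
have [c ct] : exists c, rt = c%:E.
  by exists (fine rt); rewrite fineK// ge0_fin_numE// integral_ge0.
exists (1 + expR Lam * c) => K.
have mearly k : measurable (early k) by exact: measurable_away_tail.
have Pearly k : P z (early k) =
    (alive r mv z k (fun y => expR (- (tot r y * 1))) z)%:E.
  by rewrite law_away_tail//= eqxx mul1r.
have : (\sum_(0 <= k < K) (if k == 0%N then 0 else P z (early k)) <= c%:E)%E.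
  rewrite -ct; apply: (@le_trans _ _ (\int[P z]_w
     \sum_(0 <= k < K) (if k == 0%N then 0 else \1_(early k) w)%:E)%E).
    rewrite ge0_integral_sum//; last 2 first.
    - move=> k; apply/measurable_EFinP; case: eqP => _; first exact: measurable_cst.
      exact: measurable_indic.
    - by move=> k w _; case: ifP.
    apply: lee_sum => k _; case: eqP => _; first by rewrite integral0.
    by rewrite integral_indic// setIT.
  apply: ge0_le_integral_nomeas => w; last exact: early_le_return_time.
  by apply: sume_ge0 => k _; case: ifP.
rewrite (eq_bigr (fun k => (if k == 0%N then 0 else
    alive r mv z k (fun y => expR (- (tot r y * 1))) z)%:E)); last first.
  by move=> k _; case: eqP => // _; exact: Pearly.
rewrite sumEFin lee_fin big_mkord => sum_le.
have Le : 0 < expR Lam := expR_gt0 _.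
apply: le_trans (_ : 1 + expR Lam * \sum_(i < K) (if i == 0%N :> nat then 0 else
   alive r mv z i (fun y => expR (- (tot r y * 1))) z) <= _); last first.
  by rewrite lerD2l ler_pM2l.
rewrite mulr_sumr.
case: K {sum_le} => [|K]; first by rewrite !big_ord0 addr0.
rewrite !big_ord_recl/= mulr0 add0r lerD2l; apply: ler_sum => k _.
apply: le_trans (_ : alive r mv z k.+1
  (fun y => expR Lam * expR (- (tot r y * 1))) z <= _); last by rewrite aliveZ.
apply: (@le_alive _ _ _ _ _ reg z k.+1) => y.
by rewrite mulr1 -expRD -[leLHS]expR0 ler_expR subr_ge0.
Qed.

(* The time spent before the first return to z is at most this count. *)
Let count (N : set Omega) (w : Omega) : \bar R :=
  (\sum_(k <oo) (\sum_(j <oo)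
     (\1_[set w | [/\ predT (Y 0 w), away k w & (j%:R%:E < W k w)%E]] w)%:E
   + (\1_N w)%:E))%E.

Let count_ge_jump_time N w n : away n w -> (jump_time n.+1 w <= count N w)%E.
Proof.
move=> aw; rewrite /jump_time -(big_mkord predT (W^~ w)).
apply: (@le_trans _ _ (\sum_(0 <= k < n.+1) (\sum_(j <oo)
   (\1_[set w | [/\ predT (Y 0 w), away k w & (j%:R%:E < W k w)%E]] w)%:E
   + (\1_N w)%:E))%E); last first.
  by apply: nneseries_lim_ge => k _ _; rewrite adde_ge0// nneseries_ge0.
rewrite big_nat [leRHS]big_nat; apply: lee_sum => k /andP[_ kn].
rewrite -[leLHS]adde0; apply: leeD; last by rewrite lee_fin.
apply: le_trans (le_count_below _) _; apply: lee_nneseries.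
  by move=> j _ _; case: ifP.
move=> j _; case: ifPn => [jW|_]; last by rewrite lee_fin.
rewrite indicE mem_set//; split => // i /andP[i0 ik]; apply: aw.
by rewrite i0 (leq_trans ik).
Qed.

(** A path that never returned to z would have all its jump times below the finite count, against
    non-explosion. *)
Let count_return N w : (count N w < +oo)%E -> exists n,
  [/\ away n w, Y n.+1 w = z & (jump_time n.+1 w <= count N w)%E].
Proof.
move=> cfin.
have c0 : (0 <= count N w)%E.
  apply: nneseries_ge0 => k _ _; rewrite adde_ge0 ?lee_fin//.
  by apply: nneseries_ge0 => j _ _; rewrite lee_fin.
have [t ct] : exists t, count N w = t%:E.
  by exists (fine (count N w)); rewrite fineK// ge0_fin_numE.
case: (pselect (exists n, Y n.+1 w == z)) => [/ex_minnP[n /eqP Yn nmin]|nz].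
  have aw : away n w.
    move=> [//|j] /andP[_ jn] /eqP /nmin; rewrite leqNgt jn//.
  by exists n; split => //; exact: count_ge_jump_time.
have aw n : away n w.
  by move=> [//|j] _ Yj; apply: nz; exists j; exact/eqP.
have [n tn] := non_explosive w t.
have := lt_le_trans tn (le_jump_time w (leqnSn n)).
by rewrite -ct ltNge count_ge_jump_time.
Qed.

Let measurable_count N : measurable N -> measurable_fun [set: Omega] (count N).
Proof.
move=> mN; apply: ge0_emeasurable_sum => [k w _ _|k _].
  rewrite adde_ge0 ?lee_fin//.
  by apply: nneseries_ge0 => j _ _; rewrite lee_fin.
apply: emeasurable_funD; last first.
  by apply/measurable_EFinP; exact: measurable_indic.
apply: ge0_emeasurable_sum => [j w _ _|j _]; first by rewrite lee_fin.
by apply/measurable_EFinP/measurable_indic; exact: measurable_away_tail.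
Qed.

Variables (V : S -> R) (delta Lam : R).
Hypotheses (dV : drift_away r mv z V delta) (tot_le : forall x, tot r x <= Lam).

(** The double series is dominated by D rho^k exp(- e)^j: [alive_drift] gives the factor in k, and
    e, a lower bound on all exit rates, the factor in j. The rate at z enters e separately because
    the drift bounds rates only off z. *)
Let integral_count N x : measurable N -> P x N = 0%E ->
  (\int[P x]_w count N w < +oo)%E.
Proof.
move=> mN PN0.
have [d0 V1 _] := dV.
have V0 y : 0 <= V y := le_trans ler01 (V1 y).
have [C [rho [C0 rho0 rho1 Cz Cx]]] := alive_drift reg dV tot_le.
pose D := C + V x.
have alD k : alive r mv z k (fun=> 1) x <= D * rho ^+ k.
  apply: le_trans (_ : alive r mv z k V x <= _).
    by apply: le_alive.
  have [->|/Cx h] := eqVneq x z.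
    by apply: le_trans (Cz k) _; rewrite ler_wpM2r ?exprn_ge0 ?(ltW rho0)// /D lerDl.
  apply: le_trans (h k) _; rewrite mulrC ler_wpM2r ?exprn_ge0 ?(ltW rho0)//.
  by rewrite /D lerDr.
have D0 : 0 <= D by rewrite addr_ge0.
pose e := Num.min delta (tot r z).
have e0 : 0 < e by rewrite lt_min d0 tot_gt0.
have e_le y : e <= tot r y.
  have [->|yz] := eqVneq y z; first by rewrite /e ge_min lexx orbT.
  by apply: le_trans (tot_ge_drift reg dV yz); rewrite ge_min lexx.
have q0 : 0 < expR (- e) := expR_gt0 _.
have q1 : expR (- e) < 1 by rewrite expR_lt1 oppr_lt0.
have term k j : (\int[P x]_w
    (\1_[set w | [/\ predT (Y 0 w), away k w & (j%:R%:E < W k w)%E]] w)%:E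
    <= (D * rho ^+ k * expR (- e) ^+ j)%:E)%E.
  rewrite integral_indic//; last exact: measurable_away_tail.
  rewrite setIT [leLHS](law_away_tail x predT k (ler0n _ j)) mul1r lee_fin.
  apply: le_trans (_ : alive r mv z k (fun=> expR (- e) ^+ j * 1) x <= _).
    apply: le_alive => // y; rewrite mulr1 -expRM_natl ler_expR.
    by rewrite mulrN lerN2 mulrC ler_wpM2r.
  by rewrite aliveZ mulrC ler_wpM2r// exprn_ge0// ltW.
pose E := D / (1 - expR (- e)).
have E0 : 0 <= E by rewrite divr_ge0// subr_ge0 ltW.
rewrite integral_nneseries//; last 2 first.
- move=> k; apply: emeasurable_funD; last first.
    by apply/measurable_EFinP; exact: measurable_indic.
  apply: ge0_emeasurable_sum => [j w _ _|j _]; first by rewrite lee_fin.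
  by apply/measurable_EFinP/measurable_indic; exact: measurable_away_tail.
- move=> k w _; rewrite adde_ge0 ?lee_fin//.
  by apply: nneseries_ge0 => j _ _; rewrite lee_fin.
apply: (@le_lt_trans _ _ (\sum_(k <oo) (E * rho ^+ k)%:E)%E); last first.
  by apply: le_lt_trans (nneseries_geometric_le E0 rho0 rho1) _; rewrite ltry.
apply: lee_nneseries => [k _ _|k _].
  apply: integral_ge0 => w _; rewrite adde_ge0 ?lee_fin//.
  by apply: nneseries_ge0 => j _ _; rewrite lee_fin.
rewrite ge0_integralD//; last 3 first.
- by move=> w _; apply: nneseries_ge0 => j _ _; rewrite lee_fin.
- apply: ge0_emeasurable_sum => [j w _ _|j _]; first by rewrite lee_fin.
  by apply/measurable_EFinP/measurable_indic; exact: measurable_away_tail.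
- by apply/measurable_EFinP; exact: measurable_indic.
rewrite integral_indic// setIT [X in (_ + X)%E]PN0 adde0.
rewrite integral_nneseries//; last first.
  by move=> j; apply/measurable_EFinP/measurable_indic; exact: measurable_away_tail.
apply: le_trans (_ : \sum_(j <oo) (D * rho ^+ k * expR (- e) ^+ j)%:E <= _)%E.
  apply: lee_nneseries => [j _ _|j _]; last exact: term.
  by apply: integral_ge0 => w _; rewrite lee_fin.
apply: le_trans (nneseries_geometric_le _ q0 q1) _.
  by rewrite mulr_ge0// exprn_ge0// ltW.
by rewrite lee_fin /E mulrAC.
Qed.

Lemma drift_hits x : {ae P x, forall w, hits X z w}.
Proof.
have mc := measurable_count measurable0.
have := @integrable_ae _ _ _ (P x) setT measurableT (count set0).
have c0 w : (0 <= count set0 w)%E.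
  apply: nneseries_ge0 => k _ _; rewrite adde_ge0 ?lee_fin//.
  by apply: nneseries_ge0 => j _ _; rewrite lee_fin.
have ci : (P x).-integrable setT (count set0).
  apply/integrableP; split => //.
  rewrite (eq_integral (count set0)); first exact: integral_count.
  by move=> w _; rewrite gee0_abs.
move=> /(_ ci); apply: filterS => w /(_ Logic.I).
rewrite ge0_fin_numE// => cfin; have [n [_ Yn Jn]] := count_return cfin.
exists (fine (jump_time n.+1 w)); first by rewrite fine_ge0// jump_time_ge0.
have Jfin : jump_time n.+1 w \is a fin_num.
  by rewrite ge0_fin_numE ?jump_time_ge0//; exact: le_lt_trans Jn cfin.
apply: etrans Yn; apply: X_Y; rewrite fineK//.
by rewrite (jump_timeS n.+1) lteDl.
Qed.

Lemma drift_positive_recurrent : positive_recurrent P X.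
Proof.
exists z; split; last exact: drift_hits.
right.
(* N gathers two null events: not starting at z, and a first jump that stays at z. As [count N] is
   infinite on N, the bound on the return time can hold for every path, which a comparison without
   measurability requires. *)
pose N := [set w | [/\ predC1 z (Y 0 w), away 0 w & (0%:E < W 0 w)%E]] `|`
  [set w | Y 1 w = z].
have mN0 := measurable_away_tail (predC1 z) 0 0.
have mN : measurable N by apply: measurableU.
have PN : P z N = 0%E.
  have P0 : P z [set w | [/\ predC1 z (Y 0 w), away 0 w & (0%:E < W 0 w)%E]] = 0%E.
    by rewrite law_away_tail//= eqxx mul0r.
  apply/eqP; rewrite -measure_le0; apply: le_trans (measureU2 _ mN0 (mY 1 z)) _.
  by rewrite [X in (X + _)%E]P0 [X in (_ + X)%E]law_jump_self adde0.
apply: le_lt_trans (integral_count mN PN).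
have rt0 w : (0 <= return_time X z w)%E.
  apply: le_ereal_inf_tmp => _ [t [[s [s0 st _]] _] <-].
  by rewrite lee_fin (le_trans s0)// ltW.
apply: ge0_le_integral_nomeas => // w.
have [->|] := eqVneq (count N w) +oo%E; first exact: leey.
rewrite -ltey => cfin; have [n [aw Yn Jn]] := count_return cfin.
have nN : ~ N w.
  move=> Nw; move: cfin; rewrite ltey => /eqP; apply.
  apply/eqP; rewrite -leye_eq; apply: le_trans (le_count_below +oo%E) _.
  apply: lee_nneseries => k; first by case: ifP.
  move=> _; rewrite ltry -[leLHS]add0e; apply: leeD; last first.
    by rewrite indicE mem_set.
  by apply: nneseries_ge0 => j _ _; rewrite lee_fin.
have Y0 : Y 0 w = z.
  apply: contrapT => Y0; apply: nN; left; split => //=; first exact/eqP.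
  by move=> j; rewrite andbC leqn0; case: eqP => // ->.
have Y1 : Y 1 w <> z by move=> Y1; apply: nN; right.
have Jfin k : (k <= n.+1)%N -> jump_time k w \is a fin_num.
  move=> kn; rewrite ge0_fin_numE ?jump_time_ge0//.
  by apply: le_lt_trans (le_trans (le_jump_time w kn) Jn) cfin.
apply: le_trans Jn; apply: ereal_inf_lbound.
exists (fine (jump_time n.+1 w)); last by rewrite fineK// Jfin.
have n0 : (0 < n)%N by case: n Yn {aw Jfin} => [/Y1|].
split.
  exists (fine (jump_time 1 w)); split.
  - by rewrite fine_ge0// jump_time_ge0.
  - rewrite -lte_fin !fineK ?Jfin// (jump_timeS n).
    apply: lt_le_trans (leeD2r _ (le_jump_time w n0)) => /=.
    by rewrite lteDl// Jfin.
  - rewrite (_ : X _ w = Y 1 w)//; apply: X_Y; rewrite fineK ?Jfin//.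
    by rewrite (jump_timeS 1) lteDl// Jfin.
apply: etrans Yn; apply: X_Y; rewrite fineK ?Jfin//.
by rewrite (jump_timeS n.+1) lteDl// Jfin.
Qed.

End jump_chain.

(** * Transition probabilities over a short time *)

Lemma le_of_expR_damped {R : realType} (q x k : R) : 0 <= q -> 0 <= x ->
  (forall e, 0 < e -> x * expR (- (q * e)) <= k) -> x <= k.
Proof.
move=> q0 x0 h; apply/ler_addgt0Pr => eps eps0.
have qx0 : 0 <= q * x by rewrite mulr_ge0.
have e0 : 0 < eps / (q * x + 1) by rewrite divr_gt0// ltr_wpDl.
have := h _ e0; set e := eps / _ in e0 *.
have qe : q * x * e <= eps.
  rewrite /e mulrA ler_pdivrMr ?ltr_wpDl// mulrDr mulr1 [eps * _]mulrC lerDl.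
  exact: ltW.
have := expR_ge1Dx (- (q * e)) => /(ler_wpM2l x0) h1 h2.
have := le_trans h1 h2; rewrite mulrDr mulr1 mulrN lerBlDr => /le_trans; apply.
by rewrite lerD2l mulrA [x * q]mulrC.
Qed.

Section measure_lemmas.
Context {R : realType} {d : measure_display} {Omega : measurableType d}.
Variable mu : probability Omega R.

(** Both sides are finite measures in B, so agreement on a generating pi-system that contains the
    whole space is enough. *)
Lemma sigma_scale (G : set (set Omega)) (F1 F2 : set Omega) (c : R) :
  G `<=` measurable -> setI_closed G -> G setT -> 0 <= c ->
  measurable F1 -> measurable F2 ->
  (forall B, G B -> (mu (B `&` F1) = c%:E * mu (B `&` F2))%E) ->
  forall B, <<s G >> B -> (mu (B `&` F1) = c%:E * mu (B `&` F2))%E.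
Proof.
move=> Gm GI GT c0 mF1 mF2 H B sB.
have := @g_sigma_algebra_measure_unique _ _ _ G Gm (fun=> setT) _ _
  (mrestr mu mF1) (mscale (NngNum c0) (mrestr mu mF2)) GI _ _ B sB.
apply => //.
- by rewrite bigcup_const//; exists 0%N.
- move=> _; change (mu (setT `&` F1) < +oo)%E.
  by rewrite setTI; apply: le_lt_trans (probability_le1 mu mF1) _; rewrite ltry.
Qed.

Lemma measure_cells (E : set Omega) (C : nat -> set Omega) :
  (forall i, measurable (C i)) -> trivIset setT C -> measurable E ->
  E `<=` \bigcup_i C i -> mu E = (\sum_(i <oo) mu (C i `&` E))%E.
Proof.
move=> mC tC mE EC.
rewrite -measure_semi_bigcup -?setI_bigcupl.
- by rewrite setIC; congr (mu _); apply/esym/setIidPl.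
- by move=> i; exact: measurableI.
- move=> i j _ _ [w [[Ci _] [Cj _]]].
  by apply: tC => //; exists w.
- by apply: measurableI => //; exact: bigcupT_measurable.
Qed.

(* Cutting the values of J into cells of width e shows the identity up to a
   factor exp (q e). *)
Lemma memoryless (J U : Omega -> \bar R) (F : set Omega) (q t h : R) :
  measurable_fun setT J -> measurable_fun setT U -> measurable F ->
  (forall w, (0 <= J w)%E) -> 0 <= q -> 0 <= h ->
  (forall a b s, 0 <= s ->
    (mu ([set w | (a%:E < J w <= b%:E)%E] `&` (F `&` [set w | (s%:E < U w)%E]))
     = (expR (- (q * s)))%:E * mu ([set w | (a%:E < J w <= b%:E)%E] `&` F))%E) ->
  (mu ([set w | (J w <= t%:E)%E] `&` (F `&` [set w | ((t + h)%:E < J w + U w)%E]))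
   = (expR (- (q * h)))%:E *
     mu ([set w | (J w <= t%:E)%E] `&` (F `&` [set w | (t%:E < J w + U w)%E])))%E.
Proof.
move=> mJ mU mF J0 q0 h0 H.
pose E s := [set w | (J w <= t%:E)%E] `&` (F `&` [set w | (s%:E < J w + U w)%E]).
pose C e i := [set w | ((t - i.+1%:R * e)%:E < J w <= (t - i%:R * e)%:E)%E].
have mlt s : measurable [set w | (s%:E < U w)%E].
  by rewrite -[mkset _]setTI; exact: emeasurable_fun_o_infty.
have mJb a b : measurable [set w | (a%:E < J w <= b%:E)%E].
  have -> : [set w | (a%:E < J w <= b%:E)%E] =
      (setT `&` [set w | (a%:E < J w)%E]) `&` (setT `&` [set w | (J w <= b%:E)%E]).
    apply/seteqP; split => w /=; first by move=> /andP[].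
    by move=> [[_ ->] [_ ->]].
  apply: measurableI; first exact: emeasurable_fun_o_infty.
  exact: emeasurable_fun_infty_c.
have mE s : measurable (E s).
  apply: measurableI.
    by rewrite -[mkset _]setTI; exact: emeasurable_fun_infty_c.
  apply: measurableI => //; rewrite -[mkset _]setTI.
  by apply: emeasurable_fun_o_infty => //; exact: emeasurable_funD.
have mC e i : measurable (C e i) by exact: mJb.
have tC e : 0 < e -> trivIset setT (C e).
  move=> e0 i j _ _ [w [/andP[i1 i2] /andP[j1 j2]]].
  wlog ij : i j i1 i2 j1 j2 / (i <= j)%N.
    move=> hw; case/orP: (leq_total i j) => ij; first exact: (hw i j).
    by apply/esym; exact: (hw j i).
  apply/eqP; rewrite eqn_leq ij leqNgt; apply/negP => ji.
  have := lt_le_trans i1 j2; rewrite lte_fin ltrD2l ltrN2 ltr_pM2r//.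
  by rewrite ltr_nat ltnNge ji.
have EC e s : 0 < e -> E s `<=` \bigcup_i C e i.
  move=> e0 w [/= Jt _].
  have [j Jj] : exists j, J w = j%:E.
    exists (fine (J w)); rewrite fineK// ge0_fin_numE//.
    by apply: le_lt_trans Jt _; rewrite ltry.
  have jt : j <= t by rewrite -lee_fin -Jj.
  exists (Num.trunc ((t - j) / e)) => //=; rewrite /C/= Jj lte_fin lee_fin.
  have /truncn_itv/andP[h1 h2] : 0 <= (t - j) / e.
    by rewrite divr_ge0 ?subr_ge0// ltW.
  move: h1 h2; rewrite ler_pdivlMr// ltr_pdivrMr// => h1 h2.
  by apply/andP; split; lra.
(* On cell i, J + U > t + s is implied by U > (i + 1) e + s and implies U > i e + s. *)
have lower e i s : 0 <= s -> 0 < e ->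
    ((expR (- (q * (i.+1%:R * e + s))))%:E * mu (C e i `&` F) <=
     mu (C e i `&` E (t + s)%R))%E.
  move=> s0 e0; rewrite -H; last by rewrite addr_ge0// mulr_ge0// ltW.
  apply: le_measure; rewrite ?inE.
  - by apply: measurableI => //; exact: measurableI.
  - exact: measurableI.
  move=> w [/= Cw [Fw Uw]]; split => //; split; [|split] => //=.
    case/andP: Cw => _ /le_trans; apply; rewrite lee_fin lerBlDr lerDl.
    by rewrite mulr_ge0// ltW.
  case/andP: Cw => Jw _.
  rewrite (_ : t + s = (t - i.+1%:R * e) + (i.+1%:R * e + s)); last by ring.
  by rewrite EFinD; exact: lteD.
have upper e i s : 0 <= s -> 0 < e ->
    (mu (C e i `&` E (t + s)%R) <=
     (expR (- (q * (i%:R * e + s))))%:E * mu (C e i `&` F))%E.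
  move=> s0 e0; rewrite -H; last by rewrite addr_ge0// mulr_ge0// ltW.
  apply: le_measure; rewrite ?inE.
  - exact: measurableI.
  - by apply: measurableI => //; exact: measurableI.
  move=> w [/= Cw [_ [Fw /= Uw]]]; split => //; split => //=.
  case/andP: Cw => _ Jw.
  have := lt_le_trans Uw (leeD2r (U w) Jw).
  rewrite -lteBlDl// -EFinB; congr (_ < _)%E; congr _%:E; ring.
have sumE e s : 0 < e -> mu (E s) = (\sum_(i <oo) mu (C e i `&` E s))%E.
  by move=> e0; apply: measure_cells => //; [exact: tC|exact: EC].
(* The two bounds on a cell differ by exp(- q e) whatever i is, so the series over the cells compare
   term by term. *)
have compare s s' e : 0 <= s -> 0 <= s' -> 0 < e ->
    ((expR (- (q * (s + e)))%R)%:E * mu (E (t + s')%R) <=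
     (expR (- (q * s')))%:E * mu (E (t + s)%R))%E.
  move=> s0 s'0 e0; rewrite (sumE e)// [in leRHS](sumE e)//.
  rewrite -!nneseriesZl//; apply: lee_nneseries => [i _ _|i _].
    by rewrite mule_ge0.
  apply: le_trans (lee_wpmul2l _ (upper _ _ _ s'0 e0)) _; first by rewrite lee_fin.
  apply: le_trans (lee_wpmul2l _ (lower _ _ _ s0 e0)); last by rewrite lee_fin.
  rewrite !muleA -!EFinM -!expRD; rewrite le_eqVlt; apply/orP; left; apply/eqP.
  by congr (_%:E * _)%E; congr expR; rewrite -natr1; ring.
have fE s : mu (E s) \is a fin_num by exact: fin_num_measure.
rewrite -/(E (t + h)) -/(E t).
have := compare h 0; have := compare 0 h.
rewrite !addr0 !mulr0 !oppr0 !expR0 !mul1e.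
rewrite -(fineK (fE (t + h))) -(fineK (fE t)).
have x0 s : 0 <= fine (mu (E s)) by rewrite fine_ge0.
set x := fine (mu (E (t + h))); set y := fine (mu (E t)).
move=> c1 c2; congr _%:E; apply/eqP; rewrite eq_le; apply/andP; split.
  apply: (@le_of_expR_damped _ q) => //; first exact: x0.
  move=> e e0.
  have := c1 e (lexx 0) h0 e0.
  by rewrite -!EFinM lee_fin add0r mulrC.
apply: (@le_of_expR_damped _ q) => //; first by rewrite mulr_ge0 ?expR_ge0 ?x0.
move=> e e0; have := c2 e h0 (lexx 0) e0.
rewrite -!EFinM lee_fin mulrDr opprD expRD; congr (_ <= _); ring.
Qed.

End measure_lemmas.

Section transition.
Context {R : realType} {S : countType} {I : finType}.
Variables (r : S -> I -> R) (mv : S -> I -> S).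
Hypothesis reg : regular_moves r mv.
Context {d : measure_display} {Omega : measurableType d}.
Variables (P : S -> probability Omega R) (X : R -> Omega -> S).
Variables (Y : nat -> Omega -> S) (W : nat -> Omega -> \bar R).
Hypothesis path : jump_path (move_rate r mv) P X Y W.

Let r_ge0 x i : 0 <= r x i. Proof. by case: reg. Qed.
Let tot_gt0 x : 0 < tot r x. Proof. by case: reg. Qed.
Let mY n y : measurable [set w | Y n w = y]. Proof. by case: path => -[]. Qed.
Let mW n : measurable_fun [set: Omega] (W n). Proof. by case: path => -[]. Qed.
Let W_gt0 n w : (0 < W n w)%E. Proof. by case: path. Qed.
Let non_explosive w (t : R) : exists n, (t%:E < jump_time W n w)%E.
Proof. by case: path. Qed.
Let X_Y w n (t : R) : (jump_time W n w <= t%:E)%E ->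
  (t%:E < jump_time W n.+1 w)%E -> X t w = Y n w.
Proof. by case: path => _ _ _ + _; apply. Qed.
Let law_cyl' x n (A : nat -> pred S) (s : nat -> R) : (forall k, 0 <= s k) ->
  P x [set w | forall k, (k <= n)%N -> A k (Y k w) /\ ((s k)%:E < W k w)%E] =
  (cyl r mv n A s x)%:E.
Proof. by case: path => _ _ _ _ law; exact: law_cyl. Qed.
Local Notation jump_time := (jump_time W).

Lemma cylS n (A : nat -> pred S) (s : nat -> R) x :
  cyl r mv n.+1 A s x = (A 0 x)%:R * expR (- (tot r x * s 0)) *
    step r mv (cyl r mv n (A \o succn) (s \o succn)) x.
Proof. by []. Qed.

Lemma cyl_last n (A : nat -> pred S) (s : nat -> R) x y :
  (forall v, A n v -> v = y) ->
  cyl r mv n A s x = expR (- (tot r y * s n)) *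
    cyl r mv n A (fun k => if k == n then 0 else s k) x.
Proof.
elim: n A s x => [|n IH] A s x Ay /=.
  rewrite mulr0 oppr0 expR0 !mulr1; case: (boolP (A 0 x)) => [/Ay ->|_].
    by rewrite mulr1 mul1r.
  by rewrite !mul0r mulr0.
rewrite [RHS]mulrCA -[in RHS]stepZ; congr (_ * _); apply: eq_step => v.
by rewrite (IH (A \o succn)).
Qed.

Lemma cyl_next n (A : nat -> pred S) (s : nat -> R) x y y' :
  (forall v, A n v -> v = y) -> (forall v, A n.+1 v = (v == y')) ->
  cyl r mv n.+1 A s x = jump r mv y y' * expR (- (tot r y' * s n.+1)) *
    cyl r mv n A s x.
Proof.
elim: n A s x => [|n IH] A s x Ay Ay'.
  rewrite /= mulr1 [RHS]mulrC; have [/Ay ->|_] := boolP (A 0 x); last by rewrite !mul0r.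
  congr (_ * _); rewrite -step_delta mulrC -stepZ; apply: eq_step => v /=.
  rewrite Ay' mulr1 mulrC [y' == v]eq_sym; case: eqP => [->//|_].
  by rewrite !mulr0.
rewrite [LHS]cylS [in RHS]cylS [RHS]mulrCA -[in RHS]stepZ; congr (_ * _); apply: eq_step => v.
by rewrite (IH (A \o succn)).
Qed.

(** A pi-system generating the sigma-algebra of W 0, ..., W (n - 1), for which [jump_time n] is
    measurable. Thresholds are nonnegative because [law] covers only those. *)
Definition tails n : set (set Omega) :=
  [set B | exists2 s : nat -> R, (forall k, 0 <= s k) &
    B = [set w | forall k, (k < n)%N -> ((s k)%:E < W k w)%E]].

Lemma tails_measurable n : tails n `<=` measurable.
Proof.
move=> _ [s _ ->]; apply: (@bigcap_measurableType _ _
  (fun k => [set w | ((s k)%:E < W k w)%E]) [set k | (k < n)%N]) => k _.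
exact: measurable_tail.
Qed.

Lemma tails_setI n : setI_closed (tails n).
Proof.
move=> _ _ [s s0 ->] [s' s'0 ->].
exists (fun k => Num.max (s k) (s' k)); first by move=> k; rewrite le_max s0.
apply/seteqP; split => w /=.
  by move=> [h h'] k kn; rewrite EFin_max gt_max h ?h'.
by move=> h; split => k /h; rewrite EFin_max gt_max => /andP[].
Qed.

Lemma tailsT n : tails n setT.
Proof.
exists (fun=> 0) => //; apply/seteqP; split => w //= _ k _.
Qed.

Lemma sub_tails n B : <<s tails n >> B -> measurable B.
Proof.
by apply: smallest_sub; [exact: sigma_algebra_measurable|exact: tails_measurable].
Qed.

Local Notation Om n := (g_sigma_algebraType (tails n)).

Lemma measurable_jump_time m n : (m <= n)%N ->
  @measurable_fun _ _ (Om n) (\bar R) setT (jump_time m).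
Proof.
have mWk k : (k < n)%N -> @measurable_fun _ _ (Om n) (\bar R) setT (W k).
  move=> kn; apply: (measurability _ (ErealGenOInfty.measurableE R)) => //.
  move=> _ [_ [a ->]] <-; rewrite setTI; apply: sub_sigma_algebra.
  exists (fun j => if j == k then Num.max a 0 else 0).
    by move=> j; case: ifP => // _; rewrite le_max lexx orbT.
  apply/seteqP; split => w /=.
    rewrite in_itv/= andbT => aW j jn; case: eqP => [->|_]; last exact: W_gt0.
    by rewrite EFin_max gt_max aW W_gt0.
  move=> /(_ k kn); rewrite eqxx in_itv/= andbT EFin_max gt_max.
  by case/andP.
elim: m => [|m IH] mn.
  rewrite (_ : jump_time 0 = cst 0%E); first exact: measurable_cst.
  by apply/funext => w; exact: jump_time0.
rewrite (_ : jump_time m.+1 = fun w => (jump_time m w + W m w)%E); last first.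
  by apply/funext => w; exact: jump_timeS.
by apply: emeasurable_funD; [apply: IH; exact: ltnW|exact: mWk].
Qed.

Let sigma_interval n a b :
  <<s tails n >> [set w | (a%:E < jump_time n w <= b%:E)%E].
Proof.
have -> : [set w | (a%:E < jump_time n w <= b%:E)%E] =
    (setT `&` [set w | (a%:E < jump_time n w)%E]) `&`
    (setT `&` [set w | (jump_time n w <= b%:E)%E]).
  apply/seteqP; split => w /=; first by move=> /andP[].
  by move=> [[_ ->] [_ ->]].
apply: (@measurableI _ (Om n)).
  exact: (emeasurable_fun_o_infty measurableT (measurable_jump_time (leqnn n))).
exact: (emeasurable_fun_infty_c measurableT (measurable_jump_time (leqnn n))).
Qed.

Let measurable_J n : measurable_fun setT (jump_time n).
Proof.
move=> _ B mB; rewrite setTI; apply: sub_tails (n) _ _.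
by have := measurable_jump_time (leqnn n) measurableT mB; rewrite setTI.
Qed.

Lemma law_hold n x y (B : set Omega) (s : R) : 0 <= s -> <<s tails n >> B ->
  (P x (B `&` ([set w | Y n w = y] `&` [set w | (s%:E < W n w)%E])) =
   (expR (- (tot r y * s)))%:E * P x (B `&` [set w | Y n w = y]))%E.
Proof.
move=> s0; apply: (sigma_scale (@tails_measurable n) (@tails_setI n)) => //.
- exact: tailsT.
- by apply: measurableI => //; exact: measurable_tail.
move=> _ [sk sk0 ->].
pose A k : pred S := if k == n then pred1 y else predT.
pose f c k : R := if k == n then c else sk k.
have evE c : 0 <= c -> P x ([set w | forall k, (k < n)%N -> ((sk k)%:E < W k w)%E]
    `&` ([set w | Y n w = y] `&` [set w | (c%:E < W n w)%E])) =
    (cyl r mv n A (f c) x)%:E.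
  move=> c0; rewrite -law_cyl'; last by move=> k; rewrite /f; case: eqP.
  congr (P x _); apply/seteqP; split => w /=.
    move=> [h [Yy cW]] k; rewrite leq_eqVlt /A /f => /predU1P[->|kn].
      by rewrite eqxx /= Yy eqxx.
    by rewrite ltn_eqF//=; split => //; exact: h.
  move=> h; split.
    by move=> k kn; have [_] := h _ (ltnW kn); rewrite /f ltn_eqF.
  by have [] := h _ (leqnn n); rewrite /A /f eqxx /= => /eqP.
rewrite evE// [X in P x (_ `&` X)](_ : _ = [set w | Y n w = y] `&`
    [set w | (0%:E < W n w)%E]); last first.
  by apply/seteqP; split => w /=; [move=> ->|case].
rewrite evE// -EFinM; congr _%:E.
have Ay v : A n v -> v = y by rewrite /A eqxx => /eqP.
rewrite (cyl_last (f s) x Ay).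
rewrite (_ : f s n = s); last by rewrite /f eqxx.
by congr (_ * cyl _ _ _ _ _ _); apply/funext => k; rewrite /f; case: (k == n).
Qed.

(** B may now involve W n, as it will say that the jump of index n + 1 falls between t and t + h:
    given Y n, the next state and its holding time do not depend on the holding times so far. *)
Lemma law_next n x y y' (B : set Omega) (s : R) : 0 <= s -> <<s tails n.+1 >> B ->
  (P x (B `&` ([set w | Y n w = y] `&` ([set w | Y n.+1 w = y'] `&`
     [set w | (s%:E < W n.+1 w)%E]))) =
   (jump r mv y y' * expR (- (tot r y' * s)))%:E * P x (B `&` [set w | Y n w = y]))%E.
Proof.
move=> s0; apply: (sigma_scale (@tails_measurable n.+1) (@tails_setI n.+1)) => //.
- exact: tailsT.
- by rewrite mulr_ge0 ?expR_ge0 ?(jump_ge0 reg).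
- by apply: measurableI => //; apply: measurableI => //; exact: measurable_tail.
move=> _ [sk sk0 ->].
pose A k : pred S :=
  if k == n.+1 then pred1 y' else if k == n then pred1 y else predT.
pose f k : R := if k == n.+1 then s else sk k.
have f0 k : 0 <= f k by rewrite /f; case: eqP.
rewrite (_ : _ `&` _ = [set w | forall k, (k <= n.+1)%N ->
    A k (Y k w) /\ ((f k)%:E < W k w)%E]); last first.
  apply/seteqP; split => w /=.
    move=> [h [Yy [Yy' cW]]] k; rewrite leq_eqVlt /A /f => /predU1P[->|kn].
      by rewrite eqxx /= Yy' eqxx.
    rewrite (ltn_eqF kn); split; last exact: h.
    by case: eqP => // ->; rewrite Yy /= eqxx.
  move=> h; split.
    by move=> k kn; have [_] := h _ (ltnW kn); rewrite /f ltn_eqF.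
  have [] := h _ (leqnn _); rewrite /A /f eqxx /= => /eqP -> ->.
  by have [] := h _ (leqnSn _); rewrite /A ltn_eqF// eqxx /= => /eqP ->.
rewrite law_cyl'//.
rewrite (_ : _ `&` _ = [set w | forall k, (k <= n)%N ->
    A k (Y k w) /\ ((f k)%:E < W k w)%E]); last first.
  apply/seteqP; split => w /=.
    move=> [h Yy] k kn; rewrite /A /f ltn_eqF//; split; last exact: h.
    by case: eqP => // ->; rewrite Yy /= eqxx.
  move=> h; split.
    by move=> k kn; have [_] := h _ kn; rewrite /f ltn_eqF.
  by have [] := h _ (leqnn _); rewrite /A ltn_eqF// eqxx /= => /eqP ->.
rewrite law_cyl'// -EFinM; congr _%:E.
have Ay v : A n v -> v = y by rewrite /A ltn_eqF// eqxx => /eqP.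
have Ay' v : A n.+1 v = (v == y') by rewrite /A eqxx.
by rewrite (cyl_next f x Ay Ay') {1}/f eqxx.
Qed.

(** Time t falls in the sojourn of index n, spent at y. The next jump time is written as a sum to
    fit [memoryless]. *)
Definition visit n y (t : R) : set Omega := [set w | (jump_time n w <= t%:E)%E] `&`
  ([set w | Y n w = y] `&` [set w | (t%:E < jump_time n w + W n w)%E]).

Lemma measurable_visit n y t : measurable (visit n y t).
Proof.
apply: measurableI.
  by rewrite -[mkset _]setTI; exact: emeasurable_fun_infty_c.
apply: measurableI => //; rewrite -[mkset _]setTI.
by apply: emeasurable_fun_o_infty => //; exact: emeasurable_funD.
Qed.

Let stay n y t h : set Omega := [set w | (jump_time n w <= t%:E)%E] `&`
  ([set w | Y n w = y] `&` [set w | ((t + h)%:E < jump_time n w + W n w)%E]).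

Let law_stay x n y t h : 0 <= h ->
  (P x (stay n y t h) = (expR (- (tot r y * h)))%:E * P x (visit n y t))%E.
Proof.
move=> h0; apply: memoryless => //.
- by move=> w; exact: (jump_time_ge0 path).
- exact: ltW.
- by move=> a b s s0; apply: law_hold.
Qed.

(** Either no jump during h, or one jump to y' followed by a sojourn longer than h. Paths with more
    jumps are dropped, so this only bounds the transition probability from below. *)
Definition short_kernel (h : R) (y y' : S) : R :=
  (y == y')%:R * expR (- (tot r y * h)) +
  jump r mv y y' * expR (- (tot r y' * h)) * (1 - expR (- (tot r y * h))).

Lemma short_kernel_ge0 h y y' : 0 <= h -> 0 <= short_kernel h y y'.
Proof.
move=> h0; apply: addr_ge0; first by rewrite mulr_ge0 ?expR_ge0.
apply: mulr_ge0; first by rewrite mulr_ge0 ?expR_ge0 ?(jump_ge0 reg).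
by rewrite subr_ge0 -expR0 ler_expR oppr_le0 mulr_ge0// ltW.
Qed.

Lemma measurable_X t y : 0 <= t -> measurable [set w | X t w = y].
Proof.
move=> t0; rewrite (_ : mkset _ = \bigcup_n visit n y t).
  by apply: bigcupT_measurable => n; exact: measurable_visit.
apply/seteqP; split => w /=.
  move=> Xy; have [n [Jn Jn1]] := jump_index path w t0.
  exists n => //; split => //; split; first by rewrite /= -(X_Y Jn Jn1).
  by rewrite /= -jump_timeS.
by move=> [n _ [Jn [<- Jn1]]]; apply: X_Y => //; rewrite jump_timeS.
Qed.

(** Two disjoint events put X at y' at time t + h: in H the sojourn at y outlasts t + h; in G it
    ends in between, the next state is y' and is held for more than h. B is what remains of the
    visit without [stay], whence the factor 1 - exp(- tot y h). *)
Let visit_step x n y y' t h : 0 <= t -> 0 <= h ->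
  ((short_kernel h y y')%:E * P x (visit n y t) <=
   P x ([set w | X (t + h) w = y'] `&` visit n y t))%E.
Proof.
move=> t0 h0.
have th0 : 0 <= t + h by rewrite addr_ge0.
have mstay : measurable (stay n y t h).
  apply: measurableI.
    by rewrite -[mkset _]setTI; exact: emeasurable_fun_infty_c.
  apply: measurableI => //; rewrite -[mkset _]setTI.
  by apply: emeasurable_fun_o_infty => //; exact: emeasurable_funD.
pose B := [set w | (jump_time n w <= t%:E)%E] `&`
  [set w | (t%:E < jump_time n.+1 w <= (t + h)%:E)%E].
have sB : <<s tails n.+1 >> B.
  apply: (@measurableI _ (Om n.+1)); last exact: sigma_interval.
  rewrite -[mkset _]setTI.
  exact: (emeasurable_fun_infty_c measurableT (measurable_jump_time (leqnSn n))).
have sub : stay n y t h `<=` visit n y t.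
  move=> w [Jt [Yy Jh]]; split => //; split => //=.
  by apply: le_lt_trans Jh; rewrite lee_fin lerDl.
have visitB : visit n y t = (B `&` [set w | Y n w = y]) `|` stay n y t h.
  apply/seteqP; split => w /=.
    move=> [Jt [Yy JW]].
    case: (ltP (t + h)%:E (jump_time n w + W n w)%E) => Jh; [by right|left].
    by split => //; split => //=; rewrite jump_timeS JW.
  move=> [[[Jt /andP[JW _]] Yy]|/sub//].
  by split => //; split => //=; rewrite -jump_timeS.
have disj : (B `&` [set w | Y n w = y]) `&` stay n y t h = set0.
  apply/seteqP; split => w //= -[[[_ /andP[_ Jh]] _] [_ [_]]].
  by rewrite /= -jump_timeS ltNge Jh.
have mBY : measurable (B `&` [set w | Y n w = y]).
  by apply: measurableI => //; exact: (@sub_tails n.+1).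
have PB : P x (B `&` [set w | Y n w = y]) =
    ((1 - expR (- (tot r y * h)))%:E * P x (visit n y t))%E.
  have split_visit (u v : \bar R) (e : R) : u \is a fin_num -> v \is a fin_num ->
      (v = e%:E * (u + v))%E -> (u = (1 - e)%:E * (u + v))%E.
    move: u v => [u| |] [v| |]//= _ _; rewrite -EFinD -!EFinM => -[h1].
    by congr _%:E; lra.
  have PV : (P x (visit n y t) =
      P x (B `&` [set w | Y n w = y]) + P x (stay n y t h))%E.
    by rewrite visitB; exact: measureU.
  rewrite PV; apply: split_visit; [exact: fin_num_measure|exact: fin_num_measure|].
  by rewrite -PV; exact: law_stay.
pose G := B `&` ([set w | Y n w = y] `&` ([set w | Y n.+1 w = y'] `&`
   [set w | (h%:E < W n.+1 w)%E])).
have mG : measurable G.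
  apply: measurableI; first exact: (@sub_tails n.+1).
  by apply: measurableI => //; apply: measurableI => //; exact: measurable_tail.
pose H := if y == y' then stay n y t h else set0.
have mH : measurable H by rewrite /H; case: ifP.
have PG := law_next x y y' h0 sB.
rewrite -/G PB in PG.
have PH : P x H = (((y == y')%:R * expR (- (tot r y * h)))%:E * P x (visit n y t))%E.
  rewrite /H; case: eqP => _; first by rewrite mul1r law_stay.
  by rewrite measure0 mul0r mul0e.
have GH : G `&` H = set0.
  apply/seteqP; split => w //= -[[Bw [Yy _]]]; rewrite /H; case: ifP => // _ sw.
  by have : (B `&` [set w | Y n w = y] `&` stay n y t h) w; [|rewrite disj].
apply: (@le_trans _ _ (P x (G `|` H))); last first.
  apply: le_measure; rewrite ?inE.
  - exact: measurableU.
  - by apply: measurableI; [exact: measurable_X|exact: measurable_visit].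
  move=> w [[[Jt /= /andP[tJ Jh]] [Yy [Yy' hW]]]|].
    split; last by split => //; split => //=; rewrite -jump_timeS.
    rewrite /= -Yy'; apply: X_Y => //; rewrite jump_timeS EFinD.
    exact: lteD.
  rewrite /H; case: eqP => // <- sw; split; last exact: sub.
  case: sw => Jt [Yy Jh]; rewrite /= -Yy; apply: X_Y.
    by apply: le_trans Jt _; rewrite lee_fin lerDl.
  by rewrite jump_timeS.
rewrite measureU// [X in (_ <= X + _)%E]PG [X in (_ <= _ + X)%E]PH.
rewrite muleA -EFinM -ge0_muleDl//; last first.
  rewrite lee_fin; apply: mulr_ge0.
    by rewrite mulr_ge0 ?expR_ge0 ?(jump_ge0 reg).
  by rewrite subr_ge0 -expR0 ler_expR oppr_le0 mulr_ge0// ltW.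
by rewrite -EFinD addrC.
Qed.

Let idx (t : R) (w : Omega) : nat := (ex_minn (non_explosive w t)).-1.

Let idxP t w : 0 <= t ->
  (jump_time (idx t w) w <= t%:E)%E /\ (t%:E < jump_time (idx t w).+1 w)%E.
Proof.
move=> t0; rewrite /idx; case: ex_minnP => -[|n] tn nmin.
  by move: tn; rewrite jump_time0 lte_fin ltNge t0.
split=> //=; rewrite leNgt; apply/negP => /nmin.
by rewrite ltnn.
Qed.

Let visitE n y t : 0 <= t -> visit n y t =
  [set w | idx t w = n] `&` [set w | Y n w = y].
Proof.
move=> t0; apply/seteqP; split => w /=.
  move=> [Jt [Yy tJ]]; split => //; have [h1 h2] := idxP w t0.
  by apply: (jump_time_uniq path h1 h2 Jt); rewrite jump_timeS.
move=> [<- Yy]; have [h1 h2] := idxP w t0.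
by split => //; split => //; rewrite /= -jump_timeS.
Qed.

Let measurable_idx t n : 0 <= t -> measurable [set w | idx t w = n].
Proof.
move=> t0; rewrite (_ : mkset _ = [set w | exists y, visit n y t w]); last first.
  apply/seteqP; split => w /=; first by move=> h; exists (Y n w); rewrite visitE.
  by move=> [y]; rewrite visitE// => -[].
rewrite (_ : mkset _ = [set w | (jump_time n w <= t%:E)%E] `&`
    [set w | (t%:E < jump_time n w + W n w)%E]).
  apply: measurableI.
    by rewrite -[mkset _]setTI; exact: emeasurable_fun_infty_c.
  rewrite -[mkset _]setTI.
  by apply: emeasurable_fun_o_infty => //; exact: emeasurable_funD.
apply/seteqP; split => w /=; first by move=> [y [? []]].
by move=> [? ?]; exists (Y n w).
Qed.

Let law_visit x t (E : set Omega) : 0 <= t -> measurable E ->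
  P x E = (\esum_(n in [set: nat]) \esum_(y in [set: S]) P x (E `&` visit n y t))%E.
Proof.
move=> t0 mE; rewrite (measure_partition (P x) (fun n => measurable_idx n t0))//.
apply: eq_esum => n _.
rewrite (measure_partition (P x) (mY n)); last first.
  by apply: measurableI => //; exact: measurable_idx.
by apply: eq_esum => y _; rewrite visitE// setIA.
Qed.

Let law_X x t y : 0 <= t ->
  P x [set w | X t w = y] = (\esum_(n in [set: nat]) P x (visit n y t))%E.
Proof.
move=> t0; have mX := measurable_X y t0.
rewrite (measure_partition (P x) (fun n => measurable_idx n t0))//.
apply: eq_esum => n _; congr (P x _); rewrite visitE//.
apply/seteqP; split => w /= [h1 h2]; split => //; have [h3 h4] := idxP w t0.
  by rewrite -h1 -h2; apply/esym/X_Y; rewrite -?h2.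
by rewrite -h2 -h1; apply: X_Y.
Qed.

Lemma short_kernel_le x y' t h : 0 <= t -> 0 <= h ->
  (\esum_(y in [set: S]) (P x [set w | X t w = y] * (short_kernel h y y')%:E) <=
   P x [set w | X (t + h) w = y'])%E.
Proof.
move=> t0 h0; have th0 : 0 <= t + h by rewrite addr_ge0.
rewrite (law_visit x t0 (measurable_X y' th0)).
rewrite (esum_exchange (a := fun n y =>
  P x ([set w | X (t + h) w = y'] `&` visit n y t))); last first.
  by move=> n y; exact: measure_ge0.
apply: le_esum => y _; rewrite law_X// muleC -ge0_esumZl ?short_kernel_ge0//.
by apply: le_esum => n _; exact: visit_step.
Qed.

Lemma law_X0 x y : P x [set w | X 0 w = y] = ((x == y)%:R)%:E.
Proof.
rewrite (_ : mkset _ = [set w | forall k, (k <= 0)%N ->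
    (pred1 y) (Y k w) /\ (0%:E < W k w)%E]); last first.
  have X0 w : X 0 w = Y 0 w.
    by apply: X_Y; rewrite ?jump_timeS jump_time0 ?add0e.
  apply/seteqP; split => w /=; rewrite X0.
    by move=> h k; rewrite leqn0 => /eqP ->; rewrite h eqxx.
  by move=> /(_ 0%N isT)[/eqP].
by rewrite (@law_cyl' x 0%N (fun=> pred1 y) (fun=> 0))//= mulr0 oppr0 expR0 !mulr1.
Qed.

Lemma law_X_total x t : 0 <= t ->
  (\esum_(y in [set: S]) P x [set w | X t w = y] = 1)%E.
Proof.
move=> t0; rewrite -(probability_setT (P x)).
rewrite (measure_partition (P x) (fun y => measurable_X y t0))//.
by apply: eq_esum => y _; rewrite setTI.
Qed.

End transition.

(** * Stationary distributions *)

(** The nonnegative differences sum to zero. This turns every one-sided bound on evolved laws into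
    an identity. *)
Lemma esum_le_eq {R : realType} (T : choiceType) (f g : T -> \bar R) :
  (forall x, (0 <= f x)%E) -> (forall x, (f x <= g x)%E) ->
  (\esum_(x in [set: T]) g x <= \esum_(x in [set: T]) f x)%E ->
  (\esum_(x in [set: T]) f x < +oo)%E -> f =1 g.
Proof.
move=> f0 fg gf foo.
have ffin x : f x \is a fin_num.
  rewrite ge0_fin_numE//; apply: le_lt_trans foo.
  exact: (esum_ge1 (a := f)).
have d0 x : (0 <= g x - f x)%E by rewrite sube_ge0 ?ffin.
have gE : (\esum_(x in [set: T]) g x =
    \esum_(x in [set: T]) f x + \esum_(x in [set: T]) (g x - f x))%E.
  rewrite -esumD//; apply: eq_esum => x _.
  by rewrite addeC subeK.
have D0 : (\esum_(x in [set: T]) (g x - f x) <= 0)%E.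
  have F_fin : \esum_(x in [set: T]) f x \is a fin_num.
    by rewrite ge0_fin_numE// esum_ge0.
  by move: gf; rewrite gE -[leRHS]adde0 leeD2lE.
move=> x; apply/eqP; rewrite eq_le fg/= -sube_le0 ?ffin//.
by apply: le_trans D0; exact: (esum_ge1 (a := fun x => g x - f x)%E).
Qed.

Lemma bernoulli_le {R : realType} (a : R) k : 0 <= a <= 1 ->
  1 - a *+ k <= (1 - a) ^+ k.
Proof.
move=> /andP[a0 a1]; elim: k => [|k IH]; first by rewrite mulr0n subr0.
rewrite exprS; apply: le_trans (_ : (1 - a) * (1 - a *+ k) <= _); last first.
  by rewrite ler_wpM2l// subr_ge0.
have : 0 <= a * (a *+ k) by rewrite mulr_ge0// mulrn_wge0.
rewrite mulrS; lra.
Qed.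

Section stationarity.
Context {R : realType} {S : countType} {I : finType}.
Variables (r : S -> I -> R) (mv : S -> I -> S).
Hypothesis reg : regular_moves r mv.
Context {d : measure_display} {Omega : measurableType d}.
Variables (P : S -> probability Omega R) (X : R -> Omega -> S).
Variables (Y : nat -> Omega -> S) (W : nat -> Omega -> \bar R).
Hypothesis path : jump_path (move_rate r mv) P X Y W.
Variable Lam : R.
Hypothesis tot_le : forall x, tot r x <= Lam.

Let r_ge0 x i : 0 <= r x i. Proof. by case: reg. Qed.
Let tot_gt0 x : 0 < tot r x. Proof. by case: reg. Qed.
Let move_ge0 x y : 0 <= move_rate r mv x y.
Proof. by apply: sumr_ge0 => i _; rewrite mulr_ge0. Qed.

(** A first-order expansion uniform in the states: both factors of the one-jump term are at least 1
    - Lam h times their leading order. *)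
Let short_kernel_ge h y y' : 0 <= h -> Lam * h <= 1 ->
  (y == y')%:R * (1 - tot r y' * h) +
    move_rate r mv y y' * (h * (1 - Lam * h) ^+ 2) <= short_kernel r mv h y y'.
Proof.
move=> h0 Lh1.
have Lh v : tot r v * h <= Lam * h by rewrite ler_wpM2r.
have qh0 v : 0 <= tot r v * h by rewrite mulr_ge0// ltW.
apply: lerD.
  case: eqP => [->|_]; last by rewrite !mul0r.
  by rewrite !mul1r; exact: expR_ge1Dx.
rewrite /jump -!mulrA ler_wpM2l//.
have e1 : 1 - Lam * h <= expR (- (tot r y' * h)).
  by apply: le_trans (expR_ge1Dx _); rewrite lerD2l lerN2.
have e2 : tot r y * h * (1 - Lam * h) <= 1 - expR (- (tot r y * h)).
  have u0 := qh0 y; have uL := Lh y; set u := tot r y * h in u0 uL *.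
  (* Thus exp(- u) <= 1 / (1 + u), and 1 - exp(- u) >= u / (1 + u) >= u (1 - u). *)
  have E1 : expR (- u) * (1 + u) <= 1.
    have := ler_wpM2l (expR_ge0 (- u)) (expR_ge1Dx u).
    by rewrite -expRD addNr expR0.
  have E0 : 0 <= expR (- u) := expR_ge0 _.
  apply: (@le_trans _ _ (u * (1 - u))); first by rewrite ler_wpM2l// lerD2l lerN2.
  nra.
have p0 : 0 <= 1 - Lam * h by rewrite subr_ge0.
rewrite ler_pdivlMl//; apply: le_trans (ler_pM p0 _ e1 e2); last first.
  by rewrite mulr_ge0.
by rewrite le_eqVlt; apply/orP; left; apply/eqP; ring.
Qed.

Section balance.
Variable pi : S -> R.
Hypothesis pi_ge0 : forall x, 0 <= pi x.
Hypothesis pi_total : (\esum_(x in [set: S]) (pi x)%:E = 1)%E.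
Hypothesis pi_balance : forall y,
  (\esum_(x in [set: S]) (pi x * move_rate r mv x y)%:E = (pi y * tot r y)%:E)%E.

Let evolve t y : \bar R := (\esum_(x in [set: S]) ((pi x)%:E * P x [set w | X t w = y]))%E.

(** Balance cancels the first-order terms. With u = tot h and L = Lam h there remains 1 - u + u (1 -
    L)^2 >= 1 - 2 u L >= 1 - 2 L^2. *)
Let balance_short_kernel h y' : 0 <= h -> Lam * h <= 1 ->
  ((pi y' * (1 - 2 * (Lam * h) ^+ 2))%:E <=
   \esum_(y in [set: S]) ((short_kernel r mv h y y')%:E * (pi y)%:E))%E.
Proof.
move=> h0 Lh1.
have Lh : tot r y' * h <= Lam * h by rewrite ler_wpM2r.
have qh0 : 0 <= tot r y' * h by rewrite mulr_ge0// ltW.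
have qh1 : 0 <= 1 - tot r y' * h by rewrite subr_ge0 (le_trans Lh).
pose c := h * (1 - Lam * h) ^+ 2.
have c0 : 0 <= c by rewrite mulr_ge0// sqr_ge0.
apply: (@le_trans _ _ (\esum_(y in [set: S])
    ((if y == y' then (pi y' * (1 - tot r y' * h))%:E else 0) +
      c%:E * (pi y * move_rate r mv y y')%:E))%E); last first.
  apply: le_esum => y _; rewrite -!EFinM.
  have := ler_wpM2r (pi_ge0 y) (short_kernel_ge y y' h0 Lh1).
  rewrite -lee_fin; apply: le_trans; rewrite mulrDl EFinD; apply: leeD.
    case: eqP => [->|_]; last by rewrite mul0r mul0r.
    by rewrite mul1r mulrC.
  by rewrite lee_fin /c le_eqVlt; apply/orP; left; apply/eqP; ring.
rewrite esumD; last 2 first.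
- by move=> y _; case: ifP => // _; rewrite lee_fin mulr_ge0.
- by move=> y _; rewrite -EFinM lee_fin mulr_ge0// mulr_ge0.
rewrite esum_delta; last by rewrite lee_fin mulr_ge0.
rewrite ge0_esumZl//; last by move=> y _; rewrite lee_fin mulr_ge0.
rewrite pi_balance -EFinM -EFinD lee_fin /c.
have : 0 <= pi y' * ((Lam * h - tot r y' * h) * (2 * (Lam * h))).
  by rewrite mulr_ge0// mulr_ge0 ?subr_ge0// mulr_ge0// (le_trans qh0).
have : 0 <= pi y' * (tot r y' * h * (Lam * h) ^+ 2).
  by rewrite mulr_ge0// mulr_ge0// sqr_ge0.
lra.
Qed.

Let evolve_step t h c : 0 <= t -> 0 <= h -> Lam * h <= 1 -> 0 <= c ->
  (forall y, ((c * pi y)%:E <= evolve t y)%E) ->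
  forall y', ((c * (1 - 2 * (Lam * h) ^+ 2) * pi y')%:E <= evolve (t + h) y')%E.
Proof.
move=> t0 h0 Lh1 c0 H y'.
apply: (@le_trans _ _ (\esum_(y in [set: S])
    ((short_kernel r mv h y y')%:E * evolve t y))%E).
  apply: (@le_trans _ _ (\esum_(y in [set: S])
    (c%:E * ((short_kernel r mv h y y')%:E * (pi y)%:E)))%E).
    rewrite ge0_esumZl//; last first.
      by move=> y _; rewrite -EFinM lee_fin mulr_ge0// short_kernel_ge0.
    rewrite -mulrA EFinM lee_wpmul2l ?lee_fin//.
    by have := balance_short_kernel y' h0 Lh1; rewrite (mulrC (pi y')).
  apply: le_esum => y _; rewrite muleCA lee_wpmul2l ?lee_fin ?short_kernel_ge0//.
  by rewrite -EFinM.
rewrite /evolve.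
rewrite (eq_esum (b := fun y => \esum_(x in [set: S]) ((pi x)%:E *
    (P x [set w | X t w = y] * (short_kernel r mv h y y')%:E)))%E); last first.
  move=> y _; rewrite -ge0_esumZl ?short_kernel_ge0//; last first.
    by move=> x _; rewrite mule_ge0// lee_fin.
  by apply: eq_esum => x _; rewrite muleCA; congr (_ * _)%E; rewrite muleC.
rewrite esum_exchange; last first.
  by move=> x y; rewrite !mule_ge0// lee_fin ?short_kernel_ge0.
apply: le_esum => x _; rewrite ge0_esumZl//; last first.
  by move=> y _; rewrite mule_ge0// lee_fin short_kernel_ge0.
by rewrite lee_wpmul2l ?lee_fin//; apply: (short_kernel_le reg path).
Qed.

Let evolve_total t : 0 <= t -> (\esum_(y in [set: S]) evolve t y = 1)%E.
Proof.
move=> t0; rewrite /evolve esum_exchange; last first.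
  by move=> y x; rewrite mule_ge0// lee_fin.
rewrite -pi_total; apply: eq_esum => x _.
by rewrite ge0_esumZl// (law_X_total path)// mule1.
Qed.

(** K steps of length t / K lose in all a factor (1 - a / K^2)^K >= 1 - a / K, which tends to 1. So
    pi is at most its evolution, and both have mass one. *)
Lemma stationary_of_balance : stationary P X pi.
Proof.
split => //.
move=> t y t0; apply/esym; move: y; apply: esum_le_eq.
- by move=> y; rewrite lee_fin.
- move=> y; apply/lee_addgt0Pr => e e0.
  have Lam0 : 0 < Lam := lt_le_trans (tot_gt0 y) (tot_le y).
  pose a := 2 * (Lam * t) ^+ 2.
  have a0 : 0 <= a by rewrite mulr_ge0// sqr_ge0.
  (* Large enough for a / K <= e, for Lam h <= 1 and for a / K^2 <= 1. *)
  pose K := (Num.trunc (a / e + (Lam * t) + a + 1)).+1.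
  have KR : a / e + Lam * t + a + 1 < K%:R by rewrite truncnS_gt.
  have ae0 : 0 <= a / e by rewrite divr_ge0// ltW.
  have Lt0 : 0 <= Lam * t by rewrite mulr_ge0// ltW.
  have K0 : 0 < K%:R :> R by rewrite ltr0n.
  pose h := t / K%:R.
  have h0 : 0 <= h by rewrite divr_ge0// ltW.
  have Lh1 : Lam * h <= 1 by rewrite /h mulrA ler_pdivrMr// mul1r; lra.
  have aK : 2 * (Lam * h) ^+ 2 = a / K%:R / K%:R.
    by rewrite /a /h; field; rewrite gt_eqF.
  have K1 : 1 <= K%:R :> R by rewrite ler1n.
  have aK1 : a / K%:R / K%:R <= 1.
    by rewrite ler_pdivrMr// mul1r ler_pdivrMr//; nra.
  have aK0 : 0 <= a / K%:R / K%:R by rewrite !divr_ge0// ltW.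
  have ind k : forall y', (((1 - a / K%:R / K%:R) ^+ k * pi y')%:E <= evolve (k%:R * h) y')%E.
    elim: k => [|k IH] y'.
      rewrite expr0 mul1r mul0r /evolve -[leLHS](esum_delta y') ?lee_fin//.
      apply: le_esum => x _; rewrite (law_X0 reg path); case: eqP => [->|_].
        by rewrite mule1.
      by rewrite mule0.
    rewrite exprSr -natr1 mulrDl mul1r -aK; apply: evolve_step => //.
    - by rewrite mulr_ge0.
    - by rewrite exprn_ge0// subr_ge0 aK.
    - by rewrite aK.
  have := ind K y; rewrite (_ : K%:R * h = t); last first.
    by rewrite /h mulrC divfK// gt_eqF.
  move=> h1; apply: (@le_trans _ _ (((1 - a / K%:R / K%:R) ^+ K * pi y)%:E + e%:E)%E); last first.
    exact: leeD2r.
  have piy1 : pi y <= 1.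
    rewrite -lee_fin -pi_total; apply: (esum_ge1 (a := fun x => (pi x)%:E)).
    by move=> x; rewrite lee_fin.
  rewrite -EFinD lee_fin.
  have B : 1 - (a / K%:R / K%:R) *+ K <= (1 - a / K%:R / K%:R) ^+ K.
    by apply: bernoulli_le; rewrite aK0.
  have BK : (a / K%:R / K%:R) *+ K = a / K%:R.
    by rewrite -mulr_natr divfK// gt_eqF.
  have aKe : a / K%:R <= e.
    rewrite ler_pdivrMr// mulrC -ler_pdivrMr//; lra.
  rewrite BK in B; have := ler_wpM2r (pi_ge0 y) B.
  rewrite mulrBl mul1r lerBlDr => /le_trans; apply; rewrite lerD2l.
  apply: le_trans aKe; rewrite -[leRHS]mulr1 ler_wpM2l//.
  by rewrite divr_ge0// ltW.
- by rewrite evolve_total// pi_total.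
- by rewrite pi_total ltry.
Qed.

End balance.

Section uniqueness.
Variable z : S.
Hypothesis reach_z : forall x, reaches r mv z x.

(** Each move of positive rate gets positive weight from [short_kernel] over a unit of time;
    induction runs along the moves towards z. *)
Lemma reaches_X x : exists2 t, 0 <= t & (0 < P x [set w | X t w = z])%E.
Proof.
suff : forall v, reaches r mv z v -> forall t, 0 <= t ->
    (0 < P x [set w | X t w = v])%E ->
    exists2 t, 0 <= t & (0 < P x [set w | X t w = z])%E.
  move=> /(_ x (reach_z x) 0); apply => //.
  by rewrite (law_X0 reg path) eqxx lte_fin.
move=> v; elim => [t t0 Pt|{}v i ri _ IH t t0 Pt]; first by exists t.
apply: (IH (t + 1)); first by rewrite addr_ge0.
apply: lt_le_trans (short_kernel_le reg path x (mv v i) t0 ler01).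
apply: lt_le_trans (esum_ge1 (a := fun y => P x [set w | X t w = y] *
  (short_kernel r mv 1 y (mv v i))%:E)%E v _); last first.
  by move=> y; rewrite mule_ge0// lee_fin short_kernel_ge0.
rewrite mule_gt0// lte_fin; apply: ltr_wpDl.
  by rewrite mulr_ge0 ?expR_ge0.
apply: mulr_gt0; last by rewrite subr_gt0 expR_lt1 oppr_lt0 mulr_gt0.
apply: mulr_gt0; last exact: expR_gt0.
apply: divr_gt0 => //; rewrite /move_rate (bigD1 i)//= eqxx mulr1.
apply: ltr_wpDr => //.
by apply: sumr_ge0 => j _; rewrite mulr_ge0.
Qed.

(** The minimum k of both laws satisfies k P_t <= k with equal masses, hence k P_t = k. If k agrees
    with pi at z, the sums giving k z and pi z agree term by term, and at each x some t gives z
    positive probability; so pi = k <= pi', and masses conclude. *)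
Lemma stationary_unique pi pi' :
  stationary P X pi -> stationary P X pi' -> pi =1 pi'.
Proof.
wlog le_z : pi pi' / pi z <= pi' z.
  move=> h s s'; case/orP: (le_total (pi z) (pi' z)) => le_z; first exact: h.
  by move=> x; apply/esym; apply: h.
move=> [p0 p1 pP] [p'0 p'1 p'P].
pose k x := Num.min (pi x) (pi' x).
have k0 x : 0 <= k x by rewrite le_min p0 p'0.
have k_le x : k x <= pi x by rewrite ge_min lexx.
have koo : (\esum_(x in [set: S]) (k x)%:E < +oo)%E.
  apply: (@le_lt_trans _ _ 1%E); last exact: ltry.
  by rewrite -p1; apply: le_esum => x _; rewrite lee_fin.
have kP t : 0 <= t -> (fun y => \esum_(x in [set: S]) ((k x)%:E * P x [set w | X t w = y]))%E
    =1 (fun y => (k y)%:E).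
  move=> t0; apply: esum_le_eq.
  - by move=> y; apply: esum_ge0 => x _; rewrite mule_ge0// lee_fin.
  - move=> y; rewrite EFin_min le_min -(pP t)// -(p'P t)//; apply/andP; split.
      by apply: le_esum => x _; rewrite lee_wpmul2r// lee_fin.
    by apply: le_esum => x _; rewrite lee_wpmul2r// lee_fin ge_min lexx orbT.
  - rewrite esum_exchange; last by move=> y x; rewrite mule_ge0// lee_fin.
    by apply: le_esum => x _; rewrite ge0_esumZl// (law_X_total path)// mule1.
  - rewrite esum_exchange; last by move=> y x; rewrite mule_ge0// lee_fin.
    apply: le_lt_trans koo; apply: le_esum => x _.
    by rewrite ge0_esumZl// (law_X_total path)// mule1.
have kz : k z = pi z by rewrite /k (min_idPl le_z).
have pi_k x : pi x = k x.
  have [t t0 Px] := reaches_X x.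
  have : (fun x => (k x)%:E * P x [set w | X t w = z])%E =1
      (fun x => (pi x)%:E * P x [set w | X t w = z])%E.
    apply: esum_le_eq.
    - by move=> y; rewrite mule_ge0// lee_fin.
    - by move=> y; rewrite lee_wpmul2r// lee_fin.
    - by rewrite pP//; have := kP _ t0 z; rewrite /= kz => ->.
    - by have := kP _ t0 z; rewrite /= => ->; rewrite ltry.
  move=> /(_ x) /=; set q := P x _.
  have qfin : q \is a fin_num.
    by apply: fin_num_measure; exact: (measurable_X path).
  have q0 : 0 < fine q by rewrite fine_gt0// Px ltey_eq qfin.
  rewrite -(fineK qfin) -!EFinM => -[].
  by move=> /(mulIf (lt0r_neq0 q0)) ->.
have : (fun x => (pi x)%:E) =1 (fun x => (pi' x)%:E).
  apply: esum_le_eq.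
  - by move=> y; rewrite lee_fin.
  - by move=> y; rewrite lee_fin pi_k ge_min lexx orbT.
  - by rewrite p1 p'1.
  - by rewrite p1 ltry.
by move=> h x; have [] := h x.
Qed.

End uniqueness.
End stationarity.

(** * The stationary law built from an excursion *)

Section excursion.
Context {R : realType} {S : countType} {I : finType}.
Variables (r : S -> I -> R) (mv : S -> I -> S).
Hypothesis reg : regular_moves r mv.
Variables (z : S) (V : S -> R) (delta Lam : R).
Hypotheses (dV : drift_away r mv z V delta) (tot_le : forall x, tot r x <= Lam).

Let r_ge0 x i : 0 <= r x i. Proof. by case: reg. Qed.
Let tot_gt0 x : 0 < tot r x. Proof. by case: reg. Qed.
Local Notation alive_z := (alive r mv z).

Local Notation at_ y := (fun v : S => (y == v)%:R : R).

Lemma esum_alive k (g : S -> R) x : (forall y, 0 <= g y) ->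
  (\esum_(y in [set: S]) (alive_z k (at_ y) x * g y)%:E = (alive_z k g x)%:E)%E.
Proof.
move=> g0; elim: k x => [|k IH] x.
  rewrite -[RHS](esum_delta x) ?lee_fin//; apply: eq_esum => y _ /=.
  by case: eqP => [->|_]; rewrite ?mul1r ?mul0r.
have c0 i : 0 <= r x i * (mv x i != z)%:R / tot r x.
  by rewrite divr_ge0 ?mulr_ge0// ltW.
have aliveS f : alive_z k.+1 f x =
    \sum_i (r x i * (mv x i != z)%:R / tot r x) * alive_z k f (mv x i).
  rewrite [LHS]/= /kill /step mulr_suml; apply: eq_bigr => i _.
  by rewrite -!mulrA; congr (_ * (_ * _)); exact: mulrC.
rewrite aliveS -sumEFin.
rewrite (eq_esum (b := fun y => \sum_(i <- index_enum I)
   ((r x i * (mv x i != z)%:R / tot r x)%:E *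
    (alive_z k (at_ y) (mv x i) * g y)%:E))%E); last first.
  move=> y _; rewrite aliveS mulr_suml -sumEFin; apply: eq_bigr => i _.
  by rewrite -EFinM mulrA.
have a0 i y : 0 <= alive_z k (at_ y) (mv x i) * g y.
  by rewrite mulr_ge0// (alive_ge0 reg).
rewrite esum_sum; last by move=> y i _ _; rewrite -EFinM lee_fin mulr_ge0.
by apply: eq_bigr => i _; rewrite ge0_esumZl ?IH// => y _; rewrite lee_fin.
Qed.

(** The mean number of visits of the embedded chain to y during an excursion from z, counting the
    start and not the return. *)
Let occ y : \bar R := (\sum_(k <oo) (alive_z k (at_ y) z)%:E)%E.

Let occ_esum (g : S -> R) : (forall y, 0 <= g y) ->
  (\esum_(y in [set: S]) (occ y * (g y)%:E) = \sum_(k <oo) (alive_z k g z)%:E)%E.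
Proof.
move=> g0.
have a0 k y : (0 <= (alive_z k (at_ y) z)%:E)%E by rewrite lee_fin (alive_ge0 reg).
rewrite [RHS]nneseries_esumT; last first.
  by move=> k; rewrite lee_fin (alive_ge0 reg).
rewrite (eq_esum (b := fun y => \esum_(k in [set: nat])
    (alive_z k (at_ y) z * g y)%:E)%E); last first.
  move=> y _; rewrite /occ nneseries_esumT// muleC -ge0_esumZl//.
  by apply: eq_esum => k _; rewrite muleC.
rewrite esum_exchange; last by move=> y k; rewrite lee_fin mulr_ge0// (alive_ge0 reg).
by apply: eq_esum => k _; exact: esum_alive.
Qed.

Let occ_V : (\esum_(y in [set: S]) (occ y * (V y)%:E) < +oo)%E.
Proof.
have [_ V1 _] := dV.
have V0 x : 0 <= V x := le_trans ler01 (V1 x).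
have [C [rho [C0 rho0 rho1 Cz _]]] := alive_drift reg dV tot_le.
rewrite occ_esum//; apply: (@le_lt_trans _ _ (C / (1 - rho))%:E); last exact: ltry.
apply: le_trans (nneseries_geometric_le C0 rho0 rho1).
apply: lee_nneseries => [k _ _|k _]; rewrite lee_fin//.
exact: (alive_ge0 reg).
Qed.

Let occ_ge0 y : (0 <= occ y)%E.
Proof. by apply: nneseries_ge0 => k _ _; rewrite lee_fin (alive_ge0 reg). Qed.

Let occ_fin y : occ y \is a fin_num.
Proof.
have [_ V1 _] := dV.
rewrite ge0_fin_numE//; apply: le_lt_trans occ_V.
apply: le_trans (esum_ge1 (a := fun y => (occ y * (V y)%:E)%E) y _); last first.
  by move=> v; rewrite mule_ge0// lee_fin (le_trans ler01).
by rewrite -[leLHS]mule1 lee_wpmul2l// lee_fin.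
Qed.

Let occz : occ z = 1%E.
Proof.
have aliveZ0 k : alive_z k (fun=> 0) z = 0.
  transitivity (0 * alive_z k (fun=> 0) z); last by rewrite mul0r.
  rewrite -aliveZ; by congr (iter _ _ _ z); apply/funext => x; rewrite mul0r.
rewrite /occ nneseries_recl//; last first.
  by move=> k; rewrite lee_fin (alive_ge0 reg).
rewrite /= eqxx -[X in (_ + X)%E](nneseries_addn 1)//; last first.
  by move=> k; rewrite lee_fin (alive_ge0 reg).
rewrite eseries0 ?adde0// => k _ _.
rewrite addn1 /alive iterSr (_ : kill _ _ _ _ = fun=> 0).
  by have := aliveZ0 k; rewrite /alive => ->.
apply/funext => x; rewrite /kill -[RHS](step_cst reg 0 x); apply: eq_step => v.
by case: (eqVneq v z) => _; rewrite ?mul0r ?mulr0.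
Qed.

(** For y != z this shifts the index of the series. For z the terms are the probabilities of
    returning at jump k + 1; they telescope to 1 - a K, and the drift makes a K vanish in the
    limit. *)
Let occ_jump y : (\esum_(x in [set: S]) (occ x * (jump r mv x y)%:E) = occ y)%E.
Proof.
rewrite occ_esum; last by move=> x; exact: jump_ge0.
have [->|yz] := eqVneq y z; last first.
  rewrite [RHS]nneseries_recl//; last first.
    by move=> k; rewrite lee_fin (alive_ge0 reg).
  rewrite /= (negbTE yz) add0e -[in RHS](nneseries_addn 1)//; last first.
    by move=> k; rewrite lee_fin (alive_ge0 reg).
  apply: eq_eseriesr => k _; congr _%:E.
  rewrite addn1 /alive iterSr; congr (iter _ _ _ z); apply/funext => x.
  rewrite /kill -step_delta; apply: eq_step => v.
  by case: (eqVneq y v) => [<-|_]; rewrite ?yz ?mul1r ?mulr0.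
rewrite occz; pose a k := alive_z k (fun=> 1) z.
have jumpz k : alive_z k (fun x => jump r mv x z) z = a k - a k.+1.
  rewrite (_ : (fun x => jump r mv x z) =
      fun x => 1 + (-1) * kill r mv z (fun=> 1) x); last first.
    apply/funext => x.
    have : jump r mv x z + kill r mv z (fun=> 1) x = 1.
      rewrite -[RHS](step_cst reg 1 x) -step_delta /kill -stepD; apply: eq_step => v.
      by rewrite (eq_sym z); case: eqP; rewrite /= ?mul1r ?mul0r ?addr0 ?add0r.
    by set u := jump _ _ _ _; set v := kill _ _ _ _ _ => h; lra.
  rewrite aliveD aliveZ mulN1r /a; congr (_ - _).
  by rewrite /alive iterSr.
have part K : (\sum_(0 <= k < K) (alive_z k (fun x => jump r mv x z) z)%:E = (1 - a K)%:E)%E.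
  elim: K => [|K IH]; first by rewrite big_nil /a /= subrr.
  by rewrite big_nat_recr//= IH jumpz -EFinD; congr _%:E; ring.
have j0 k : (0 <= (alive_z k (fun x => jump r mv x z) z)%:E)%E.
  by rewrite lee_fin (alive_ge0 reg)// => x; exact: jump_ge0.
apply/eqP; rewrite eq_le; apply/andP; split.
  apply: nneseries_le_bound => // K; rewrite part lee_fin gerBl.
  exact: (alive_ge0 reg).
have [_ V1 _] := dV.
have [C [rho [C0 rho0 rho1 Cz _]]] := alive_drift reg dV tot_le.
apply/lee_addgt0Pr => e e0.
have /cvgrPdist_le /(_ _ e0) [K _ /(_ K (leqnn K))] :
    geometric C rho @ \oo --> 0 by apply: cvg_geometric; rewrite gtr0_norm.
rewrite sub0r normrN /= ger0_norm ?mulr_ge0 ?exprn_ge0 ?(ltW rho0)// => CK.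
have aK : a K <= e.
  by apply: le_trans CK; apply: le_trans (Cz K); exact: le_alive.
apply: (@le_trans _ _ ((1 - a K)%:E + e%:E)%E).
  by rewrite -EFinD lee_fin; lra.
by rewrite leeD2r// -part; apply: nneseries_lim_ge.
Qed.

(** Dividing [occ] by the exit rate weights each visit by its mean duration, which turns invariance
    for the embedded chain into balance of rates. Exit rates being at least e, total mass and
    V-moment stay finite. *)
Lemma drift_balance : exists pi : S -> R,
  [/\ forall x, 0 <= pi x, (\esum_(x in [set: S]) (pi x)%:E = 1)%E,
      forall y, (\esum_(x in [set: S]) (pi x * move_rate r mv x y)%:E
                 = (pi y * tot r y)%:E)%E
    & (\esum_(x in [set: S]) (pi x * V x)%:E < +oo)%E].
Proof.
have [d0 V1 _] := dV.
have V0 x : 0 <= V x := le_trans ler01 (V1 x).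
pose m y := fine (occ y).
have mE y : occ y = (m y)%:E by rewrite /m fineK.
have m0 y : 0 <= m y by rewrite fine_ge0.
pose e := Num.min delta (tot r z).
have e0 : 0 < e by rewrite lt_min d0 tot_gt0.
have e_le y : e <= tot r y.
  have [->|yz] := eqVneq y z; first by rewrite /e ge_min lexx orbT.
  by apply: le_trans (tot_ge_drift reg dV yz); rewrite ge_min lexx.
pose Z := (\esum_(y in [set: S]) (m y / tot r y)%:E)%E.
have mt0 y : 0 <= m y / tot r y by rewrite divr_ge0// ltW.
have mt_le y : m y / tot r y <= e^-1 * (m y * V y).
  rewrite mulrC ler_pM ?invr_ge0 ?(ltW (tot_gt0 y))//.
    by rewrite lef_pV2 ?posrE.
  by rewrite ler_peMr.
have mV : (\esum_(y in [set: S]) (e^-1 * (m y * V y))%:E < +oo)%E.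
  rewrite (eq_esum (b := fun y => (e^-1)%:E * (occ y * (V y)%:E))%E); last first.
    by move=> y _; rewrite mE -!EFinM.
  rewrite ge0_esumZl ?invr_ge0 ?(ltW e0)//; last first.
    by move=> y _; rewrite mule_ge0// lee_fin.
  apply: lte_mul_pinfty => //.
    by rewrite lee_fin invr_ge0 ltW.
have Zfin : Z \is a fin_num.
  rewrite ge0_fin_numE; last by apply: esum_ge0 => y _; rewrite lee_fin.
  by apply: le_lt_trans mV; apply: le_esum => y _; rewrite lee_fin.
pose c := fine Z.
have c0 : 0 < c.
  suff : (0 < Z)%E by move=> Z0; rewrite fine_gt0// Z0 ltey_eq Zfin.
  apply: lt_le_trans (esum_ge1 (a := fun y => (m y / tot r y)%:E) z _); last first.
    by move=> y; rewrite lee_fin.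
  by rewrite lte_fin divr_gt0// /m occz.
have esum_c (f : S -> R) : (forall y, 0 <= f y) ->
    (\esum_(y in [set: S]) (f y / c)%:E = (c^-1)%:E * \esum_(y in [set: S]) (f y)%:E)%E.
  move=> f0; rewrite -ge0_esumZl ?invr_ge0 ?(ltW c0)//; last first.
    by move=> y _; rewrite lee_fin.
  by apply: eq_esum => y _; rewrite -EFinM mulrC.
have tot0 y : tot r y != 0 by rewrite gt_eqF.
exists (fun y => m y / tot r y / c); split.
- by move=> y; rewrite divr_ge0// ltW.
- rewrite esum_c// -/Z -(fineK Zfin) -/c -EFinM mulVf// gt_eqF//.
- move=> y; rewrite (eq_esum (b := fun x => (m x * jump r mv x y / c)%:E)); last first.
    by move=> x _; congr _%:E; rewrite /jump; field; rewrite tot0 gt_eqF.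
  rewrite esum_c; last by move=> x; rewrite mulr_ge0// jump_ge0.
  rewrite (eq_esum (b := fun x => occ x * (jump r mv x y)%:E)%E); last first.
    by move=> x _; rewrite mE -EFinM.
  rewrite occ_jump mE -EFinM; congr _%:E; field.
  by rewrite tot0 gt_eqF.
- rewrite (eq_esum (b := fun x => (m x / tot r x * V x / c)%:E)); last first.
    by move=> x _; congr _%:E; rewrite mulrAC.
  rewrite esum_c; last by move=> x; rewrite mulr_ge0.
  apply: lte_mul_pinfty => //.
    by rewrite lee_fin invr_ge0 ltW.
  apply: le_lt_trans mV; apply: le_esum => x _; rewrite lee_fin mulrA.
  rewrite ler_wpM2r// mulrC ler_wpM2r//.
  by rewrite lef_pV2 ?posrE.
Qed.

End excursion.

(** * The chain of gaps *)

Section lumping.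
Context {R : realType} {S S' : countType} {I : finType}.
Variables (r : S -> I -> R) (mv : S -> I -> S) (r' : S' -> I -> R)
  (mv' : S' -> I -> S') (phi : S -> S') (sec : S' -> S).
Hypotheses (reg : regular_moves r mv) (reg' : regular_moves r' mv').
Hypothesis secK : cancel sec phi.
Hypothesis r_phi : forall x i, r x i = r' (phi x) i.
Hypothesis mv_phi : forall x i, r x i != 0 -> phi (mv x i) = mv' (phi x) i.

Let tot_phi x : tot r x = tot r' (phi x).
Proof. by apply: eq_bigr => i _; exact: r_phi. Qed.

Let cyl_phi n (y : nat -> S') (s : nat -> R) x :
  cyl r mv n (fun k v => phi v == y k) s x = (phi x == y 0)%:R
   * \prod_(k < n) jump_prob (move_rate r' mv') (y k) (y k.+1)
   * \prod_(k < n.+1) expR (- (exit_rate (move_rate r' mv') (y k) * s k)).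
Proof.
elim: n y s x => [|n IH] y s x.
  rewrite big_ord0 big_ord_recl big_ord0 /= !mulr1 tot_phi.
  by rewrite (exit_rate_tot reg'); case: eqP => [->//|_]; rewrite !mul0r.
rewrite cylS /step.
have [phix|_] := eqVneq (phi x) (y 0); last by rewrite !mul0r.
pose Q := \prod_(k < n) jump_prob (move_rate r' mv') (y k.+1) (y k.+2)
   * \prod_(k < n.+1) expR (- (exit_rate (move_rate r' mv') (y k.+1) * s k.+1)).
rewrite (eq_bigr (fun i => r' (phi x) i * (y 1 == mv' (phi x) i)%:R * Q)); last first.
  move=> i _; rewrite IH -mulrA -mulrA -/Q.
  have [r0|ri] := eqVneq (r x i) 0; first by rewrite -r_phi r0 !mul0r.
  by rewrite r_phi mv_phi// eq_sym.
rewrite -mulr_suml -/(move_rate r' mv' (phi x) (y 1)).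
rewrite big_ord_recl [\prod_(k < n.+2) _]big_ord_recl/=.
rewrite (jump_probE reg') (exit_rate_tot reg') /jump tot_phi phix /Q /bump /=.
by rewrite !mul1r; ring.
Qed.

(** Rates depend only on the image, and by [reg'] no effective move is invisible there, so the image
    keeps the holding times of X. *)
Lemma lumped_jump_process {d : measure_display} {Omega : measurableType d}
    (P : S -> probability Omega R) (X : R -> Omega -> S) :
  is_jump_process (move_rate r mv) P X ->
  is_jump_process (move_rate r' mv') (P \o sec) (fun t w => phi (X t w)).
Proof.
move=> [Y [W [[mY mW] W0 nonexp XY law]]].
exists (fun k w => phi (Y k w)), W; split => //.
- split => // k y; exact: (measurable_state mY k [set v | phi v = y]).
- by move=> w k t h1 h2; rewrite (XY w k t).
move=> x k y s s0; rewrite -[in RHS](secK x) -cyl_phi.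
rewrite -(law_cyl reg mY mW law)//=; congr (P _ _).
by apply/seteqP; split => w /= h j /h[] => [->|/eqP].
Qed.

End lumping.

(** Abel summation: with T_k the sum of the first k weights, the left-hand side is - sum_k T_k (y_k
    - y_(k-1)), as the full sum vanishes. The induction carries the boundary term T_(k+1) y_k. *)
Lemma abel_le {R : realType} n (w y : 'I_n.+1 -> R) (c : R) :
  (forall k : nat, (0 < k <= n)%N -> c <= \sum_(i < n.+1 | (i < k)%N) w i) ->
  \sum_i w i = 0 -> (forall i j : 'I_n.+1, (i <= j)%N -> y i <= y j) ->
  \sum_i w i * y i <= - (c * (y ord_max - y ord0)).
Proof.
move=> Tc T0 ymono.
pose T (k : nat) := \sum_(i < n.+1 | (i < k)%N) w i.
pose z (k : nat) := y (inord k).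
have alg (s t u zk zl z0 : R) : s <= t * zk - c * (zk - z0) ->
    0 <= (t - c) * (zl - zk) -> u * zl + s <= (u + t) * zl - c * (zl - z0).
  by lra.
have part k : (k <= n)%N ->
    \sum_(i < n.+1 | (i < k.+1)%N) w i * y i <= T k.+1 * z k - c * (z k - z 0).
  elim: k => [|k IH] kn.
    rewrite subrr mulr0 subr0 /T !(big_pred1 ord0); last 2 first.
    - by move=> i; rewrite ltnS leqn0.
    - by move=> i; rewrite ltnS leqn0.
    by rewrite /z (_ : inord 0 = ord0)//; apply: val_inj; rewrite /= inordK.
  have kn' : (k.+1 < n.+1)%N by rewrite ltnS.
  have split_k (F : 'I_n.+1 -> R) : \sum_(i < n.+1 | (i < k.+2)%N) F i =
      F (inord k.+1) + \sum_(i < n.+1 | (i < k.+1)%N) F i.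
    rewrite (bigD1 (inord k.+1))/= ?inordK//; congr (_ + _).
    apply: eq_bigl => i; rewrite -val_eqE /= inordK// [in RHS]ltn_neqAle.
    by rewrite -ltnS andbC.
  rewrite split_k {1}/T split_k -/(T k.+1).
  have cT : c <= T k.+1 by apply: Tc.
  have zz : z k <= z k.+1 by apply: ymono; rewrite (inordK kn') (inordK (ltnW kn')).
  apply: alg (IH (ltnW kn)) _.
  by rewrite mulr_ge0 ?subr_ge0.
have := part n (leqnn n).
rewrite (eq_bigl xpredT); last by move=> i; rewrite ltn_ord.
rewrite (_ : T n.+1 = 0); last first.
  by rewrite /T -[RHS]T0; apply: eq_bigl => i; rewrite ltn_ord.
rewrite mul0r sub0r /z (_ : inord n = ord_max); last first.
  by apply: val_inj; rewrite /= inordK.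
by rewrite (_ : inord 0 = ord0)//; apply: val_inj; rewrite /= inordK.
Qed.

(** * Clusters, pushes and translations of configurations *)

Section configurations.
Context {n : nat}.
Implicit Types (x y : config n) (i j : 'I_n.+1).

Definition is_first x i : bool :=
  [forall j : 'I_n.+1, (j.+1 == i :> nat) ==> (val x j < val x i)].

Definition is_last x i : bool :=
  [forall j : 'I_n.+1, (j == i.+1 :> nat) ==> (val x i < val x j)].

Lemma config_le x i j : (i <= j)%N -> val x i <= val x j.
Proof. by move=> ij; have /forallP/(_ i)/forallP/(_ j)/implyP := valP x; apply. Qed.

Lemma is_firstP x i j : is_first x i -> (j < i)%N -> val x j < val x i.
Proof.
move=> /forallP fi ji.
have pn : (i.-1 < n.+1)%N by rewrite (leq_ltn_trans (leq_pred i)).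
have := fi (Ordinal pn); rewrite /= prednK ?(leq_ltn_trans _ ji)// eqxx /=.
by apply: le_lt_trans; apply: config_le => /=; rewrite -ltnS prednK ?(leq_ltn_trans _ ji).
Qed.

Lemma is_lastP x i j : is_last x i -> (i < j)%N -> val x i < val x j.
Proof.
move=> /forallP li ij.
have pn : (i.+1 < n.+1)%N by rewrite (leq_ltn_trans ij).
have := li (Ordinal pn); rewrite /= eqxx /= => /lt_le_trans; apply.
exact: config_le.
Qed.

Lemma block_last x j :
  exists i, [/\ (j <= i)%N, val x i = val x j & is_last x i].
Proof.
have [i /eqP xi imax] := @arg_maxnP _ j (fun i => val x i == val x j)
  (@nat_of_ord _) (eqxx _).
exists i; split => //; first exact: imax.
apply/forallP => k; apply/implyP => /eqP ki.
rewrite lt_neqAle config_le ?ki// andbT; apply/eqP => xk.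
by have := imax k; rewrite -xk xi eqxx => /(_ isT); rewrite ki /= ltnn.
Qed.

Lemma block_first x j :
  exists i, [/\ (i <= j)%N, val x i = val x j & is_first x i].
Proof.
have [i /eqP xi imin] := @arg_minnP _ j (fun i => val x i == val x j)
  (@nat_of_ord _) (eqxx _).
exists i; split => //; first exact: imin.
apply/forallP => k; apply/implyP => /eqP ki.
rewrite lt_neqAle config_le -?ki// andbT; apply/eqP => xk.
by have := imin k; rewrite xk xi eqxx => /(_ isT); rewrite -ki /= ltnn.
Qed.

(* Particle p.1 jumps to the right if p.2 is true, to the left otherwise. *)
Definition pushed x (p : 'I_n.+1 * bool) : {ffun 'I_n.+1 -> int} :=
  [ffun j => val x j + (if p.2 then (j == p.1)%:R else - (j == p.1)%:R)].

Lemma ordered_pushed x p : (if p.2 then is_last x p.1 else is_first x p.1) ->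
  ordered (pushed x p).
Proof.
case: p => i d /= di; apply/forallP => k; apply/forallP => j; apply/implyP.
rewrite leq_eqVlt => /predU1P[/val_inj ->|kj]; first exact: lexx.
have xkj := config_le x (ltnW kj); rewrite !ffunE /=.
case: d di => [li|fi].
  have [ki|_] := eqVneq k i.
    have lt_ij : (i < j)%N by rewrite -ki.
    have := is_lastP li lt_ij; rewrite -ki gt_eqF//= mulr1n mulr0n addr0.
    by rewrite lezD1.
  by rewrite addr0; apply: le_trans xkj _; rewrite lerDl.
have [ji|_] := eqVneq j i.
  have lt_ki : (k < i)%N by rewrite -ji.
  have := is_firstP fi lt_ki; rewrite -ji lt_eqF//= mulr1n mulr0n subr0.
  by rewrite -lezD1 lerBrDr.
by rewrite oppr0 addr0; apply: le_trans xkj; rewrite gerBl.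
Qed.

(** The default x occurs only when the move would break the order, and then its rate is zero by
    [elastic_neq0]. *)
Definition push x p : config n := insubd x (pushed x p).

Lemma val_push x p : (if p.2 then is_last x p.1 else is_first x p.1) ->
  val (push x p) = pushed x p.
Proof. by move=> dp; rewrite val_insubd ordered_pushed. Qed.

Definition translates x y : Prop := exists t, forall j, val x j = val y j + t.

Lemma translates_anchored x : translates x (anchored (gap x)).
Proof.
exists (val x ord0) => j; rewrite /= ffunE.
suff H (k : nat) : (k <= n)%N ->
    ((\sum_(i < n | (i < k)%N) gap x i)%N : int) = val x (inord k) - val x ord0.
  rewrite H; last by rewrite -ltnS.
  by rewrite inord_val subrK.
elim: k => [|k IH] kn.
  rewrite big_pred0// (_ : inord 0 = ord0) ?subrr//.
  by apply: val_inj; rewrite /= inordK.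
rewrite (bigD1 (Ordinal kn))/=; last exact: ltnSn.
rewrite PoszD (eq_bigl (fun i : 'I_n => (i < k)%N)); last first.
  move=> i; rewrite -val_eqE /= ltnS [RHS]ltn_neqAle andbC//.
rewrite IH ?(ltnW kn)// ffunE.
have -> : lift ord0 (Ordinal kn) = inord k.+1.
  by apply: val_inj; rewrite /= inordK.
have -> : lift ord_max (Ordinal kn) = inord k.
  by apply: val_inj; rewrite [LHS]lift_max /= inordK// ltnW.
rewrite gez0_abs; first by rewrite addrA subrK.
rewrite subr_ge0; apply: config_le; rewrite !inordK//; exact: ltnW.
Qed.

Lemma gap_translates x y : translates x y -> gap x = gap y.
Proof.
move=> [t xy]; apply/ffunP => i; rewrite !ffunE !xy.
by rewrite opprD addrACA subrr addr0.
Qed.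

Lemma is_last_translates x y i : translates x y -> is_last x i = is_last y i.
Proof.
by move=> [t xy]; apply: eq_forallb => j; rewrite !xy ltrD2r.
Qed.

Lemma is_first_translates x y i : translates x y -> is_first x i = is_first y i.
Proof.
by move=> [t xy]; apply: eq_forallb => j; rewrite !xy ltrD2r.
Qed.

Lemma push_translates x y p :
  (if p.2 then is_last x p.1 else is_first x p.1) ->
  translates x y -> translates (push x p) (push y p).
Proof.
move=> dp xy.
have dp' : if p.2 then is_last y p.1 else is_first y p.1.
  by rewrite -(is_last_translates _ xy) -(is_first_translates _ xy).
have [t xyt] := xy; exists t => j.
by rewrite !val_push// !ffunE xyt addrAC.
Qed.

End configurations.

(** * Elastic rates and transfers inside a cluster *)

Section elastic_rates.
Context {R : realType} {n : nat}.
Variables (m a b : 'I_n.+1 -> R).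
Hypotheses (m_gt0 : forall i, 0 < m i) (a_ge0 : forall i, 0 <= a i)
  (b_ge0 : forall i, 0 <= b i).
Implicit Types (x y : config n) (i j : 'I_n.+1) (p : 'I_n.+1 * bool).

Definition elastic x p : R := if p.2 then rateB m b x p.1 else rateA m a x p.1.

Lemma elastic_ge0 x p : 0 <= elastic x p.
Proof.
rewrite /elastic /rateA /rateB; case: p.2; rewrite mulr_ge0// sumr_ge0// => j _.
  by rewrite mulr_ge0// divr_ge0// ?mulr_ge0// ltW.
by rewrite mulr_ge0// divr_ge0// ?mulr_ge0// ltW.
Qed.

Lemma elastic_neq0 x p : elastic x p != 0 ->
  if p.2 then is_last x p.1 else is_first x p.1.
Proof.
rewrite /elastic /rateA /rateB -/(is_last x p.1) -/(is_first x p.1).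
case: p.2; first by case: (is_last _ _); rewrite // mul0r eqxx.
by case: (is_first _ _); rewrite // mul0r eqxx.
Qed.

Lemma elastic_rate_move : elastic_rate m a b = move_rate elastic push.
Proof.
apply/funext => x; apply/funext => y; rewrite /elastic_rate /move_rate.
rewrite (eq_bigr (fun i => \sum_(d : bool) elastic x (i, d) * (y == push x (i, d))%:R)).
  by rewrite pair_big/=; apply: eq_bigr => -[].
move=> i _; rewrite big_bool addrC.
have val_eq p : elastic x p * (val y == pushed x p)%:R =
    elastic x p * (y == push x p)%:R.
  have [->|/elastic_neq0 dp] := eqVneq (elastic x p) 0; first by rewrite !mul0r.
  by rewrite -val_push// val_eqE.
by rewrite -!val_eq.
Qed.

(** [l j] is the last particle of the cluster of j, which performs the right jumps owned by j. The
    factor m i cancels the division by m i in the rate. Both j <= l j and the equality of positions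
    are used later. *)
Lemma transferB x : exists l : 'I_n.+1 -> 'I_n.+1,
  (forall j, (j <= l j)%N /\ val x (l j) = val x j) /\
  forall g : 'I_n.+1 -> R,
    \sum_i m i * elastic x (i, true) * g i = \sum_j m j * b j * g (l j).
Proof.
have [l lP] := choice (block_last x).
exists l; split=> [j|g]; first by have [] := lP j.
have E i : m i * elastic x (i, true) * g i = \sum_j m j * b j *
    (((j <= i)%N && (val x j == val x i) && is_last x i)%:R * g i).
  rewrite /elastic /rateB /= -/(is_last x i) mulrCA -mulrA mulr_sumr big_mkcond/=.
  rewrite !mulr_suml mulr_sumr; apply: eq_bigr => j _.
  have mi := gt_eqF (m_gt0 i).
  by case: (j <= i)%N; case: (_ == _); case: (is_last _ _);
     rewrite /= ?(mul0r, mulr0)// !mul1r ?mulr1; field; rewrite mi.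
rewrite (eq_bigr _ (fun i _ => E i)) exchange_big/=; apply: eq_bigr => j _.
rewrite -mulr_sumr; congr (_ * _).
have [jl xl ll] := lP j.
rewrite (bigD1 (l j))//= jl xl eqxx ll mul1r big1 ?addr0// => i il.
case: (boolP (_ && _)) => [/andP[/andP[ji /eqP xji] li]|_]; last by rewrite mul0r.
have [lti|] := ltnP i (l j).
  by have := is_lastP li lti; rewrite xl xji ltxx.
rewrite leq_eqVlt => /predU1P[/val_inj il'|lti]; first by rewrite il' eqxx in il.
by have := is_lastP ll lti; rewrite xl xji ltxx.
Qed.

Lemma transferA x : exists l : 'I_n.+1 -> 'I_n.+1,
  (forall j, (l j <= j)%N /\ val x (l j) = val x j) /\
  forall g : 'I_n.+1 -> R,
    \sum_i m i * elastic x (i, false) * g i = \sum_j m j * a j * g (l j).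
Proof.
have [l lP] := choice (block_first x).
exists l; split=> [j|g]; first by have [] := lP j.
have E i : m i * elastic x (i, false) * g i = \sum_j m j * a j *
    (((i <= j)%N && (val x j == val x i) && is_first x i)%:R * g i).
  rewrite /elastic /rateA /= -/(is_first x i) mulrCA -mulrA mulr_sumr big_mkcond/=.
  rewrite !mulr_suml mulr_sumr; apply: eq_bigr => j _.
  have mi := gt_eqF (m_gt0 i).
  by case: (i <= j)%N; case: (_ == _); case: (is_first _ _);
     rewrite /= ?(mul0r, mulr0)// !mul1r ?mulr1; field; rewrite mi.
rewrite (eq_bigr _ (fun i _ => E i)) exchange_big/=; apply: eq_bigr => j _.
rewrite -mulr_sumr; congr (_ * _).
have [jl xl ll] := lP j.
rewrite (bigD1 (l j))//= jl xl eqxx ll mul1r big1 ?addr0// => i il.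
case: (boolP (_ && _)) => [/andP[/andP[ji /eqP xji] li]|_]; last by rewrite mul0r.
have [lti|] := ltnP i (l j).
  by have := is_firstP ll lti; rewrite xl xji ltxx.
rewrite leq_eqVlt => /predU1P[/val_inj il'|lti]; first by rewrite il' eqxx in il.
by have := is_firstP li lti; rewrite xl xji ltxx.
Qed.

Lemma elastic_translates x y p : translates x y -> elastic x p = elastic y p.
Proof.
move=> xy; rewrite /elastic /rateA /rateB -!/(is_first _ _) -!/(is_last _ _).
rewrite (is_first_translates _ xy) (is_last_translates _ xy).
have [t xyt] := xy.
have eq_xy i j : (val x i == val x j) = (val y i == val y j).
  by rewrite !xyt (inj_eq (addIr t)).
case: p.2; congr (_ * _); apply: eq_bigr => j _; by rewrite eq_xy.
Qed.

End elastic_rates.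

(** * Drift of linear and exponential functionals *)

Section elastic_drift.
Context {R : realType} {n : nat}.
Variables (m a b : 'I_n.+1 -> R).
Hypotheses (m_gt0 : forall i, 0 < m i) (a_ge0 : forall i, 0 <= a i)
  (b_ge0 : forall i, 0 <= b i).
Implicit Types (x y : config n) (i j : 'I_n.+1) (p : 'I_n.+1 * bool).
Local Notation elastic := (elastic m a b).

Let elastic_pos x p : 0 <= elastic x p.
Proof. exact: elastic_ge0. Qed.

Lemma sum_moves (F : 'I_n.+1 * bool -> R) :
  \sum_p F p = \sum_i F (i, true) + \sum_i F (i, false).
Proof.
rewrite (eq_bigr (fun p => F (p.1, p.2))); last by case.
rewrite -(pair_big xpredT xpredT (fun i d => F (i, d)))/= -big_split/=.
by apply: eq_bigr => i _; rewrite big_bool.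
Qed.

(** Transfers with g = 1 preserve the total m-weighted rate, which is positive. *)
Lemma elastic_tot_gt0 x : 0 < \sum_j m j * (a j + b j) -> 0 < \sum_p elastic x p.
Proof.
move=> act; rewrite lt_neqAle sumr_ge0// andbT; apply/negP => /eqP/esym tot0.
have el0 p : elastic x p = 0.
  apply/eqP; rewrite eq_le elastic_pos andbT -tot0 (bigD1 p)//= lerDl.
  by rewrite sumr_ge0.
have z d : \sum_i m i * elastic x (i, d) * 1 = 0.
  by rewrite big1// => i _; rewrite el0 mulr0 mul0r.
have [l [_ /(_ (fun=> 1))]] := transferB a b m_gt0 x.
have [l' [_ /(_ (fun=> 1))]] := transferA a b m_gt0 x.
rewrite !z => ha hb; move: act; rewrite (eq_bigr (fun j => m j * a j * 1 + m j * b j * 1)).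
  by rewrite big_split/= -ha -hb addr0 ltxx.
by move=> j _; rewrite !mulr1 mulrDr.
Qed.

Lemma elastic_tot_le : exists Lam, forall x, \sum_p elastic x p <= Lam.
Proof.
exists ((\sum_j m j * (a j + b j)) * \sum_i (m i)^-1) => x.
have inv_le i : (m i)^-1 <= \sum_i (m i)^-1.
  rewrite (bigD1 i)//= lerDl sumr_ge0// => k _.
  by rewrite invr_ge0 ltW.
have el d i : elastic x (i, d) = m i * elastic x (i, d) * (m i)^-1.
  by rewrite mulrAC divff ?mul1r// gt_eqF.
rewrite sum_moves (eq_bigr _ (fun i _ => el true i)).
rewrite [X in _ + X](eq_bigr _ (fun i _ => el false i)).
have [l [_ ->]] := transferB a b m_gt0 x.
have [l' [_ ->]] := transferA a b m_gt0 x.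
rewrite mulr_suml -big_split/=; apply: ler_sum => j _.
rewrite mulrDr mulrDl addrC; apply: lerD; apply: ler_wpM2l => //.
  by rewrite mulr_ge0// ltW.
by rewrite mulr_ge0// ltW.
Qed.

Section linear.
Variable e : 'I_n.+1 -> R.
Hypothesis e_mono : forall i j, (i <= j)%N -> e i <= e j.
Hypothesis e_mean : \sum_i m i * e i = 0.

Definition moment x : R := \sum_j m j * e j * (val x j)%:~R.

Lemma moment_translates x y : translates x y -> moment x = moment y.
Proof.
move=> [t xy]; rewrite /moment.
rewrite (eq_bigr (fun j => m j * e j * (val y j)%:~R + m j * e j * t%:~R)).
  by rewrite big_split/= -mulr_suml e_mean mul0r addr0.
by move=> j _; rewrite xy intrD mulrDr.
Qed.

Lemma moment_push x p : elastic x p != 0 ->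
  moment (push x p) - moment x = if p.2 then m p.1 * e p.1 else - (m p.1 * e p.1).
Proof.
move=> /elastic_neq0 dp; rewrite /moment val_push//.
rewrite [X in X - _](bigD1 p.1)//= [X in _ - X](bigD1 p.1)//= !ffunE eqxx.
rewrite (eq_bigr (fun j => m j * e j * (val x j)%:~R)); last first.
  by move=> j /negbTE jp; rewrite !ffunE jp; case: p.2; rewrite ?oppr0 addr0.
rewrite opprD addrACA subrr addr0 -mulrBr -intrB addrAC subrr add0r.
by case: p.2; rewrite ?mulr1 // mulrN1z mulrN mulr1.
Qed.

(** The coefficient e depends on the label, not the position, so a transfer changes it. As e is
    nondecreasing, passing right jumps to a higher label and left jumps to a lower one can only
    increase the drift. *)
Lemma moment_drift x : \sum_j m j * (b j - a j) * e j <=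
  \sum_p elastic x p * (moment (push x p) - moment x).
Proof.
have E p : elastic x p * (moment (push x p) - moment x) =
    elastic x p * (if p.2 then m p.1 * e p.1 else - (m p.1 * e p.1)).
  have [->|ep] := eqVneq (elastic x p) 0; first by rewrite !mul0r.
  by rewrite moment_push.
rewrite (eq_bigr _ (fun p _ => E p)) sum_moves/=.
have [l [lP HB]] := transferB a b m_gt0 x.
have [l' [lP' HA]] := transferA a b m_gt0 x.
rewrite [X in _ <= X + _](eq_bigr (fun i => m i * elastic x (i, true) * e i)); last first.
  by move=> i _ /=; ring.
rewrite [X in _ <= _ + X](eq_bigr (fun i => - (m i * elastic x (i, false) * e i))); last first.
  by move=> i _ /=; ring.
rewrite sumrN HB HA -sumrB; apply: ler_sum => j _.
rewrite mulrBr mulrBl; apply: lerB; apply: ler_wpM2l.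
- by rewrite mulr_ge0// ltW.
- by apply: e_mono; case: (lP j).
- by rewrite mulr_ge0// ltW.
- by apply: e_mono; case: (lP' j).
Qed.

End linear.

Section exponential.

Definition exp_mass (th : R) x : R := \sum_j m j * expR (th * (val x j)%:~R).

Lemma exp_mass_push th x p : elastic x p != 0 -> exp_mass th (push x p) =
  exp_mass th x + m p.1 * (expR (if p.2 then th else - th) - 1) *
    expR (th * (val x p.1)%:~R).
Proof.
move=> /elastic_neq0 dp; rewrite /exp_mass val_push//.
rewrite [LHS](bigD1 p.1)//= [X in _ = X + _](bigD1 p.1)//= !ffunE eqxx.
rewrite (eq_bigr (fun j => m j * expR (th * (val x j)%:~R))); last first.
  by move=> j /negbTE jp; rewrite !ffunE jp; case: p.2; rewrite ?oppr0 addr0.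
rewrite intrD mulrDr expRD.
rewrite (_ : th * (if p.2 then 1%:R else - 1%:R)%:~R = if p.2 then th else - th).
  ring.
by case: p.2; rewrite ?mulr1// mulrN1z mulrN mulr1.
Qed.

(** The product of opposite exponents is translation invariant, hence a function of the gaps. The
    normalisation makes it at least e^(th * diameter), so at least 1 when th >= 0. *)
Definition exp_spread th x : R :=
  exp_mass th x * exp_mass (- th) x / (m ord0 * m ord_max).

Lemma exp_spread_translates th x y : translates x y ->
  exp_spread th x = exp_spread th y.
Proof.
move=> [t xy]; rewrite /exp_spread; congr (_ / _).
have E s : exp_mass s x = expR (s * t%:~R) * exp_mass s y.
  rewrite /exp_mass mulr_sumr; apply: eq_bigr => j _.
  by rewrite xy intrD mulrDr expRD; ring.
by rewrite !E mulrACA -expRD mulNr subrr expR0 mul1r.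
Qed.

Lemma exp_mass_ge0 th x : 0 <= exp_mass th x.
Proof. by apply: sumr_ge0 => j _; rewrite mulr_ge0 ?expR_ge0 ?ltW. Qed.

Lemma exp_spread_ge th x :
  expR (th * (val x ord_max - val x ord0)%:~R) <= exp_spread th x.
Proof.
have term s i : m i * expR (s * (val x i)%:~R) <= exp_mass s x.
  rewrite /exp_mass (bigD1 i)//= lerDl sumr_ge0// => j _.
  by rewrite mulr_ge0 ?expR_ge0 ?ltW.
rewrite /exp_spread ler_pdivlMr ?mulr_gt0//.
apply: le_trans (ler_pM _ _ (term th ord_max) (term (- th) ord0)).
- rewrite intrB mulrBr expRD mulNr le_eqVlt; apply/orP; left; apply/eqP; ring.
- by rewrite mulr_ge0 ?expR_ge0 ?ltW.
- by rewrite mulr_ge0 ?expR_ge0 ?ltW.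
Qed.

(* The second-order term of each jump has a favourable sign in the product of
   the two exponential masses, and m transfers inside a cluster leave
   the first-order terms equal to those of free particles. *)
Lemma exp_mass_drift th c K x : 0 < th -> 0 <= c ->
  (forall j, a j <= K /\ b j <= K) ->
  let ubar := (\sum_j m j * (b j - a j)) / \sum_j m j in
  (forall k : nat, (0 < k <= n)%N ->
     c <= \sum_(i < n.+1 | (i < k)%N) m i * (b i - a i - ubar)) ->
  let p := expR th - 1 in let q := 1 - expR (- th) in
  let M := \sum_j m j in
  \sum_p elastic x p * (exp_mass th (push x p) * exp_mass (- th) (push x p)
                        - exp_mass th x * exp_mass (- th) x) <=
  q * (2 * c * M - 2 * c / M * (exp_mass th x * exp_mass (- th) x))
  + 2 * p * q * K * (exp_mass th x * exp_mass (- th) x).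
Proof.
move=> th0 c0 abK ubar Tc; cbv zeta.
set p := expR th - 1; set q := 1 - expR (- th); set M := \sum_j m j.
set Ep := exp_mass th x; set Em := exp_mass (- th) x.
have Ep0 : 0 <= Ep := exp_mass_ge0 _ _.
have Em0 : 0 <= Em := exp_mass_ge0 _ _.
have p0 : 0 < p by rewrite subr_gt0 expR_gt1.
have q0 : 0 < q by rewrite subr_gt0 expR_lt1 oppr_lt0.
have M0 : 0 < M.
  rewrite /M (bigD1 ord0)//= ltr_pwDl// sumr_ge0// => i _; exact: ltW.
have pq : p - q = p * q.
  have := expRxMexpNx_1 th; rewrite /p /q; set u := expR th; set v := expR (- th).
  by move=> uv; lra.
pose e j := expR (th * (val x j)%:~R).
pose f j := expR (- th * (val x j)%:~R).
have ef j : e j * f j = 1 by rewrite /e /f -expRD mulNr subrr expR0.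
have e0 j : 0 <= e j := expR_ge0 _.
have f0 j : 0 <= f j := expR_ge0 _.
have EpE : Ep = \sum_j m j * e j by [].
have EmE : Em = \sum_j m j * f j by [].
(* A right jump of j multiplies [e j] by 1 + p and [f j] by 1 - q, a left jump the other way round;
   g and h are the first-order changes of Ep * Em per unit of m j. The remainder - m^2 p q is
   dropped. *)
pose g j := p * e j * Em - q * f j * Ep.
pose h j := p * f j * Ep - q * e j * Em.
have push_true i : elastic x (i, true) * (exp_mass th (push x (i, true)) *
    exp_mass (- th) (push x (i, true)) - Ep * Em) <=
    m i * elastic x (i, true) * g i.
  have [->|ei] := eqVneq (elastic x (i, true)) 0; first by rewrite mulr0 !mul0r.
  rewrite !exp_mass_push//= -/Ep -/Em -/(e i) -/(f i) -/p.
  rewrite [leRHS]mulrAC [leRHS]mulrC ler_wpM2l//.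
  rewrite (_ : expR (- th) - 1 = - q); last by rewrite opprB.
  have -> : (Ep + m i * p * e i) * (Em + m i * - q * f i) - Ep * Em =
      m i * g i - m i * m i * p * q * (e i * f i) by rewrite /g; ring.
  by rewrite ef mulr1 gerBl !mulr_ge0// ltW.
have push_false i : elastic x (i, false) * (exp_mass th (push x (i, false)) *
    exp_mass (- th) (push x (i, false)) - Ep * Em) <=
    m i * elastic x (i, false) * h i.
  have [->|ei] := eqVneq (elastic x (i, false)) 0; first by rewrite mulr0 !mul0r.
  rewrite !exp_mass_push//= -/Ep -/Em -/(e i) -/(f i) opprK -/p.
  rewrite [leRHS]mulrAC [leRHS]mulrC ler_wpM2l//.
  rewrite (_ : expR (- th) - 1 = - q); last by rewrite opprB.
  have -> : (Ep + m i * - q * e i) * (Em + m i * p * f i) - Ep * Em =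
      m i * h i - m i * m i * p * q * (e i * f i) by rewrite /h; ring.
  by rewrite ef mulr1 gerBl !mulr_ge0// ltW.
have [l [lP HB]] := transferB a b m_gt0 x.
have [l' [lP' HA]] := transferA a b m_gt0 x.
have step1 : \sum_p elastic x p * (exp_mass th (push x p) * exp_mass (- th) (push x p)
     - Ep * Em) <= \sum_j (m j * b j * g j + m j * a j * h j).
  rewrite sum_moves big_split/=; apply: lerD.
    apply: (@le_trans _ _ (\sum_i m i * elastic x (i, true) * g i)).
      by apply: ler_sum => i _; exact: push_true.
    rewrite HB le_eqVlt; apply/orP; left; apply/eqP; apply: eq_bigr => j _.
    by rewrite /g /e /f; have [_ ->] := lP j.
  apply: (@le_trans _ _ (\sum_i m i * elastic x (i, false) * h i)).
    by apply: ler_sum => i _; exact: push_false.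
  rewrite HA le_eqVlt; apply/orP; left; apply/eqP; apply: eq_bigr => j _.
  by rewrite /h /e /f; have [_ ->] := lP' j.
apply: le_trans step1 _.
pose w j := m j * (b j - a j - ubar).
have wsum : \sum_j w j = 0.
  rewrite /w; under eq_bigr do rewrite mulrBr.
  by rewrite sumrB -mulr_suml -/M /ubar mulrC divfK ?subrr// gt_eqF.
(* Writing q for p costs p - q = p q times rates at most K, whence the term in K. Subtracting ubar
   is free, since its contributions Em * Ep and Ep * Em cancel. *)
have step2 : \sum_j (m j * b j * g j + m j * a j * h j) <=
    q * (Em * \sum_j w j * e j + Ep * \sum_j w j * - f j) + 2 * p * q * K * (Ep * Em).
  have -> : 2 * p * q * K * (Ep * Em) =
      \sum_j p * q * K * (m j * e j * Em + m j * f j * Ep).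
    by rewrite -mulr_sumr big_split/= -!mulr_suml -EpE -EmE; ring.
  have -> : Em * \sum_j w j * e j + Ep * \sum_j w j * - f j =
      \sum_j m j * (b j - a j) * (e j * Em - f j * Ep).
    rewrite !mulr_sumr -big_split/=.
    rewrite (eq_bigr (fun j => m j * (b j - a j) * (e j * Em - f j * Ep) -
      ubar * (Em * (m j * e j) - Ep * (m j * f j)))); last first.
      by move=> j _; rewrite /w; ring.
    rewrite sumrB -mulr_sumr sumrB -!mulr_sumr -EpE -EmE.
    by rewrite [Em * Ep]mulrC subrr mulr0 subr0.
  rewrite mulr_sumr -big_split/=; apply: ler_sum => j _.
  have [aK bK] := abK j.
  have -> : m j * b j * g j + m j * a j * h j =
     q * (m j * (b j - a j) * (e j * Em - f j * Ep)) +
     (p - q) * (b j * (m j * e j * Em) + a j * (m j * f j * Ep)).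
    by rewrite /g /h; ring.
  rewrite lerD2l pq -[leRHS]mulrA; apply: ler_wpM2l.
    by rewrite mulr_ge0// ltW.
  rewrite mulrDr; apply: lerD; apply: ler_wpM2r => //;
    by rewrite mulr_ge0// mulr_ge0// ltW.
apply: le_trans step2 _; rewrite lerD2r ler_pM2l//.
(* Both e and - f are nondecreasing along the particles, so [abel_le] applies to each. *)
have e_mono (i j : 'I_n.+1) : (i <= j)%N -> e i <= e j.
  by move=> /(config_le x) ij; rewrite ler_expR ler_pM2l// ler_int.
have f_mono (i j : 'I_n.+1) : (i <= j)%N -> - f i <= - f j.
  by move=> /(config_le x) ij; rewrite lerN2 ler_expR !mulNr lerN2 ler_pM2l// ler_int.
have A1 : \sum_j w j * e j <= - (c * (e ord_max - e ord0)) by apply: abel_le.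
have A2 : \sum_j w j * - f j <= - (c * (- f ord_max - - f ord0)).
  exact: (@abel_le _ _ w (fun j => - f j)).
have B1 := ler_wpM2l Em0 A1; have B2 := ler_wpM2l Ep0 A2.
have e_max j : e j <= e ord_max by apply: e_mono; rewrite -ltnS.
have f_max j : f j <= f ord0 by rewrite -lerN2; apply: f_mono.
(* The largest values dominate the averages Ep / M and Em / M; the smallest ones are harmless since
   e ord0 * f j <= e j * f j = 1. *)
have C1 : Ep / M <= e ord_max.
  rewrite ler_pdivrMr// EpE mulr_sumr; apply: ler_sum => j _.
  by rewrite mulrC ler_wpM2r// ltW.
have C2 : Em / M <= f ord0.
  rewrite ler_pdivrMr// EmE mulr_sumr; apply: ler_sum => j _.
  by rewrite mulrC ler_wpM2r// ltW.
have C3 : Em * e ord0 <= M.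
  rewrite EmE mulr_suml; apply: ler_sum => j _.
  rewrite -mulrA -[leRHS]mulr1 (ler_wpM2l (ltW (m_gt0 j)))// -(ef j) mulrC ler_wpM2r//.
  exact: e_mono.
have C4 : Ep * f ord_max <= M.
  rewrite EpE mulr_suml; apply: ler_sum => j _.
  rewrite -mulrA -[leRHS]mulr1 (ler_wpM2l (ltW (m_gt0 j)))// -(ef j) ler_wpM2l//.
  by rewrite -lerN2; apply: f_mono; rewrite -ltnS.
have D1 := ler_wpM2l Em0 C1; have D2 := ler_wpM2l Ep0 C2.
apply: le_trans (lerD B1 B2) _.
rewrite [X in _ <= X](_ : _ = c * (2 * M - Em * (Ep / M) - Ep * (Em / M))); last first.
  by field; rewrite gt_eqF.
rewrite [X in X <= _](_ : _ = c * (Em * e ord0 + Ep * f ord_max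
  - Em * e ord_max - Ep * f ord0)); last by ring.
rewrite ler_wpM2l//.
by set u1 := Em * e ord0 in C3 *; set u2 := Ep * f ord_max in C4 *;
   set u3 := Em * e ord_max in D1 *; set u4 := Ep * f ord0 in D2 *;
   set u5 := Em * (Ep / M) in D1 *; set u6 := Ep * (Em / M) in D2 *; lra.
Qed.

End exponential.
End elastic_drift.

(** * The gaps as a chain with finitely many moves *)

Section gap_chain.
Context {R : realType} {n : nat}.
Variables (m a b : 'I_n.+1 -> R).
Hypotheses (m_gt0 : forall i, 0 < m i) (a_ge0 : forall i, 0 <= a i)
  (b_ge0 : forall i, 0 <= b i).
Implicit Types (x y : config n) (i j : 'I_n.+1) (p : 'I_n.+1 * bool).
Implicit Types (z : {ffun 'I_n -> nat}).
Local Notation elastic := (elastic m a b).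

Definition gap_rate z p : R := elastic (anchored z) p.

Definition gap_move z p : {ffun 'I_n -> nat} := gap (push (anchored z) p).

Let ubar := (\sum_j m j * (b j - a j)) / \sum_j m j.

Let mass_gt0 : 0 < \sum_j m j.
Proof. by rewrite (bigD1 ord0)//= ltr_pwDl// sumr_ge0// => i _; exact: ltW. Qed.

Lemma Mmass_total : Mmass m n.+1 = \sum_j m j.
Proof. by apply: eq_bigl => i; rewrite ltn_ord. Qed.

Lemma Mmass_gt0 k : (0 < k)%N -> 0 < Mmass m k.
Proof.
move=> k0; rewrite /Mmass (bigD1 ord0)//= ltr_pwDl// sumr_ge0// => i _.
exact: ltW.
Qed.

Lemma Mmass_lt k : (k < n.+1)%N -> Mmass m k < Mmass m n.+1.
Proof.
move=> kn; rewrite Mmass_total (bigID (fun i : 'I_n.+1 => (i < k)%N))/=.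
rewrite ltrDl (bigD1 (Ordinal kn))/= ?ltnn// ltr_pwDl// sumr_ge0// => i _.
exact: ltW.
Qed.

(* This is c_k = (M_k / M_N) U_N - U_k, by [excessE]. *)
Definition excess (k : nat) : R :=
  \sum_(i < n.+1 | (i < k)%N) m i * (b i - a i - ubar).

Lemma Umass_total : Umass m a b n.+1 = - \sum_j m j * (b j - a j).
Proof. by congr (- _); apply: eq_bigl => i; rewrite ltn_ord. Qed.

Lemma excessE k : excess k = Mmass m k * (Umass m a b n.+1 / Mmass m n.+1) - Umass m a b k.
Proof.
rewrite /excess (eq_bigr (fun i => m i * (b i - a i) - m i * ubar)); last first.
  by move=> i _; rewrite mulrBr.
rewrite sumrB -mulr_suml -/(Mmass m k) /Umass opprK addrC; congr (_ + _).
by rewrite -mulrN; congr (_ * _); rewrite -/(Umass m a b n.+1) Umass_total Mmass_total mulNr.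
Qed.

Lemma excess_gt0 k : (0 < k)%N -> (0 < excess k) =
  (Umass m a b k / Mmass m k < Umass m a b n.+1 / Mmass m n.+1).
Proof.
by move=> k0; rewrite excessE subr_gt0 ltr_pdivrMr ?Mmass_gt0// mulrC.
Qed.

Section recurrence_criterion.
Variable k : nat.
Hypotheses (k_gt0 : (0 < k)%N) (k_le : (k <= n)%N).

(** With these coefficients [moment] is the functional D_k. *)
Definition weight j : R := Mmass m k / Mmass m n.+1 - (j < k)%N%:R.

Lemma weight_mono i j : (i <= j)%N -> weight i <= weight j.
Proof.
move=> ij; rewrite lerD2l lerN2 ler_nat.
by case: (ltnP j k) => // jk; rewrite (leq_ltn_trans ij jk).
Qed.

Lemma weight_mean : \sum_j m j * weight j = 0.
Proof.
rewrite /weight (eq_bigr (fun j => m j * (Mmass m k / Mmass m n.+1) -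
  (if (j < k)%N then m j else 0))); last first.
  by move=> j _; rewrite mulrBr; case: (j < k)%N; rewrite ?mulr1 ?mulr0.
rewrite sumrB -mulr_suml -Mmass_total -big_mkcond/= -/(Mmass m k).
by rewrite mulrC divfK ?subrr// gt_eqF// Mmass_gt0.
Qed.

(** From 0 < M_k < M_N; this is why every jump changes D_k. *)
Lemma weight_neq0 j : weight j != 0.
Proof.
have M0 := Mmass_gt0 k_gt0; have MN0 := Mmass_gt0 (ltn0Sn n).
have lt1 : Mmass m k / Mmass m n.+1 < 1.
  by rewrite ltr_pdivrMr// mul1r Mmass_lt.
rewrite /weight; case: (j < k)%N.
  by rewrite subr_eq0 lt_eqF.
by rewrite subr0 gt_eqF// divr_gt0.
Qed.

Lemma weight_drift : \sum_j m j * (b j - a j) * weight j = - excess k.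
Proof.
rewrite excessE opprB /weight (eq_bigr (fun j => m j * (b j - a j) *
    (Mmass m k / Mmass m n.+1) - (if (j < k)%N then m j * (b j - a j) else 0))).
  rewrite sumrB -mulr_suml -big_mkcond/= addrC; congr (_ + _).
  by rewrite Umass_total; ring.
by move=> j _; rewrite mulrBr; case: (j < k)%N; rewrite ?mulr1 ?mulr0.
Qed.

End recurrence_criterion.

Section active.
Hypothesis active : 0 < \sum_j m j * (a j + b j).

Lemma elastic_regular : regular_moves elastic push.
Proof.
split; [exact: elastic_ge0| |by move=> x; exact: elastic_tot_gt0].
move=> x [i d] /elastic_neq0 dp; apply/eqP => /(congr1 val).
rewrite val_push// => /ffunP/(_ i); rewrite ffunE /= eqxx.
by case: d {dp} => /eqP; rewrite -subr_eq0 addrAC subrr add0r.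
Qed.

Hypothesis n_gt0 : (0 < n)%N.

Lemma gap_moment (k : nat) z p : gap_rate z p != 0 -> (0 < k)%N -> (k <= n)%N ->
  moment m (weight k) (anchored (gap_move z p)) - moment m (weight k) (anchored z) =
  if p.2 then m p.1 * weight k p.1 else - (m p.1 * weight k p.1).
Proof.
move=> rp k0 kn; rewrite -(moment_push (weight k) rp); congr (_ - _).
apply/esym/(moment_translates (weight_mean k)); exact: translates_anchored.
Qed.

(** The moment for k = 1 depends only on the gaps and every jump changes it, so no jump leaves the
    gaps fixed. *)
Lemma gap_regular : regular_moves gap_rate gap_move.
Proof.
split; [by move=> z p; exact: elastic_ge0| |by move=> z; exact: elastic_tot_gt0].
move=> z p rp; apply/eqP => mvz.
have := gap_moment rp (ltn0Sn 0) n_gt0; rewrite mvz subrr => /eqP.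
have w0 := weight_neq0 (ltn0Sn 0) n_gt0 p.1.
have := gt_eqF (m_gt0 p.1) => m0.
by case: p.2; rewrite eq_sym ?oppr_eq0 mulf_eq0 m0 (negbTE w0).
Qed.

Lemma gap_jump_process {d : measure_display} {Omega : measurableType d}
    (P : config n -> probability Omega R) (X : R -> Omega -> config n) :
  is_jump_process (elastic_rate m a b) P X ->
  is_jump_process (move_rate gap_rate gap_move) (fun z => P (anchored z))
    (fun t w => gap (X t w)).
Proof.
rewrite (elastic_rate_move m a b); apply: lumped_jump_process.
- exact: elastic_regular.
- exact: gap_regular.
- exact: anchoredK.
- by move=> x p; apply: elastic_translates; exact: translates_anchored.
- move=> x p xp; apply: gap_translates; apply: push_translates.
    exact: elastic_neq0 xp.
  exact: translates_anchored.
Qed.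

Lemma gap_tot_le : exists Lam, forall z, tot gap_rate z <= Lam.
Proof.
have [Lam H] := elastic_tot_le m_gt0 a_ge0 b_ge0.
by exists Lam => z; exact: H.
Qed.

Lemma gap_moment_drift k z : (0 < k)%N -> (k <= n)%N -> excess k <= 0 ->
  tot gap_rate z * moment m (weight k) (anchored z) <=
  \sum_p gap_rate z p * moment m (weight k) (anchored (gap_move z p)).
Proof.
move=> k0 kn ex0; rewrite -subr_ge0 /tot mulr_suml -sumrB.
have := moment_drift m_gt0 a_ge0 b_ge0 (@weight_mono k) (anchored z).
rewrite weight_drift => H.
apply: le_trans (_ : - excess k <= _); first by rewrite oppr_ge0.
apply: le_trans H _; rewrite le_eqVlt; apply/orP; left; apply/eqP.
apply: eq_bigr => p _; rewrite mulrBr; congr (_ * _ - _).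
apply: (moment_translates (weight_mean k)); exact: translates_anchored.
Qed.

Section reach.
Hypothesis excess_pos : forall k, (0 < k <= n)%N -> 0 < excess k.

(** The first excess gives b_1 - a_1 > ubar and the last one b_N - a_N < ubar. If b_1 = 0, then ubar
    < 0, which forces a_N > 0. *)
Let outer_active : 0 < b ord0 \/ 0 < a ord_max.
Proof.
have h1 : 0 < excess 1 by apply: excess_pos.
have h2 : 0 < excess n by apply: excess_pos; rewrite n_gt0 leqnn.
rewrite /excess (big_pred1 ord0) in h1; last by move=> i; rewrite ltnS leqn0.
rewrite pmulr_rgt0// in h1.
have : \sum_i m i * (b i - a i - ubar) = 0.
  under eq_bigr do rewrite mulrBr.
  by rewrite sumrB -mulr_suml /ubar mulrC divfK ?subrr// gt_eqF.
rewrite (bigD1 ord_max)//= => tot0.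
have e : \sum_(i < n.+1 | i != ord_max) m i * (b i - a i - ubar) = excess n.
  apply: eq_bigl => i; rewrite -val_eqE /= [RHS]ltn_neqAle.
  by rewrite -ltnS ltn_ord andbT.
rewrite e in tot0.
have h3 : m ord_max * (b ord_max - a ord_max - ubar) < 0 by lra.
rewrite pmulr_rlt0// in h3.
have := a_ge0 ord0; have := b_ge0 ord_max => bm am.
case: (ltP 0 (b ord0)) => b0; first by left.
by right; lra.
Qed.

Let all_equal x : (forall j, val x j = val x ord0) -> gap x = [ffun=> 0%N].
Proof. by move=> h; apply/ffunP => i; rewrite !ffunE !h subrr. Qed.

(** If b_1 > 0, the last particle of the first cluster can always jump right, which brings it closer
    to particle N until the configuration has collapsed; the sum of distances to particle N
    decreases. If a_N > 0, the mirror argument uses the last cluster and particle 1. *)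
Lemma gap_reaches z : reaches gap_rate gap_move [ffun=> 0%N] z.
Proof.
have absz_translates (i0 : 'I_n.+1) x y : translates x y ->
    (\sum_j `|val x i0 - val x j|)%N = (\sum_j `|val y i0 - val y j|)%N.
  by move=> [t xy]; apply: eq_bigr => j _; rewrite !xy; congr absz; lia.
have closer_right (u v : int) : u < v ->
    (`|(v - (u + true%:R))%R| < `|(v - u)%R|)%N by rewrite mulr1n; lia.
have closer_left (u v : int) : u < v ->
    (`|(u - (v + - true%:R))%R| < `|(u - v)%R|)%N by rewrite mulr1n; lia.
case: outer_active => out.
  have [N] := ubnP (\sum_j `|val (anchored z) ord_max - val (anchored z) j|)%N.
  elim: N z => // N IH z zN; set x := anchored z in zN *.
  have [i [_ xi li]] := block_last x ord0.
  have [im|im] := eqVneq i ord_max.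
    rewrite -(anchoredK z) all_equal; first exact: reaches_refl.
    move=> j; apply/eqP; rewrite eq_le (config_le x (leq0n j : (@ord0 n <= j)%N)) andbT -xi im.
    by apply: config_le; rewrite -ltnS.
  have ei : 0 < elastic x (i, true).
    rewrite /elastic /rateB /= -/(is_last x i) li mul1r.
    rewrite (bigD1 ord0)//= -xi eqxx mulr1 ltr_pwDl//.
      by rewrite divr_gt0// mulr_gt0.
    apply: sumr_ge0 => j _; apply: mulr_ge0 => //.
    by apply: divr_ge0; [rewrite mulr_ge0// ltW|exact: ltW].
  apply: (@reaches_step _ _ _ gap_rate gap_move _ z (i, true)) => //.
  apply: IH; rewrite -ltnS; apply: leq_trans zN; rewrite ltnS.
  rewrite -(absz_translates _ _ _ (translates_anchored (push x (i, true)))).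
  rewrite [ltnRHS](bigD1 i)//= [ltnLHS](bigD1 i)//= -addSn leq_add//.
    rewrite val_push// !ffunE /= eqxx [ord_max == i]eq_sym (negbTE im) addr0.
    have lt_i : (i < @ord_max n)%N.
      by rewrite ltn_neqAle -val_eqE in im *; rewrite im -ltnS ltn_ord.
    have := is_lastP li lt_i; rewrite /x /= !ffunE; exact: closer_right.
  apply: leq_sum => j ji; rewrite val_push// !ffunE /= (negbTE ji).
  by rewrite [ord_max == i]eq_sym (negbTE im) !addr0.
have [N] := ubnP (\sum_j `|val (anchored z) ord0 - val (anchored z) j|)%N.
elim: N z => // N IH z zN; set x := anchored z in zN *.
have [i [_ xi fi]] := block_first x ord_max.
have [i0|i0] := eqVneq i ord0.
  rewrite -(anchoredK z) all_equal; first exact: reaches_refl.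
  move=> j; apply/eqP; rewrite eq_le (config_le x (leq0n j : (@ord0 n <= j)%N)) andbT -i0 xi.
  by apply: config_le; rewrite -ltnS.
have ei : 0 < elastic x (i, false).
  rewrite /elastic /rateA /= -/(is_first x i) fi mul1r.
  rewrite (bigD1 ord_max)/= -?xi ?eqxx ?mulr1; last by rewrite -ltnS.
  rewrite ltr_pwDl//.
    by rewrite divr_gt0// mulr_gt0.
  apply: sumr_ge0 => j _; apply: mulr_ge0 => //.
  by apply: divr_ge0; [rewrite mulr_ge0// ltW|exact: ltW].
apply: (@reaches_step _ _ _ gap_rate gap_move _ z (i, false)) => //.
apply: IH; rewrite -ltnS; apply: leq_trans zN; rewrite ltnS.
rewrite -(absz_translates _ _ _ (translates_anchored (push x (i, false)))).
rewrite [ltnRHS](bigD1 i)//= [ltnLHS](bigD1 i)//= -addSn leq_add//.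
  rewrite val_push// !ffunE /= eqxx [ord0 == i]eq_sym (negbTE i0) oppr0 addr0.
  have lt_i : (@ord0 n < i)%N by rewrite lt0n -val_eqE in i0 *.
  have := is_firstP fi lt_i; rewrite /x /= !ffunE; exact: closer_left.
apply: leq_sum => j ji; rewrite val_push// !ffunE /= (negbTE ji).
by rewrite [ord0 == i]eq_sym (negbTE i0) !oppr0 !addr0.
Qed.

End reach.
End active.
End gap_chain.

Lemma finite_small_gaps n (K : nat) : exists F : seq {ffun 'I_n -> nat},
  forall z : {ffun 'I_n -> nat}, z \notin F -> (K <= \sum_i z i)%N.
Proof.
exists [seq [ffun i => val (f i)] | f : {ffun 'I_n -> 'I_K.+1}] => z.
apply: contraNT; rewrite -ltnNge => zK; apply/mapP.
have zi i : (z i < K.+1)%N.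
  by rewrite ltnS; apply: leq_trans (ltnW zK); rewrite (bigD1 i)//= leq_addr.
exists [ffun i => Ordinal (zi i)]; first by rewrite mem_enum.
by apply/ffunP => i; rewrite !ffunE.
Qed.

Lemma positive_lower_bound {R : realType} n (f : nat -> R) :
  (forall k, (0 < k <= n)%N -> 0 < f k) ->
  exists2 c, 0 < c & forall k, (0 < k <= n)%N -> c <= f k.
Proof.
elim: n => [|n IH] f0.
  by exists 1 => // k /andP[k0]; rewrite leqNgt k0.
have [k /andP[k0 kn]|c c0 cf] := IH; first by apply: f0; rewrite k0 leqW.
exists (Num.min c (f n.+1)); first by rewrite lt_min c0 f0 /=.
move=> k /andP[k0]; rewrite leq_eqVlt => /predU1P[->|kn].
  by rewrite ge_min lexx orbT.
by rewrite ge_min cf// k0.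
Qed.

Section elastic_criterion.
Context {R : realType} {n : nat}.
Variables (m a b : 'I_n.+1 -> R).
Hypotheses (m_gt0 : forall i, 0 < m i) (a_ge0 : forall i, 0 <= a i)
  (b_ge0 : forall i, 0 <= b i).
Implicit Types (z : {ffun 'I_n -> nat}).

Lemma gap_drift (excess_pos : forall k, (0 < k <= n)%N -> 0 < excess m a b k) :
  0 < \sum_j m j * (a j + b j) -> (0 < n)%N ->
  exists V delta th, [/\ drift_away (gap_rate m a b) gap_move [ffun=> 0%N] V delta,
    0 < th & forall z, expR (th * (\sum_i z i)%:R) <= V z].
Proof.
move=> active n0.
have [c c0 cE] := positive_lower_bound excess_pos.
pose K := \sum_j (a j + b j).
have abK j : a j <= K /\ b j <= K.
  have Kj : a j + b j <= K.
    by rewrite /K (bigD1 j)//= lerDl sumr_ge0// => i _; rewrite addr_ge0.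
  by split; apply: le_trans Kj; rewrite ?lerDl ?lerDr.
have K0 : 0 <= K by rewrite sumr_ge0// => i _; rewrite addr_ge0.
pose M := \sum_j m j.
have M0 : 0 < M.
  by rewrite /M (bigD1 ord0)//= ltr_pwDl// sumr_ge0// => i _; exact: ltW.
have Mn0 : M != 0 by rewrite gt_eqF.
have K1n0 : K + 1 != 0 by rewrite gt_eqF// ltr_wpDl.
(* Chosen so that the error 2 p q K is at most half of the restoring rate 2 q c / M; the 1 keeps the
   denominator positive. Then th is the exponent with e^th - 1 = p. *)
pose p := c / (2 * M * (K + 1)).
have p0 : 0 < p by rewrite divr_gt0// mulr_gt0 ?mulr_gt0// ltr_wpDl.
pose th := ln (1 + p).
have th0 : 0 < th by rewrite ln_gt0// ltrDl.
have thE : expR th = 1 + p by rewrite lnK// posrE addr_gt0.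
pose q := 1 - expR (- th).
have q0 : 0 < q by rewrite subr_gt0 expR_lt1 oppr_lt0.
have pK : 2 * p * K <= c / M.
  rewrite /p (_ : 2 * _ * K = c / M * (K / (K + 1))); last first.
    by field; rewrite ?Mn0 ?K1n0.
  rewrite -[leRHS]mulr1 ler_wpM2l ?divr_ge0 ?(ltW c0) ?(ltW M0)//.
  by rewrite ler_pdivrMr ?mul1r ?lerDl// ltr_wpDl.
pose mm := m ord0 * m ord_max.
have mm0 : 0 < mm by rewrite mulr_gt0.
pose V0 z := exp_spread m th (anchored z).
have V0_ge z : expR (th * (\sum_i z i)%:R) <= V0 z.
  apply: le_trans (exp_spread_ge m_gt0 th (anchored z)).
  have -> : val (anchored z) ord0 = 0 by rewrite /= ffunE big_pred0.
  have -> : val (anchored z) ord_max = Posz (\sum_i z i).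
    by rewrite /= ffunE; congr Posz; apply: eq_bigl => i; rewrite ltn_ord.
  by rewrite subr0.
have V01 z : 1 <= V0 z.
  by apply: le_trans (V0_ge z); rewrite -expR0 ler_expR mulr_ge0 ?(ltW th0).
pose d0 := q * c / M; pose bb := 2 * q * c * M / mm.
have d00 : 0 < d0 by rewrite divr_gt0// mulr_gt0.
have bb0 : 0 <= bb by rewrite divr_ge0 ?(ltW mm0)// !mulr_ge0// ltW.
have V0_drift z : \sum_i gap_rate m a b z i * V0 (gap_move z i) <=
    (tot (gap_rate m a b) z - d0) * V0 z + bb.
  pose x := anchored z; pose G y := exp_mass m th y * exp_mass m (- th) y.
  have GE y : exp_spread m th y = G y / mm by [].
  have := exp_mass_drift m_gt0 a_ge0 b_ge0 x th0 (ltW c0) abK cE.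
  cbv zeta; rewrite -/M -/q -/(G x).
  rewrite (_ : expR th - 1 = p); last by rewrite thE addrAC subrr add0r.
  move=> drift.
  have G0 : 0 <= G x by rewrite mulr_ge0 ?exp_mass_ge0.
  have qG0 : 0 <= q * G x by rewrite mulr_ge0// ltW.
  have pKG := ler_wpM2l qG0 pK.
  have drift' : \sum_p elastic m a b x p * (G (push x p) - G x) <=
      2 * q * c * M - d0 * G x.
    apply: le_trans drift _; rewrite /d0.
    rewrite [X in X + _ <= _](_ : _ = 2 * q * c * M - 2 * (q * G x * (c / M))); last by ring.
    rewrite [X in _ + X <= _](_ : _ = q * G x * (2 * p * K)); last by ring.
    rewrite [X in _ <= _ - X](_ : _ = q * G x * (c / M)); last by ring.
    by move: pKG; set u1 := q * G x * (c / M); set u2 := q * G x * (2 * p * K) => h; lra.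
  have sumE : \sum_i gap_rate m a b z i * V0 (gap_move z i) - tot (gap_rate m a b) z * V0 z =
      (\sum_p elastic m a b x p * (G (push x p) - G x)) / mm.
    rewrite /tot [X in _ - X]mulr_suml -sumrB [RHS]mulr_suml; apply: eq_bigr => i _.
    rewrite /V0 -(exp_spread_translates m th (translates_anchored (push x i))) !GE.
    by rewrite /gap_rate -/x; ring.
  rewrite mulrBl -addrA -lerBlDl sumE ler_pdivrMr//.
  apply: le_trans drift' _; rewrite /V0 GE /bb -/x le_eqVlt; apply/orP; left; apply/eqP.
  by field; rewrite gt_eqF.
(* Off F the total gap exceeds 2 bb / (d0 th), and V0 >= e^u >= u for u = th times that gap. *)
have [F FE] := finite_small_gaps n (Num.trunc (2 * bb / d0 / th)).+1.
have large z : z \notin F -> bb <= d0 / 2 * V0 z.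
  move=> /FE zK.
  have : 2 * bb / d0 / th < (\sum_i z i)%:R.
    by apply: lt_le_trans (truncnS_gt _) _; rewrite ler_nat.
  rewrite ltr_pdivrMr// [ltRHS]mulrC => h.
  have h2 : 2 * bb / d0 <= V0 z.
    apply: le_trans (V0_ge z); apply: le_trans (ltW h) _.
    by apply: le_trans (expR_ge1Dx _); rewrite lerDr.
  move: h2; rewrite ler_pdivrMr// => h2; lra.
have reg := gap_regular m_gt0 a_ge0 b_ge0 active n0.
have rea := gap_reaches m_gt0 a_ge0 b_ge0 active n0 excess_pos.
have [V [delta [dV VV]]] := drift_patch reg d00 bb0 V01 V0_drift large rea.
exists V, delta, th; split => // z.
exact: le_trans (V0_ge z) (VV z).
Qed.

(** With exit rate zero, W 0 exceeds every integer almost surely. *)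
Lemma inactive_frozen {d : measure_display} {Omega : measurableType d}
    (P : config n -> probability Omega R) (X : R -> Omega -> config n) x :
  is_jump_process (elastic_rate m a b) P X -> (forall p, elastic m a b x p = 0) ->
  {ae P x, forall w, forall t, 0 <= t -> X t w = x}.
Proof.
move=> [Y [W [[mY mW] W0 nonexp XY law]]] el0.
have exit0 : exit_rate (elastic_rate m a b) x = 0.
  rewrite /exit_rate esum1// => y _; rewrite elastic_rate_move /move_rate.
  by rewrite big1// => p _; rewrite el0 mul0r.
pose E (s : nat) := [set w | forall k, (k <= 0)%N ->
  Y k w = x /\ ((s%:R : R)%:E < W k w)%E].
have mE s : measurable (E s).
  rewrite (_ : E s = [set w | Y 0%N w = x] `&`
      [set w | (s%:R%:E < W 0%N w)%E]).
    apply: measurableI => //; exact: measurable_tail.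
  apply/seteqP; split => w /=; first by move=> /(_ 0%N isT).
  by move=> [h1 h2] k; rewrite leqn0 => /eqP ->.
have PE s : P x (E s) = 1%E.
  rewrite (law x 0%N (fun=> x) (fun=> s%:R))// eqxx big_ord0 big_ord_recl big_ord0.
  by rewrite exit0 mul0r oppr0 expR0 !mulr1.
have : (P x).-negligible (\bigcup_s ~` E s).
  apply: negligible_bigcup => s; apply/negligibleP; first exact: measurableC.
  by apply: etrans (probability_setC (P x) (mE s)) _; rewrite PE subee.
apply: negligibleS => w /= /existsNP[t] /not_implyP[t0 Xt].
exists (Num.trunc t).+1 => //= Et; apply: Xt.
have [Y0 tW] := Et 0%N isT.
have J0 : (\sum_(k < 0) W k w = 0)%E by rewrite big_ord0.
rewrite -Y0; apply: XY; first by rewrite J0 lee_fin.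
rewrite big_ord_recl big_ord0 adde0; apply: lt_trans tW.
by rewrite lte_fin truncnS_gt.
Qed.

End elastic_criterion.

Theorem corollary1p5 (R : realType) (n : nat) (m a b : 'I_n.+1 -> R)
    (m_gt0 : forall i, 0 < m i)
    (a_ge0 : forall i, 0 <= a i)
    (b_ge0 : forall i, 0 <= b i)
    (d : measure_display) (Omega : measurableType d)
    (P : config n -> probability Omega R)
    (X : R -> Omega -> config n)
    (X_elastic : is_jump_process (elastic_rate m a b) P X) :
  let eta := fun (t : R) (w : Omega) => gap (X t w) in
  let Peta := fun z : {ffun 'I_n -> nat} => P (anchored z) in
  (positive_recurrent Peta eta <->
   forall k : nat, (0 < k)%N -> (k < n.+1)%N ->
     Umass m a b k / Mmass m k < Umass m a b n.+1 / Mmass m n.+1)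
  /\ (positive_recurrent Peta eta -> geometrically_ergodic Peta eta).
Proof.
move=> eta Peta.
(* A single particle: there is one state, it is absorbing, and the condition is empty. *)
have [n0|n_gt0] := posnP n.
  have gap1 (z z' : {ffun 'I_n -> nat}) : z = z'.
    by apply/ffunP => i; have := ltn_ord i; rewrite [X in (_ < X)%N]n0.
  have rec : positive_recurrent Peta eta.
    exists [ffun=> 0%N]; split.
      by left; apply: aeW => w t _; exact: gap1.
    by move=> x; apply: aeW => w; exists 0.
  split; first by split => // _ k k0 kn; exfalso; move: kn; rewrite n0 ltnS leqNgt k0.
  move=> _; pose z0 : {ffun 'I_n -> nat} := [ffun=> 0%N].
  have setT1 : [set: {ffun 'I_n -> nat}] = [set z0].
    by apply/seteqP; split => z _ //=; exact: gap1.
  exists (fun=> 1); split.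
  - split => //; first by rewrite setT1 esum_set1.
    move=> t y t0; rewrite setT1 esum_set1; last by rewrite mul1e.
    rewrite mul1e (_ : mkset _ = setT) ?probability_setT//.
    by apply/seteqP; split => w _ //=; exact: gap1.
  - move=> pi' [p0 + _] z; rewrite setT1 esum_set1 ?lee_fin// (gap1 z z0).
    by move=> [].
  - exists 1 => //; rewrite setT1 esum_set1; first exact: ltry.
    by rewrite lee_fin mulr_ge0// expR_ge0.
(* If all rates vanish, a chain started elsewhere never reaches the candidate state, so recurrence
   fails; the condition fails too, all U_k being zero. *)
have [inactive|active] := leP (\sum_j m j * (a j + b j)) 0.
  have ab0 j : a j = 0 /\ b j = 0.
    have h0 i : 0 <= m i * (a i + b i) by rewrite mulr_ge0 ?addr_ge0// ltW.
    have : m j * (a j + b j) <= 0.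
      apply: le_trans inactive; rewrite (bigD1 j)//= lerDl.
      by rewrite sumr_ge0.
    rewrite pmulr_rle0// => h; have := a_ge0 j; have := b_ge0 j => bj aj.
    by split; lra.
  have el0 x p : elastic m a b x p = 0.
    rewrite /elastic /rateA /rateB; case: p.2; rewrite big1 ?mulr0// => j _;
    by have [aj bj] := ab0 j; rewrite ?aj ?bj mulr0 !mul0r.
  have norec : ~ positive_recurrent Peta eta.
    move=> [z [_ /(_ [ffun i => (z i).+1])]].
    set z' : {ffun 'I_n -> nat} := [ffun i => (z i).+1].
    move=> hit; have frozen := inactive_frozen X_elastic (el0 (anchored z')).
    have : {ae Peta z', forall w, False}.
      apply: filterS2 hit frozen => w [t t0 Zt] /(_ t t0) Xt.
      move: Zt; rewrite /eta Xt anchoredK => /ffunP/(_ (Ordinal n_gt0)).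
      by rewrite ffunE => /eqP; rewrite eqn_leq ltnn.
    move=> [N [mN PN0 sN]]; have : (Peta z' setT <= Peta z' N)%E.
      by apply: le_measure; rewrite ?inE// => w _; apply: sN => /=.
    by rewrite [X in (_ <= X)%E]PN0 [X in (X <= _)%E]probability_setT lee_fin ler10.
  split; last by move=> /norec.
  split; first by move=> /norec.
  have U0 k : Umass m a b k = 0.
    rewrite /Umass big1 ?oppr0// => i _; have [-> ->] := ab0 i.
    by rewrite subrr mulr0.
  by move=> /(_ 1%N isT); rewrite ltnS => /(_ n_gt0); rewrite !U0 !mul0r ltxx.
have reg := gap_regular m_gt0 a_ge0 b_ge0 active n_gt0.
have [Lam tot_le] := gap_tot_le m_gt0 a_ge0 b_ge0.
have [Y [W path]] : exists Y W,
    jump_path (move_rate (gap_rate m a b) gap_move) Peta eta Y W.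
  by have := gap_jump_process m_gt0 a_ge0 b_ge0 active n_gt0 X_elastic.
have nec : positive_recurrent Peta eta ->
    forall k, (0 < k <= n)%N -> 0 < excess m a b k.
  move=> [z [recz _]] k /andP[k0 kn]; rewrite ltNge; apply/negP => ex0.
  have [C alC] := positive_recurrent_summable reg path tot_le recz.
  pose D y := moment m (weight m k) (anchored y).
  pose B := \sum_j m j * `|weight m k j|.
  have DB y p : gap_rate m a b y p != 0 -> `|D (gap_move y p) - D y| <= B.
    move=> rp; rewrite /D (gap_moment m_gt0 rp)//.
    have -> : `|if p.2 then m p.1 * weight m k p.1 else - (m p.1 * weight m k p.1)|
        = m p.1 * `|weight m k p.1|.
      by case: p.2; rewrite ?normrN normrM gtr0_norm.
    by rewrite /B (bigD1 p.1)//= lerDl sumr_ge0// => j _; rewrite mulr_ge0// ltW.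
  have Ddrift y : tot (gap_rate m a b) y * D y <=
      \sum_p gap_rate m a b y p * D (gap_move y p).
    exact: gap_moment_drift.
  have Dle p := return_submartingale (i := p) reg DB Ddrift alC.
  have Dlt p : gap_rate m a b z p != 0 -> D (gap_move z p) < D z.
    move=> rp; rewrite lt_neqAle Dle// andbT -subr_eq0 /D (gap_moment m_gt0 rp)//.
    have w0 := weight_neq0 m_gt0 k0 kn p.1.
    by case: p.2; rewrite ?oppr_eq0 mulf_eq0 negb_or w0 gt_eqF.
  have r0 p : 0 <= gap_rate m a b z p by case: reg.
  have [p rp] : exists p, gap_rate m a b z p != 0.
    apply/existsP; apply: contraT; rewrite negb_exists => /forallP h.
    have : 0 < tot (gap_rate m a b) z by case: reg.
    rewrite /tot big1 ?ltxx// => p _; apply/eqP; have := h p.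
    by rewrite negbK.
  have := Ddrift z; rewrite leNgt => /negP; apply.
  rewrite /tot mulr_suml (bigD1 p)//= [ltRHS](bigD1 p)//=; apply: ltr_leD.
    by rewrite ltr_pM2l ?Dlt// lt_neqAle eq_sym rp r0.
  apply: ler_sum => p' _; have [->|rp'] := eqVneq (gap_rate m a b z p') 0.
    by rewrite !mul0r.
  by rewrite ler_wpM2l// ltW// Dlt.
have suf : (forall k, (0 < k <= n)%N -> 0 < excess m a b k) ->
    positive_recurrent Peta eta /\ geometrically_ergodic Peta eta.
  move=> ex; have [V [delta [th [dV th0 Vth]]]] :=
    gap_drift m_gt0 a_ge0 b_ge0 ex active n_gt0.
  split; first exact: (drift_positive_recurrent reg path dV tot_le).
  have [pi [pi0 pi1 pib piV]] := drift_balance reg dV tot_le.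
  have spi := stationary_of_balance reg path tot_le pi0 pi1 pib.
  exists pi; split => //.
  - move=> pi' spi' z; apply/esym.
    apply: (stationary_unique reg path _ spi spi').
    exact: (gap_reaches m_gt0 a_ge0 b_ge0 active n_gt0 ex).
  - exists th => //; apply: le_lt_trans piV; apply: le_esum => z _.
    by rewrite lee_fin ler_wpM2l.
have condE : (forall k : nat, (0 < k)%N -> (k < n.+1)%N ->
     Umass m a b k / Mmass m k < Umass m a b n.+1 / Mmass m n.+1) <->
    (forall k, (0 < k <= n)%N -> 0 < excess m a b k).
  split=> [h k /andP[k0 kn]|h k k0 kn].
    by rewrite excess_gt0// h.
  by rewrite -excess_gt0// h// k0.
split; last by move=> /nec/suf[].
by split => [/nec/condE|/condE/suf[]].
Qed.
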